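(* Fix $\varepsilon>0$. Let $L\ge1$ be an integer, $K_1,\dots,K_L\subseteq[N]$ pairwise disjoint, $x_0=\sum_{i=1}^L i\,\mathbb{1}_{K_i}$, $K=\bigcup_{i=1}^LK_i$, $\hat K=K\setminus K_L$, $k=|K|$, $\hat k=|\hat K|$, $k_L=|K_L|$. Let $A\in\mathbb{R}^{m\times N}$ be a Gaussian matrix and $b=Ax_0$. If $$m\ge\inf_{\tau\ge0}\Big\{\hat k(1+\tau^2)+k_L\int_{-\infty}^{\tau}(u-\tau)^2\phi(u)\,du+(N-k)\int_\tau^\infty(u-\tau)^2\phi(u)\,du\Big\}+\sqrt{8\log(4/\varepsilon)N},$$ with $\phi(u)=(2\pi)^{-1/2}e^{-u^2/2}$, then with probability larger than $1-\varepsilon$, $x_0$ is the unique solution of $\min\|x\|_1$ subject to $Ax=b$ and $x\in[0,L]^N$.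
   Context: $\mathbb{1}_S$ has entries $1$ on $S$, $0$ elsewhere. A Gaussian matrix is $A=m^{-1/2}[a_{ij}]$ with $a_{ij}$ i.i.d. standard normal. $\log$ is the natural logarithm. *)

(* Defs.v *)
From HB Require Import structures.
From mathcomp Require Import all_boot all_order all_algebra.
From mathcomp Require Import all_classical all_reals all_analysis.
Set Implicit Arguments. Unset Strict Implicit. Unset Printing Implicit Defensive.
Import Order.TTheory GRing.Theory Num.Theory.
Local Open Scope classical_set_scope.
Local Open Scope ring_scope.

Definition phi {R : realType} (u : R) : R :=
  (Num.sqrt (pi *+ 2))^-1 * expR (- (u ^+ 2) / 2).

Definition bound_fun {R : realType} (khat kL Nk : nat) (tau : R) : R :=
  khat%:R * (1 + tau ^+ 2)
  + kL%:R * Rintegral lebesgue_measure `]-oo, tau] (fun u => (u - tau) ^+ 2 * phi u)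
  + Nk%:R * Rintegral lebesgue_measure `[tau, +oo[ (fun u => (u - tau) ^+ 2 * phi u).

Definition std_normal_RV d (T : measurableType d) (R : realType)
  (P : probability T R) (X : {RV P >-> R}) : Prop :=
  forall B : set R, measurable B -> P (X @^-1` B) = normal_prob 0 1 B.

Definition mutually_independent d (T : measurableType d) (R : realType)
  (P : probability T R) (m N : nat) (a : 'I_m -> 'I_N -> {RV P >-> R}) : Prop :=
  forall B : 'I_m -> 'I_N -> set R, (forall i j, measurable (B i j)) ->
    P [set w | forall i j, B i j (a i j w)]
    = (\prod_(i < m) \prod_(j < N) P (a i j @^-1` B i j))%E.

Definition gauss_mx d (T : measurableType d) (R : realType)
  (P : probability T R) (m N : nat) (a : 'I_m -> 'I_N -> {RV P >-> R}) (w : T)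
  : 'M[R]_(m, N) :=
  \matrix_(i, j) ((Num.sqrt (m%:R : R))^-1 * a i j w).

Definition l1norm {R : realType} (N : nat) (x : 'cV[R]_N) : R :=
  \sum_(j < N) `|x j 0|.

Definition unique_box_l1_solution {R : realType} (m N L : nat)
  (A : 'M[R]_(m, N)) (b : 'cV[R]_m) (x0 : 'cV[R]_N) : Prop :=
  let feasible (x : 'cV[R]_N) := A *m x = b /\ forall j, 0 <= x j 0 <= L%:R in
  feasible x0 /\ forall x, feasible x -> x <> x0 -> l1norm x0 < l1norm x.

(* Main.v *)
(* If x0 is not the unique solution, then x - x0 lies in the kernel of A for some x, and it lies in
   the cone C of the vectors d that are arbitrary on Khat, nonpositive on K_L, nonnegative off K and
   have nonpositive sum. Let g be one more independent Gaussian row. As <g, d> > 0 with probability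
   1/2 for a given d, it suffices to bound the probability that <g, d> > 0 for some d in C with A d = 0,
   and for such (g, A) the minimisers over C of |x - g|^2 + k |A x|^2 lie, for large k, on faces of C
   of dimension > m, almost surely.
   For each face, rotation invariance bounds the probability that the minimiser lies on it, uniformly
   in k, by the probability that the projection of g on C lies on it, namely by
   P(proj_F g in relint F) P(g in normal cone of F). By a Gaussian change of scale, z^(dim F) times
   this probability is the expectation of exp(eta |proj_C g|^2) on the event that proj_C g is in F,
   where z^2 = 1 + s and eta = s / (2 (1 + s)). Summing over the faces, the probability is at most
   z^-(m+1) E exp(eta |proj_C g|^2). For tau >= 0, |proj_C g|^2 is at most the squared distance from g
   to the set of v with v = tau on Khat, v >= tau on K_L and v <= tau off K, a subset of the polar
   cone of C: this is a sum of independent one-sided squares whose expectations add up to bound_fun, and the choice s = sqrt(8 log (4 / eps) N) / (2 N) gives eps / 4. *)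
Require Import Defs.
From HB Require Import structures.
From mathcomp Require Import all_boot all_order all_algebra.
From mathcomp Require Import all_classical all_reals all_analysis.
From mathcomp Require Import measurable_realfun ring lra.
Set Implicit Arguments. Unset Strict Implicit. Unset Printing Implicit Defensive.
Import Order.TTheory GRing.Theory Num.Theory.
Import numFieldNormedType.Exports.
Local Open Scope classical_set_scope.
Local Open Scope ring_scope.

(** * Product sigma-algebra on matrices *)

Section MatrixSigmaAlgebra.
Context {R : realType}.

(** The claim concerns all kernel directions at once, an uncountable union. The extra row [g] turns
    it into one scalar event at the price of a factor 2, paid by Markov's inequality: [eps / 4]
    becomes [eps / 2], and the margin up to [eps] makes the final inequality strict. The
    intersection of the cone with the kernel of [A] has random faces; the penalty keeps the cone and
    its finite list of faces fixed and moves the randomness into the objective. The resulting bound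
    is a tail of the conic intrinsic volumes of the cone, and the weight exp(eta |proj|^2) is a
    Chernoff bound for that tail; [z] and [eta] are tied by 1/2 - eta = 1/(2 z^2). The existence of
    a kernel direction is not obviously a measurable event, so it is replaced by a measurable
    function that is at least 1 whenever some direction has a positive product with [g], and the set
    [E] of the conclusion is defined by an integral of that function. No density on matrices is
    used: invariance is proved for rotations in coordinate planes and sign changes, and products of
    these give every orthogonal map needed. *)

Definition box (p q : nat) (B : 'I_p -> 'I_q -> set R) : set 'M[R]_(p, q) :=
  [set M | forall i j, B i j (M i j)].

Definition boxes (p q : nat) : set (set 'M[R]_(p, q)) :=
  [set D | exists2 B, (forall i j, measurable (B i j)) & D = box B].

(** Boxes are closed under intersection, so a probability law on matrices is determined by its
    values on them. *)
Definition mxm p q := g_sigma_algebraType (@boxes p q).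

Lemma measurable_box p q (B : 'I_p -> 'I_q -> set R) :
  (forall i j, measurable (B i j)) -> measurable (box B : set (mxm p q)).
Proof. by move=> mB; apply: sub_sigma_algebra; exists B. Qed.

Lemma measurable_mxE p q i j : measurable_fun setT (fun M : mxm p q => M i j).
Proof.
move=> _ B mB; rewrite setTI.
pose B' k l := if (k == i) && (l == j) then B else setT.
have -> : (fun M : mxm p q => M i j) @^-1` B = box B'.
  apply/seteqP; split => [M BM k l|M /(_ i j)]; rewrite /B' /=; last by rewrite !eqxx.
  by case: ifP => // /andP[/eqP -> /eqP ->].
by apply: measurable_box => k l; rewrite /B'; case: ifP.
Qed.

Lemma measurable_mxP d (T : measurableType d) p q (X : T -> mxm p q) :
  (forall i j, measurable_fun setT (fun w => X w i j)) -> measurable_fun setT X.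
Proof.
move=> mX; apply: (@measurability _ _ _ (mxm p q) setT X (@boxes p q)) => // _ [_ [B mB ->] <-].
have -> : setT `&` X @^-1` box B =
  \bigcap_(i in [set: 'I_p]) \bigcap_(j in [set: 'I_q]) ((fun w => X w i j) @^-1` B i j).
  rewrite setTI; apply/seteqP; split => [w H i _ j _|w H i j]; first exact: H.
  exact: H.
apply: fin_bigcap_measurable; first exact: finite_finset.
move=> i _; apply: fin_bigcap_measurable; first exact: finite_finset.
by move=> j _; rewrite -[X in measurable X]setTI; exact: mX.
Qed.

Lemma boxT p q : @box p q (fun _ _ => setT) = setT.
Proof. by apply/seteqP; split. Qed.

Lemma boxesI p q : setI_closed (@boxes p q).
Proof.
move=> _ _ [B mB ->] [C mC ->]; exists (fun i j => B i j `&` C i j).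
  by move=> i j; exact: measurableI.
apply/seteqP; split => [M [HB HC] i j|M H]; first by split; [exact: HB|exact: HC].
by split => i j; have [] := H i j.
Qed.

End MatrixSigmaAlgebra.
Arguments mxm R p q : clear implicits.

(** * Existence and uniqueness of the standard Gaussian law on matrices *)

Section GaussianMatrix.
Context {R : realType}.
Local Notation gam := (normal_prob (0 : R) 1).
Local Open Scope ereal_scope.

Definition is_mgauss p q (mu : set (mxm R p q) -> \bar R) := forall B,
  (forall i j, measurable (B i j)) -> mu (box B) = \prod_i \prod_j gam (B i j).

Lemma is_mgauss_unique p q (m1 m2 : {measure set (mxm R p q) -> \bar R}) :
  is_mgauss m1 -> is_mgauss m2 -> forall D, measurable D -> m1 D = m2 D.
Proof.
move=> h1 h2 D mD.
apply: (@measure_unique _ R (mxm R p q) (@boxes R p q) (fun=> setT)) => //.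
- exact: boxesI.
- by move=> _; exists (fun _ _ => setT) => //; rewrite boxT.
- by rewrite bigcup_const//; exists 0%N.
- by move=> _ [B mB ->]; rewrite h1// h2.
- move=> _; rewrite -boxT h1//.
  rewrite big1 ?ltry// => i _; rewrite big1// => j _.
  by rewrite -(@probability_setT _ _ _ gam).
Qed.

(** Product measures build a row entry by entry, then a matrix row by row. A space of empty matrices
    has a single point, so the Dirac mass is the law there. *)
Lemma ex_mgauss p q : exists mu : probability (mxm R p q) R, is_mgauss mu.
Proof.
have row n : exists mu : probability (mxm R 1 n) R, is_mgauss mu.
  elim: n => [|n [mu hmu]].
    exists (dirac (0%R : mxm R 1 0)) => B mB /=.
    rewrite big1 => [|i _]; last by rewrite big_ord0.
    rewrite diracE mem_set// => i; case; by [].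
  pose f (x : measurableTypeR R * mxm R 1 n) : mxm R 1 (1 + n) := row_mx (const_mx x.1) x.2.
  have mf : measurable_fun setT f.
    apply: measurable_mxP => i j; rewrite /f /=.
    case: (fintype.split j) (splitK j) => k <-.
      rewrite (_ : (fun _ => _) = fst); first exact: measurable_fst.
      by apply/funext => x; rewrite row_mxEl mxE.
    rewrite (_ : (fun _ => _) = (fun M : mxm R 1 n => M i k) \o snd).
      by apply: measurableT_comp => //; exact: measurable_mxE.
    by apply/funext => x; rewrite /= row_mxEr.
  pose fm := HB.pack_for {mfun _ >-> _} f (isMeasurableFun.Build _ _ _ _ _ mf).
  exists (distribution (gam \x mu)%E fm) => B mB /=.
  rewrite /distribution /pushforward /=.
  have -> : f @^-1` box B = B ord0 (lshift n (ord0 : 'I_1)) `*` box (fun i j => B i (rshift 1 j)).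
    apply/seteqP; split => [[a M] H|[a M] [/= H1 H2] i j].
      split => /=.
        by have := H ord0 (lshift n (ord0 : 'I_1)); rewrite /f (@row_mxEl _ 1 1 n) mxE.
      by move=> i j; have := H i (rshift 1 j); rewrite /f (@row_mxEr _ 1 1 n).
    rewrite /f /= ord1; case: (@fintype.split 1 n j) (@splitK 1 n j) => k <-.
      by rewrite (@row_mxEl _ 1 1 n) mxE ord1.
    rewrite (@row_mxEr _ 1 1 n); exact: H2.
  rewrite product_measure1E; [|exact: mB|by apply: measurable_box => i j; exact: mB].
  rewrite !big_ord1 big_ord_recl; congr (_ * _).
    by congr (gam (B _ _)); apply/val_inj.
  etransitivity; first by apply: hmu => i j; exact: mB.
  by rewrite big_ord1; apply: eq_bigr => j _; congr (gam (B _ _)); apply/val_inj.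
elim: p => [|p [mu hmu]].
  exists (dirac (0%R : mxm R 0 q)) => B mB /=.
  rewrite big_ord0 diracE mem_set// => i; case: i => //.
have [nu hnu] := row q.
pose f (x : mxm R 1 q * mxm R p q) : mxm R (1 + p) q := col_mx x.1 x.2.
have mf : measurable_fun setT f.
  apply: measurable_mxP => i j; rewrite /f /=.
  case: (fintype.split i) (splitK i) => k <-.
    rewrite (_ : (fun _ => _) = (fun M : mxm R 1 q => M k j) \o fst).
      by apply: measurableT_comp => //; exact: measurable_mxE.
    by apply/funext => x; rewrite col_mxEu.
  rewrite (_ : (fun _ => _) = (fun M : mxm R p q => M k j) \o snd).
    by apply: measurableT_comp => //; exact: measurable_mxE.
  by apply/funext => x; rewrite /= col_mxEd.
pose fm := HB.pack_for {mfun _ >-> _} f (isMeasurableFun.Build _ _ _ _ _ mf).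
exists (distribution (nu \x mu)%E fm) => B mB /=.
rewrite /distribution /pushforward /=.
have -> : f @^-1` box B = box (fun (i : 'I_1) j => B (lshift p i) j) `*` box (fun (i : 'I_p) j => B (rshift 1 i) j).
  apply/seteqP; split => [[a M] H|[a M] [/= H1 H2] i j].
    split => /= i j; first by have := H (lshift p i) j; rewrite /f (@col_mxEu _ 1 p q).
    by have := H (rshift 1 i) j; rewrite /f (@col_mxEd _ 1 p q).
  rewrite /f /=; case: (@fintype.split 1 p i) (@splitK 1 p i) => k <-.
    by rewrite (@col_mxEu _ 1 p q); exact: H1.
  rewrite (@col_mxEd _ 1 p q); exact: H2.
rewrite product_measure1E; try by apply: measurable_box => i j; exact: mB.
rewrite big_ord_recl; congr (_ * _).
  etransitivity; first by apply: hnu => i j; exact: mB.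
  by rewrite big_ord1; apply: eq_bigr => j _; congr (gam (B _ _)); apply/val_inj.
etransitivity; first by apply: hmu => i j; exact: mB.
by apply: eq_bigr => i _; apply: eq_bigr => j _; congr (gam (B _ _)); apply/val_inj.
Qed.

Definition mgauss p q : probability (mxm R p q) R := projT1 (cid (ex_mgauss p q)).

Lemma mgaussE p q : is_mgauss (mgauss p q).
Proof. exact: projT2 (cid (ex_mgauss p q)). Qed.

(** Reduces a change of variables for Gaussian matrices to a computation on boxes; as [f] is
    nonnegative, no integrability has to be checked. *)
Lemma mgauss_push d (T : measurableType d) (P : probability T R) p q
    (X : T -> mxm R p q) : measurable_fun setT X ->
  is_mgauss (fun D => P (X @^-1` D)) ->
  forall f : mxm R p q -> \bar R, measurable_fun setT f -> (forall M, 0 <= f M) ->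
  \int[P]_w f (X w) = \int[mgauss p q]_M f M.
Proof.
move=> mX hX f mf f0.
pose Xm := HB.pack_for {mfun _ >-> _} X (isMeasurableFun.Build _ _ _ _ _ mX).
transitivity (\int[distribution P Xm]_M f M).
  by rewrite ge0_integral_distribution.
apply: eq_measure_integral => D mD _.
by apply: is_mgauss_unique => //; exact: mgaussE.
Qed.

End GaussianMatrix.

(** * Splitting Gaussian matrices into independent blocks *)

Section GaussianMatrixFubini.
Context {R : realType}.
Local Notation mgauss := (@mgauss R).
Local Open Scope ereal_scope.

Definition mix p q (S : 'I_p -> 'I_q -> bool) (A B : mxm R p q) : mxm R p q :=
  \matrix_(i, j) if S i j then A i j else B i j.

Lemma measurable_mix p q S d (T : measurableType d) (A B : T -> mxm R p q) :
  measurable_fun setT A -> measurable_fun setT B ->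
  measurable_fun setT (fun w => mix S (A w) (B w)).
Proof.
move=> mA mB; apply: measurable_mxP => i j; rewrite /mix.
have mE C : measurable_fun setT C -> measurable_fun setT (fun w : T => (C w : mxm R p q) i j).
  by move=> mC; apply: (@measurableT_comp _ _ _ _ _ _ (fun M : mxm R p q => M i j)) => //; exact: measurable_mxE.
case Sij : (S i j).
  by under [X in measurable_fun _ X]eq_fun do rewrite mxE Sij; exact: mE.
by under [X in measurable_fun _ X]eq_fun do rewrite mxE Sij; exact: mE.
Qed.

(** Splicing two independent copies along the mask [S] gives a Gaussian matrix again. Conditioning
    on the entries selected by [S] thereby becomes an iterated integral. *)
Lemma mgauss_mix p q (S : 'I_p -> 'I_q -> bool) (f : mxm R p q -> \bar R) :
  measurable_fun setT f -> (forall M, 0 <= f M) ->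
  \int[mgauss p q]_M f M = \int[mgauss p q]_A \int[mgauss p q]_B f (mix S A B).
Proof.
move=> mf f0.
have mm : measurable_fun setT (fun z : mxm R p q * mxm R p q => mix S z.1 z.2).
  exact: measurable_mix.
rewrite -(mgauss_push (P := (mgauss p q \x mgauss p q)) mm)//.
  rewrite fubini_tonelli1//; exact: measurableT_comp.
move=> B mB.
pose B1 i j := if S i j then B i j else setT.
pose B2 i j := if S i j then setT else B i j.
have -> : (fun z => mix S z.1 z.2) @^-1` box B = box B1 `*` box B2.
  apply/seteqP; split => [[a b] H|[a b] [/= H1 H2] i j].
    by split => i j; have := H i j; rewrite /mix /B1 /B2 mxE /=; case: ifP.
  by have := H1 i j; have := H2 i j; rewrite /mix /B1 /B2 mxE /=; case: ifP.
have mB1 i j : measurable (B1 i j) by rewrite /B1; case: ifP.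
have mB2 i j : measurable (B2 i j) by rewrite /B2; case: ifP.
transitivity (mgauss p q (box B1) * mgauss p q (box B2)).
  by apply: product_measure1E; exact: measurable_box.
rewrite (mgaussE mB1) (mgaussE mB2).
rewrite -big_split /=; apply: eq_bigr => i _.
rewrite -big_split /=; apply: eq_bigr => j _.
by rewrite /B1 /B2; case: ifP => _; rewrite [normal_prob _ _ setT]probability_setT ?mule1 ?mul1e.
Qed.

Lemma measurable_col_mx p1 p2 q d (T : measurableType d) (A : T -> mxm R p1 q) (B : T -> mxm R p2 q) :
  measurable_fun setT A -> measurable_fun setT B ->
  measurable_fun setT (fun w => col_mx (A w) (B w) : mxm R (p1 + p2) q).
Proof.
move=> mA mB; apply: measurable_mxP => i j.
have mE p C : measurable_fun setT C -> forall i, measurable_fun setT (fun w : T => (C w : mxm R p q) i j).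
  by move=> mC k; apply: (@measurableT_comp _ _ _ _ _ _ (fun M : mxm R p q => M k j)) => //; exact: measurable_mxE.
case: (fintype.split i) (splitK i) => k <-.
  by under [X in measurable_fun _ X]eq_fun do rewrite (@col_mxEu _ p1 p2 q); exact: mE.
by under [X in measurable_fun _ X]eq_fun do rewrite (@col_mxEd _ p1 p2 q); exact: mE.
Qed.

Lemma mgauss_col_mx p1 p2 q (f : mxm R (p1 + p2) q -> \bar R) :
  measurable_fun setT f -> (forall M, 0 <= f M) ->
  \int[mgauss (p1 + p2) q]_M f M =
  \int[mgauss p1 q]_A \int[mgauss p2 q]_B f (col_mx A B).
Proof.
move=> mf f0.
have mm : measurable_fun setT (fun z : mxm R p1 q * mxm R p2 q => col_mx z.1 z.2 : mxm R (p1 + p2) q).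
  exact: measurable_col_mx.
rewrite -(mgauss_push (P := (mgauss p1 q \x mgauss p2 q)) mm)//.
  rewrite fubini_tonelli1//; exact: (measurableT_comp mf mm).
move=> B mB.
have -> : (fun z : mxm R p1 q * mxm R p2 q => col_mx z.1 z.2 : mxm R (p1 + p2) q) @^-1` box B =
    box (fun (i : 'I_p1) j => B (lshift p2 i) j) `*` box (fun (i : 'I_p2) j => B (rshift p1 i) j).
  apply/seteqP; split => [[a M] H|[a M] [/= H1 H2] i j].
    split => /= i j; first by have := H (lshift p2 i) j; rewrite /= (@col_mxEu _ p1 p2 q).
    by have := H (rshift p1 i) j; rewrite /= (@col_mxEd _ p1 p2 q).
  rewrite /=; case: (fintype.split i) (splitK i) => k <-.
    by rewrite (@col_mxEu _ p1 p2 q); exact: H1.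
  rewrite (@col_mxEd _ p1 p2 q); exact: H2.
etransitivity; first by apply: product_measure1E; exact: measurable_box.
by rewrite big_split_ord; congr (_ * _); apply: mgaussE => i j; exact: mB.
Qed.

Lemma measurable_trmx p q : measurable_fun setT (fun M : mxm R p q => M^T : mxm R q p).
Proof.
apply: measurable_mxP => i j; under [X in measurable_fun _ X]eq_fun do rewrite mxE.
exact: measurable_mxE.
Qed.

Lemma mgauss_trmx p q (f : mxm R q p -> \bar R) :
  measurable_fun setT f -> (forall M, 0 <= f M) ->
  \int[mgauss p q]_M f M^T = \int[mgauss q p]_M f M.
Proof.
move=> mf f0; apply: (mgauss_push (@measurable_trmx p q)) => // B mB.
have -> : (fun M : mxm R p q => M^T : mxm R q p) @^-1` box B = box (fun i j => B j i).
  by apply/seteqP; split => M H i j; have := H j i; rewrite /= mxE.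
by rewrite mgaussE// exchange_big.
Qed.

Lemma measurable_row p q i : measurable_fun setT (fun M : mxm R p q => row i M : mxm R 1 q).
Proof.
apply: measurable_mxP => k j; under [X in measurable_fun _ X]eq_fun do rewrite mxE.
exact: measurable_mxE.
Qed.

Lemma emeasurable_prod d (T : measurableType d) I (r : seq I) (f : I -> T -> \bar R) :
  (forall i, measurable_fun setT (f i)) ->
  measurable_fun setT (fun w => \prod_(i <- r) f i w).
Proof.
move=> mf; elim: r => [|i r IH].
  by under [X in measurable_fun _ X]eq_fun do rewrite big_nil; exact: measurable_cst.
under [X in measurable_fun _ X]eq_fun do rewrite big_cons; exact: emeasurable_funM.
Qed.

Lemma eprod_ge0 I (r : seq I) (f : I -> \bar R) :
  (forall i, 0 <= f i) -> 0 <= \prod_(i <- r) f i.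
Proof. by move=> f0; elim/big_ind : _ => //; exact: mule_ge0. Qed.

Lemma mgauss_rows p q (F : 'I_p -> mxm R 1 q -> \bar R) :
  (forall i, measurable_fun setT (F i)) -> (forall i M, 0 <= F i M) ->
  \int[mgauss p q]_M \prod_i F i (row i M) = \prod_i \int[mgauss 1 q]_M F i M.
Proof.
elim: p F => [|p IH] F mF F0.
  under eq_integral do rewrite big_ord0.
  by rewrite big_ord0 integral_cst// mul1e [LHS]probability_setT.
have mrow n k (i : 'I_n) (G : mxm R 1 q -> \bar R) : measurable_fun setT G ->
    measurable_fun setT (fun M : mxm R n q => G (row i M)).
  by move=> mG; exact: (measurableT_comp mG (measurable_row i)).
rewrite (@mgauss_col_mx 1 p q (fun M : mxm R p.+1 q => \prod_i F i (row i M))); last 2 first.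
  by apply: emeasurable_prod => i; exact: mrow.
  by move=> M; exact: eprod_ge0.
have e (A : mxm R 1 q) (B : mxm R p q) : \prod_i F i (row i (col_mx A B)) =
    F ord0 A * \prod_(i < p) F (lift ord0 i) (row i B).
  rewrite big_ord_recl; congr (F _ _ * _).
    have -> : ord0 = lshift p (ord0 : 'I_1) by apply/val_inj.
    by rewrite (@rowKu _ 1 p q) row_id.
  apply: eq_bigr => i _; congr (F _ _).
  have -> : lift ord0 i = rshift 1 i by apply/val_inj.
  by rewrite (@rowKd _ 1 p q).
under eq_integral do under eq_integral do rewrite e.
under eq_integral => A _.
  rewrite ge0_integralZl//; last 2 first.
    by apply: emeasurable_prod => i; exact: mrow.
    by move=> M _; exact: eprod_ge0.
  rewrite (IH (fun i => F (lift ord0 i)))//; over.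
rewrite ge0_integralZr//; last by apply: eprod_ge0 => i; apply: integral_ge0 => M _; exact: F0.
by rewrite [RHS]big_ord_recl.
Qed.

End GaussianMatrixFubini.

(** * Lebesgue measure under affine maps of the line *)

Section LebesgueAffine.
Context {R : realType}.
Local Notation mu := (@lebesgue_measure R).
Local Open Scope ereal_scope.

Lemma integral_lebesgue_shift (a : R) (f : R -> \bar R) :
  measurable_fun setT f -> (forall x, 0 <= f x) ->
  \int[mu]_x f (x + a)%R = \int[mu]_x f x.
Proof.
move=> mf f0.
pose h (x : measurableTypeR R) : measurableTypeR R := (x + a)%R.
have mh : measurable_fun setT h by apply: measurable_funD => //; exact: measurable_cst.
pose hm := HB.pack_for {mfun _ >-> _} h (isMeasurableFun.Build _ _ _ _ _ mh).
transitivity (\int[pushforward mu hm]_x f x); first by rewrite ge0_integral_pushforward.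
apply: eq_measure_integral => A mA _; apply/esym/lebesgue_measure_unique => //= _ [[b c]] _ <-.
rewrite /pushforward.
have -> : h @^-1` `]b, c]%classic = `](b - a)%R, (c - a)%R]%classic.
  by apply/seteqP; split => x; rewrite /= !in_itv /= ltrBlDr lerBrDr.
rewrite /= !lebesgue_measure_itv /= !lte_fin ltrD2r.
by case: ifP => // _; rewrite -!EFinD opprB addrA subrK.
Qed.

Lemma integral_lebesgue_scale (z : R) (f : R -> \bar R) : (0 < z)%R ->
  measurable_fun setT f -> (forall x, 0 <= f x) ->
  z%:E * \int[mu]_x f (z * x)%R = \int[mu]_x f x.
Proof.
move=> z0 mf f0.
pose h (x : measurableTypeR R) : measurableTypeR R := (z * x)%R.
have mh : measurable_fun setT h by apply: measurable_funM => //; exact: measurable_cst.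
pose hm := HB.pack_for {mfun _ >-> _} h (isMeasurableFun.Build _ _ _ _ _ mh).
have zn0 : (0 <= z)%R by exact: ltW.
transitivity (\int[mscale (NngNum zn0) mu]_x f (h x)).
  by rewrite ge0_integral_mscale//; exact: measurableT_comp.
transitivity (\int[pushforward (mscale (NngNum zn0) mu) hm]_x f x).
  by rewrite ge0_integral_pushforward.
apply: eq_measure_integral => A mA _; apply/esym/lebesgue_measure_unique => //= _ [[b c]] _ <-.
rewrite /pushforward /mscale.
have -> : h @^-1` `]b, c]%classic = `](b / z)%R, (c / z)%R]%classic.
  by apply/seteqP; split => x; rewrite /= !in_itv /= /h ltr_pdivrMr// ler_pdivlMr// mulrC.
rewrite /= !lebesgue_measure_itv /= !lte_fin ltr_pM2r ?invr_gt0//.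
case: ifP => // _; last by rewrite mule0.
by rewrite -!EFinD -EFinM mulrBr !(mulrC z) !divfK ?gt_eqF.
Qed.

End LebesgueAffine.

(** * The density of the standard normal law *)

Section Gaussian1.
Context {R : realType}.
Local Notation mu := (@lebesgue_measure R).
Local Notation gam := (normal_prob (0 : R) 1).
Local Open Scope ereal_scope.

Lemma normal_pdf01 (x : R) : normal_pdf 0 1 x = phi x.
Proof.
rewrite normal_pdfE ?oner_eq0// /phi /normal_peak /normal_fun expr1n mul1r subr0.
by [].
Qed.

Lemma phi_ge0 (x : R) : (0 <= phi x)%R.
Proof. by rewrite -normal_pdf01 normal_pdf_ge0. Qed.

Lemma measurable_phi : measurable_fun setT (@phi R).
Proof.
rewrite (_ : @phi R = normal_pdf 0 1); first exact: measurable_normal_pdf.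
by apply/funext => x; rewrite normal_pdf01.
Qed.

(** The Radon-Nikodym derivative of the normal law and [phi] have the same integral over every
    measurable set, so they agree almost everywhere. *)
Lemma integral_gam (f : R -> \bar R) :
  measurable_fun setT f -> (forall x, 0 <= f x) ->
  \int[gam]_x f x = \int[mu]_x (f x * (phi x)%:E).
Proof.
move=> mf f0.
have dom := normal_prob_dominates (0 : R) 1.
rewrite -(Radon_Nikodym_SigmaFinite.change_of_variables dom)//.
have gi := Radon_Nikodym_SigmaFinite.f_integrable dom.
have mg := measurable_int _ gi.
have mp : measurable_fun setT (fun x => (phi x)%:E : \bar R).
  by apply/measurable_EFinP; exact: measurable_phi.
apply: ge0_ae_eq_integral => //.
- exact: emeasurable_funM.
- exact: emeasurable_funM.
- by move=> x _; rewrite mule_ge0// Radon_Nikodym_SigmaFinite.f_ge0.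
- by move=> x _; rewrite mule_ge0// lee_fin phi_ge0.
have := @integral_ae_eq _ _ _ mu setT measurableT _ _ gi mp _.
move=> /(_ _) H.
have : ae_eq mu setT (Radon_Nikodym_SigmaFinite.f (normal_prob 0 1) mu) (fun x => (phi x)%:E).
  apply: H => E _ mE; rewrite -Radon_Nikodym_SigmaFinite.f_integral//.
  by apply: eq_integral => x _; rewrite normal_pdf01.
by apply: filterS => x H1 H2; rewrite H1.
Qed.
End Gaussian1.

(** * Resampling coordinates of a Gaussian vector *)

Section Coordinates.
Context {R : realType}.
Local Notation gam := (normal_prob (0 : R) 1).
Local Notation mgauss := (@mgauss R).
Local Open Scope ereal_scope.

Definition setc n (i : 'I_n) (x : R) (M : mxm R 1 n) : mxm R 1 n :=
  \row_k if k == i then x else M ord0 k.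

Lemma measurable_setc n (i : 'I_n) :
  measurable_fun setT (fun z : measurableTypeR R * mxm R 1 n => setc i z.1 z.2).
Proof.
apply: measurable_mxP => k l; rewrite /setc.
case: (eqVneq l i) => [->|li].
  by under [X in measurable_fun _ X]eq_fun do rewrite mxE eqxx; exact: measurable_fst.
under [X in measurable_fun _ X]eq_fun do rewrite mxE (negbTE li).
exact: (measurableT_comp (measurable_mxE ord0 l) measurable_snd).
Qed.

(** Overwriting a coordinate by an independent normal value preserves the law; identities on the
    line lift to vectors this way. *)
Lemma mgauss_setc n (i : 'I_n) (f : mxm R 1 n -> \bar R) :
  measurable_fun setT f -> (forall M, 0 <= f M) ->
  \int[mgauss 1 n]_M f M = \int[gam]_x \int[mgauss 1 n]_M f (setc i x M).
Proof.
move=> mf f0; have mm := measurable_setc i.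
rewrite -(mgauss_push (P := (gam \x mgauss 1 n)) mm)//.
  rewrite fubini_tonelli1//; exact: (measurableT_comp mf mm).
move=> B mB.
have -> : (fun z : measurableTypeR R * mxm R 1 n => setc i z.1 z.2) @^-1` box B =
    B ord0 i `*` box (fun k l => if l == i then setT else B k l).
  apply/seteqP; split => [[a M] H|[a M] [/= H1 H2] k l].
    split => [|k l] /=; first by have := H ord0 i; rewrite mxE eqxx.
    by have := H k l; rewrite ord1 mxE; case: eqP.
  by have := H2 k l; rewrite ord1 mxE; case: eqP => [->|].
have mB' k l : measurable (if l == i then setT else B k l) by case: ifP.
transitivity (gam (B ord0 i) * mgauss 1 n (box (fun k l => if l == i then setT else B k l))).
  by apply: product_measure1E; [exact: mB|exact: (measurable_box mB')].
rewrite mgaussE// !big_ord1 (bigD1 i)//= [in RHS](bigD1 i)//= eqxx probability_setT mul1e.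
by congr (_ * _); apply: eq_bigr => j /negbTE ->.
Qed.

Lemma mgauss_coord n (i : 'I_n) (f : R -> \bar R) :
  measurable_fun setT f -> (forall x, 0 <= f x) ->
  \int[mgauss 1 n]_M f (M ord0 i) = \int[gam]_x f x.
Proof.
move=> mf f0; rewrite (mgauss_setc i)//; last first.
  exact: (measurableT_comp mf (@measurable_mxE R 1 n ord0 i)).
apply: eq_integral => x _; under eq_integral do rewrite mxE eqxx.
by rewrite integral_cst// [X in _ * X]probability_setT mule1.
Qed.

(** Independence of the coordinates is independence of the rows after transposition. *)
Lemma mgauss_coords n (f : 'I_n -> R -> \bar R) :
  (forall i, measurable_fun setT (f i)) -> (forall i x, 0 <= f i x) ->
  \int[mgauss 1 n]_M \prod_i f i (M ord0 i) = \prod_i \int[gam]_x f i x.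
Proof.
move=> mf f0.
have mg k i (j : 'I_k) : measurable_fun setT (fun M : mxm R k 1 => f i (M j ord0)).
  exact: (measurableT_comp (mf i) (@measurable_mxE R k 1 j ord0)).
under eq_bigr do rewrite -(@mgauss_coord 1 ord0)//.
rewrite -(mgauss_rows (F := fun i (M : mxm R 1 1) => f i (M ord0 ord0)))//.
rewrite -mgauss_trmx; last 2 first.
- apply: (@emeasurable_prod R _ (mxm R 1 n) _ (index_enum _) (fun i (M : mxm R 1 n) => f i (M ord0 i))) => i.
  exact: (measurableT_comp (mf i) (@measurable_mxE R 1 n ord0 i)).
- by move=> M; exact: eprod_ge0.
by apply: eq_integral => M _; apply: eq_bigr => i _; rewrite !mxE.
Qed.

Definition setc2 n (i j : 'I_n) (z : R * R) (M : mxm R 1 n) : mxm R 1 n :=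
  \row_k if k == i then z.1 else if k == j then z.2 else M ord0 k.

Lemma measurable_setc2 n (i j : 'I_n) :
  measurable_fun setT (fun z : (measurableTypeR R * measurableTypeR R) * mxm R 1 n => setc2 i j z.1 z.2).
Proof.
apply: measurable_mxP => k l; rewrite /setc2.
case: (eqVneq l i) => [->|li].
  under [X in measurable_fun _ X]eq_fun do rewrite mxE eqxx.
  exact: (measurableT_comp measurable_fst measurable_fst).
case: (eqVneq l j) => [lj|lj].
  under [X in measurable_fun _ X]eq_fun do rewrite mxE (negbTE li) lj eqxx.
  exact: (measurableT_comp measurable_snd measurable_fst).
under [X in measurable_fun _ X]eq_fun do rewrite mxE (negbTE li) (negbTE lj).
exact: (measurableT_comp (measurable_mxE ord0 l) measurable_snd).
Qed.

Lemma mgauss_setc2 n (i j : 'I_n) (f : mxm R 1 n -> \bar R) : i != j ->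
  measurable_fun setT f -> (forall M, 0 <= f M) ->
  \int[mgauss 1 n]_M f M = \int[mgauss 1 n]_M \int[gam]_x \int[gam]_y f (setc2 i j (x, y) M).
Proof.
move=> ij mf f0; have mm := measurable_setc2 i j.
rewrite -(mgauss_push (P := ((gam \x gam) \x mgauss 1 n)) mm)//.
  rewrite fubini_tonelli2//; last exact: (measurableT_comp mf mm).
  apply: eq_integral => M _.
  pose g z := f (setc2 i j z M).
  have mg : measurable_fun setT (g : measurableTypeR R * measurableTypeR R -> \bar R).
    exact: (measurableT_comp (measurableT_comp mf mm) (pair2_measurable M)).
  by apply: (@fubini_tonelli1 _ _ _ _ _ gam gam g) => // z; exact: f0.
move=> B mB.
pose B' (k : 'I_1) l := if l == i then setT else if l == j then setT else B k l.
have -> : (fun z : (measurableTypeR R * measurableTypeR R) * mxm R 1 n => setc2 i j z.1 z.2) @^-1` box B =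
    (B ord0 i `*` B ord0 j) `*` box B'.
  apply/seteqP; split => [[[a b] M] H|[[a b] M] [/= [H0 H1] H2] k l].
    split => [|k l] /=.
      split; first by have := H ord0 i; rewrite mxE eqxx.
      by have := H ord0 j; rewrite mxE eqxx eq_sym (negbTE ij).
    by have := H k l; rewrite /B' ord1 mxE; case: eqP => // _; case: eqP.
  by have := H2 k l; rewrite /B' ord1 mxE; case: eqP => [->|]//; case: eqP => [->|].
have mB' k l : measurable (B' k l) by rewrite /B'; case: ifP => // _; case: ifP.
transitivity ((gam (B ord0 i) * gam (B ord0 j)) * mgauss 1 n (box B')).
  rewrite -(product_measure1E gam gam); [|exact: mB|exact: mB].
  by apply: product_measure1E; [apply: measurableX; exact: mB|exact: (measurable_box mB')].
have ji : j != i by rewrite eq_sym.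
rewrite mgaussE// !big_ord1 (bigD1 i)//= (bigD1 j)//= [in RHS](bigD1 i)//= [in RHS](bigD1 j)//=.
rewrite /B' eqxx (negbTE ji) eqxx !probability_setT !mul1e muleA.
by congr (_ * _); apply: eq_bigr => k /andP[/negbTE -> /negbTE ->].
Qed.

End Coordinates.

(** * Rotation invariance in the plane *)

Section Rotation.
Context {R : realType}.
Local Notation mu := (@lebesgue_measure R).
Local Notation gam := (normal_prob (0 : R) 1).
Local Open Scope ereal_scope.
Local Notation R2 := (measurableTypeR R * measurableTypeR R)%type.

Lemma lebesgue2_shear2 (a : R) (F : R2 -> \bar R) :
  measurable_fun setT F -> (forall z, 0 <= F z) ->
  \int[mu]_x \int[mu]_y F (x, y + a * x)%R = \int[mu]_x \int[mu]_y F (x, y).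
Proof.
move=> mF F0; apply: eq_integral => x _.
apply: (@integral_lebesgue_shift R (a * x)%R (fun y => F (x, y))) => //.
exact: (measurableT_comp mF (pair1_measurable x)).
Qed.

Lemma lebesgue2_swap (F : R2 -> \bar R) :
  measurable_fun setT F -> (forall z, 0 <= F z) ->
  \int[mu]_x \int[mu]_y F (x, y) = \int[mu]_y \int[mu]_x F (x, y).
Proof. by move=> mF F0; apply: (@fubini_tonelli _ _ _ _ _ mu mu F). Qed.

Lemma lebesgue2_shear1 (b : R) (F : R2 -> \bar R) :
  measurable_fun setT F -> (forall z, 0 <= F z) ->
  \int[mu]_x \int[mu]_y F (x + b * y, y)%R = \int[mu]_x \int[mu]_y F (x, y).
Proof.
move=> mF F0.
have mG : measurable_fun setT (fun z : R2 => F (z.1 + b * z.2, z.2)%R).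
  apply: measurableT_comp => //; apply: measurable_fun_pair => //.
  by apply: measurable_funD => //; apply: measurable_funM.
apply: (etrans (lebesgue2_swap mG _)) => //.
apply: (etrans _ (esym (lebesgue2_swap mF _))) => //.
apply: eq_integral => y _.
apply: (@integral_lebesgue_shift R (b * y)%R (fun x => F (x, y))) => //.
exact: (measurableT_comp mF (pair2_measurable y)).
Qed.

(* A rotation that moves the first axis is a product of three shears. *)
Lemma lebesgue2_rot (c s : R) (F : R2 -> \bar R) :
  (c ^+ 2 + s ^+ 2 = 1)%R -> (s != 0)%R ->
  measurable_fun setT F -> (forall z, 0 <= F z) ->
  \int[mu]_x \int[mu]_y F (c * x - s * y, s * x + c * y)%R = \int[mu]_x \int[mu]_y F (x, y).
Proof.
move=> cs s0 mF F0.
(* For a rotation by the angle theta this is -tan(theta / 2), the coefficient of the two outer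
   shears; the middle one has coefficient [s]. *)
set b := ((c - 1) / s)%R.
have bs : (b * s = c - 1)%R by rewrite /b divfK.
have bc : (b * (1 + c) = - s)%R.
  apply: (mulfI s0); apply/eqP; rewrite -subr_eq0; apply/eqP.
  transitivity ((b * s - (c - 1)) * (1 + c) + (c ^+ 2 + s ^+ 2 - 1))%R; first by ring.
  by rewrite bs cs !subrr mul0r addr0.
pose sh1 (z : R2) : R2 := (z.1 + b * z.2, z.2)%R.
pose sh2 (z : R2) : R2 := (z.1, z.2 + s * z.1)%R.
have m1 : measurable_fun setT sh1.
  apply: measurable_fun_pair => //.
  by apply: measurable_funD => //; apply: measurable_funM.
have m2 : measurable_fun setT sh2.
  apply: measurable_fun_pair => //.
  by apply: measurable_funD => //; apply: measurable_funM.
transitivity (\int[mu]_x \int[mu]_y F (sh1 (sh2 (sh1 (x, y))))).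
  apply: eq_integral => x _; apply: eq_integral => y _; congr F; rewrite /sh1 /sh2 /=.
  congr (_, _); last first.
    apply/esym/eqP; rewrite -subr_eq0; apply/eqP.
    transitivity ((b * s - (c - 1)) * y)%R; first by ring.
    by rewrite bs subrr mul0r.
  apply/esym/eqP; rewrite -subr_eq0; apply/eqP.
  transitivity ((b * s - (c - 1)) * (x + b * y) + (b * (1 + c) + s) * y)%R; first by ring.
  by rewrite bs bc subrr addNr !mul0r addr0.
have mF1 := measurableT_comp mF m1.
have mF2 := measurableT_comp mF1 m2.
have e1 := lebesgue2_shear1 b mF2 (fun z => F0 _).
have e2 := lebesgue2_shear2 s mF1 (fun z => F0 _).
exact: (etrans e1 (etrans e2 (lebesgue2_shear1 b mF F0))).
Qed.

Lemma phiM (x y x' y' : R) : (x ^+ 2 + y ^+ 2 = x' ^+ 2 + y' ^+ 2)%R ->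
  (phi x * phi y = phi x' * phi y')%R.
Proof.
move=> e; rewrite /phi !(mulrACA _ (expR _)) -!expRD; congr (_ * expR _)%R.
by rewrite -!mulrDl -!opprD e.
Qed.

Lemma gam2_lebesgue (F : R2 -> \bar R) :
  measurable_fun setT F -> (forall z, 0 <= F z) ->
  \int[gam]_x \int[gam]_y F (x, y) =
  \int[mu]_x \int[mu]_y (F (x, y) * (phi x * phi y)%:E).
Proof.
move=> mF F0.
have mp : measurable_fun setT (fun x => (phi x)%:E : \bar R).
  by apply/measurable_EFinP; exact: measurable_phi.
rewrite integral_gam; last 2 first.
- exact: (@measurable_fun_fubini_tonelli_F _ _ _ _ _ gam F).
- by move=> x; exact: integral_ge0.
apply: eq_integral => x _.
have mx : measurable_fun setT (fun y => F (x, y)).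
  exact: (measurableT_comp mF (pair1_measurable x)).
rewrite integral_gam// -ge0_integralZr//.
- by apply: eq_integral => y _; rewrite -muleA -EFinM mulrC.
- exact: emeasurable_funM.
- by move=> y _; rewrite mule_ge0// lee_fin phi_ge0.
- by rewrite lee_fin phi_ge0.
Qed.

Lemma gam2_rot (c s : R) (F : R2 -> \bar R) :
  (c ^+ 2 + s ^+ 2 = 1)%R -> (s != 0)%R ->
  measurable_fun setT F -> (forall z, 0 <= F z) ->
  \int[gam]_x \int[gam]_y F (c * x - s * y, s * x + c * y)%R = \int[gam]_x \int[gam]_y F (x, y).
Proof.
move=> cs s0 mF F0.
have mr : measurable_fun setT (fun z : R2 => (c * z.1 - s * z.2, s * z.1 + c * z.2)%R : R2).
  apply: measurable_fun_pair => //.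
    by apply: measurable_funB => //; apply: measurable_funM.
  by apply: measurable_funD => //; apply: measurable_funM.
have mFp : measurable_fun setT (fun z : R2 => F z * (phi z.1 * phi z.2)%:E).
  apply: emeasurable_funM => //; apply/measurable_EFinP; apply: measurable_funM.
    exact: (measurableT_comp measurable_phi measurable_fst).
  exact: (measurableT_comp measurable_phi measurable_snd).
have e1 := gam2_lebesgue (measurableT_comp mF mr) (fun z => F0 _).
have Fp0 z : 0 <= F z * (phi z.1 * phi z.2)%:E.
  by rewrite mule_ge0// lee_fin mulr_ge0// phi_ge0.
have e2 := lebesgue2_rot cs s0 mFp Fp0.
apply: (etrans e1); apply: (etrans _ (etrans e2 (esym (gam2_lebesgue mF F0)))).
apply: eq_integral => x _; apply: eq_integral => y _ /=; congr (_ * _%:E); apply: phiM.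
transitivity ((c ^+ 2 + s ^+ 2) * (x ^+ 2 + y ^+ 2))%R; first by rewrite cs mul1r.
ring.
Qed.

End Rotation.

(** * Orthogonal maps that preserve the Gaussian law *)

Section Orthogonal.
Context {R : realType}.
Local Notation mgauss := (@mgauss R).

Lemma measurable_mulmxr d (T : measurableType d) p q r (X : T -> mxm R p q) (O : 'M[R]_(q, r)) :
  measurable_fun setT X -> measurable_fun setT (fun w => X w *m O : mxm R p r).
Proof.
move=> mX; apply: measurable_mxP => i j.
under [X in measurable_fun _ X]eq_fun do rewrite mxE.
apply: measurable_sum => k; apply: measurable_funM => //.
exact: (measurableT_comp (@measurable_mxE R p q i k) mX).
Qed.

(** Invariance is carried along with orthogonality, for every number of rows, so that it only has to
    be proved for generators and propagated through products and transposes. *)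
Definition ginv q (O : 'M[R]_q) := O *m O^T = 1%:M /\
  forall p (f : mxm R p q -> \bar R), measurable_fun setT f -> (forall M, 0 <= f M)%E ->
    (\int[mgauss p q]_M f (M *m O) = \int[mgauss p q]_M f M)%E.

(** The rows of [M *m O] are the images of the independent rows of [M], so the mass of a box factors
    over the rows. *)
Lemma ginv_row q (O : 'M[R]_q) : O *m O^T = 1%:M ->
  (forall f : mxm R 1 q -> \bar R, measurable_fun setT f -> (forall M, 0 <= f M)%E ->
    (\int[mgauss 1 q]_M f (M *m O) = \int[mgauss 1 q]_M f M)%E) -> ginv O.
Proof.
move=> OO H; split=> // p f mf f0.
have mX : measurable_fun setT (fun M : mxm R p q => M *m O : mxm R p q).
  exact: measurable_mulmxr.
apply: (mgauss_push mX) => // B mB.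
pose D i : set (mxm R 1 q) := box (fun (_ : 'I_1) j => B i j).
have mD i : measurable (D i) by apply: measurable_box => _ j; exact: mB.
have mI i : measurable_fun setT (fun x : mxm R 1 q => (\1_(D i) x)%:E : \bar R).
  by apply/measurable_EFinP; exact: measurable_indic.
have mI' i : measurable_fun setT (fun x : mxm R 1 q => (\1_(D i) (x *m O))%:E : \bar R).
  exact: (measurableT_comp (mI i) (measurable_mulmxr O (@measurable_id _ _ setT))).
transitivity (\int[mgauss p q]_M \prod_i (\1_(D i) (row i M *m O))%:E)%E.
  have mXB : measurable ((fun M : mxm R p q => M *m O : mxm R p q) @^-1` box B).
    by rewrite -[X in measurable X]setTI; apply: mX => //; exact: measurable_box.
  rewrite -[X in mgauss p q X]setIT -(integral_indic (mgauss p q) measurableT mXB).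
  apply: eq_integral => M _; rewrite prodEFin; congr EFin.
  have [h|h] := boolP (M \in (fun M : mxm R p q => M *m O : mxm R p q) @^-1` box B).
    rewrite indicE h big1// => i _; rewrite indicE mem_set// => k j.
    by rewrite -row_mul mxE; have /set_mem/(_ i j) := h.
  rewrite indicE (negbTE h).
  have [i hi] : exists i, ~ D i (row i M *m O).
    apply/existsNP => H'; move/negP: h; apply; apply/mem_set => i j.
    by have := H' i ord0 j; rewrite -row_mul mxE.
  by rewrite (bigD1 i)//= indicE memNset// mul0r.
rewrite (mgauss_rows (F := fun i (x : mxm R 1 q) => (\1_(D i) (x *m O))%:E))//.
apply: eq_bigr => i _; rewrite (H (fun x => (\1_(D i) x)%:E))// integral_indic// setIT.
by apply: (etrans (mgaussE (fun _ j => mB i j))); rewrite big_ord1.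
Qed.

Lemma ginv_mul q (O1 O2 : 'M[R]_q) : ginv O1 -> ginv O2 -> ginv (O1 *m O2).
Proof.
move=> [oo1 h1] [oo2 h2]; split.
  by rewrite trmx_mul mulmxA -(mulmxA O1) oo2 mulmx1 oo1.
move=> p f mf f0; under eq_integral do rewrite mulmxA.
rewrite (h1 p (fun M => f (M *m O2)))//; first exact: h2.
exact: (measurableT_comp mf (measurable_mulmxr O2 (@measurable_id _ _ setT))).
Qed.

Lemma ginv_tr q (O : 'M[R]_q) : ginv O -> ginv O^T.
Proof.
move=> [oo h]; split; first by rewrite trmxK; exact: mulmx1C.
move=> p f mf f0.
rewrite -(h p (fun M => f (M *m O^T)))//.
  by apply: eq_integral => M _; rewrite -mulmxA oo mulmx1.
exact: (measurableT_comp mf (measurable_mulmxr O^T (@measurable_id _ _ setT))).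
Qed.

Lemma ginv1 q : ginv (1%:M : 'M[R]_q).
Proof.
split; first by rewrite trmx1 mulmx1.
by move=> p f _ _; apply: eq_integral => M _; rewrite mulmx1.
Qed.

End Orthogonal.

(** * Orthogonal maps carrying a vector to a coordinate axis *)

Section Transitivity.
Context {R : realType}.
Local Notation mu := (@lebesgue_measure R).
Local Notation gam := (normal_prob (0 : R) 1).
Local Notation mgauss := (@mgauss R).

Lemma integral_lebesgue_opp (f : R -> \bar R) :
  measurable_fun setT f -> (forall x, 0 <= f x)%E ->
  (\int[mu]_x f (- x)%R = \int[mu]_x f x)%E.
Proof.
move=> mf f0; pose h (x : measurableTypeR R) : measurableTypeR R := - x.
have mh : measurable_fun setT h by exact: oppr_measurable.
pose hm := HB.pack_for {mfun _ >-> _} h (isMeasurableFun.Build _ _ _ _ _ mh).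
transitivity (\int[pushforward mu hm]_x f x)%E; first by rewrite ge0_integral_pushforward.
by apply: eq_measure_integral => A mA _; exact: lebesgue_measureN.
Qed.

Lemma gam_opp (f : R -> \bar R) : measurable_fun setT f -> (forall x, 0 <= f x)%E ->
  (\int[gam]_x f (- x)%R = \int[gam]_x f x)%E.
Proof.
move=> mf f0.
have mN : measurable_fun setT (fun x : R => - x) by exact: oppr_measurable.
have mp : measurable_fun setT (fun x => (phi x)%:E : \bar R).
  by apply/measurable_EFinP; exact: measurable_phi.
apply: (etrans (integral_gam (measurableT_comp mf mN) (fun x => f0 _))).
apply: (etrans _ (esym (integral_gam mf f0))).
have mfp : measurable_fun setT (fun x => f x * (phi x)%:E)%E by exact: emeasurable_funM.
have fp0 x : (0 <= f x * (phi x)%:E)%E by rewrite mule_ge0// lee_fin phi_ge0.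
apply: (etrans _ (integral_lebesgue_opp mfp fp0)).
by apply: eq_integral => x _; rewrite /phi /= sqrrN.
Qed.

Definition flip n (i : 'I_n) : 'M[R]_n := diag_mx (\row_k if k == i then -1 else 1).

Lemma mul_flipE n (i : 'I_n) p (M : 'M[R]_(p, n)) a k :
  (M *m flip i) a k = if k == i then - M a k else M a k.
Proof. by rewrite mul_mx_diag !mxE; case: ifP => _; rewrite ?mulr1 ?mulrN1. Qed.

Lemma ginv_flip n (i : 'I_n) : ginv (flip i).
Proof.
apply: ginv_row.
  rewrite tr_diag_mx; apply/matrixP => a b; rewrite mul_flipE !mxE.
  case: (eqVneq a b) => [->|_]; last by rewrite !mulr0n oppr0 if_same.
  by rewrite !mulr1n; case: eqP => _; rewrite ?opprK.
move=> f mf f0.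
have mX : measurable_fun setT (fun M : mxm R 1 n => M *m flip i : mxm R 1 n).
  exact: (measurable_mulmxr _ (@measurable_id _ _ setT)).
have e1 := mgauss_setc i (measurableT_comp mf mX) (fun M => f0 _).
apply: (etrans e1); apply: (etrans _ (esym (mgauss_setc i mf f0))).
have mS : measurable_fun setT (fun z : measurableTypeR R * mxm R 1 n => f (setc i z.1 z.2)).
  exact: (measurableT_comp mf (measurable_setc i)).
have mI : measurable_fun setT (fun x : R => \int[mgauss 1 n]_M f (setc i x M))%E.
  by apply: (@measurable_fun_fubini_tonelli_F _ _ _ _ _ (mgauss 1 n) _ mS) => z.
have I0 (x : R) : (0 <= \int[mgauss 1 n]_M f (setc i x M))%E by exact: integral_ge0.
apply: (etrans _ (gam_opp mI I0)).
apply: eq_integral => x _.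
have mN : measurable_fun setT (fun M : mxm R 1 n => f (setc i (- x) M)).
  exact: (measurableT_comp mS (pair1_measurable (- x : measurableTypeR R))).
apply: eq_integral => M _; congr f; apply/matrixP => a k.
by rewrite mul_flipE /setc !mxE; case: (k == i).
Qed.

Definition givens n (i j : 'I_n) (c s : R) : 'M[R]_n := \matrix_(k, l)
  if k == i then if l == i then c else if l == j then s else 0
  else if k == j then if l == i then - s else if l == j then c else 0
  else (k == l)%:R.

Lemma mul_givens n (i j : 'I_n) c s (x : 'rV[R]_n) l : i != j ->
  (x *m givens i j c s) 0 l =
  if l == i then c * x 0 i - s * x 0 j
  else if l == j then s * x 0 i + c * x 0 j else x 0 l.
Proof.
move=> ij; have ji : j != i by rewrite eq_sym.
rewrite mxE (bigD1 i)//= (bigD1 j)//= !mxE !eqxx (negbTE ji).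
have -> : \sum_(k < n | (k != i) && (k != j)) x 0 k * givens i j c s k l =
    if (l == i) || (l == j) then 0 else x 0 l.
  transitivity (\sum_(k < n | (k != i) && (k != j)) x 0 k * (k == l)%:R).
    by apply: eq_bigr => k /andP[/negbTE ki /negbTE kj]; rewrite mxE ki kj.
  case: ifP => [/orP lij|/norP[li lj]].
    rewrite big1// => k /andP[ki kj]; case: eqP => [kl|]; last by rewrite mulr0.
    by case: lij => /eqP e; move: ki kj; rewrite kl e eqxx.
  rewrite (bigD1 l) ?li//= eqxx mulr1 big1 ?addr0// => k /andP[_ /negbTE ->].
  by rewrite mulr0.
case: eqP => _ /=; first by rewrite addr0; ring.
by case: eqP => _ /=; [rewrite addr0; ring | rewrite !mulr0 !add0r].
Qed.

Definition dot n (x y : 'rV[R]_n) : R := \sum_i x 0 i * y 0 i.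

Lemma dotE n (x y : 'rV[R]_n) : dot x y = (x *m y^T) 0 0.
Proof. by rewrite mxE; apply: eq_bigr => i _; rewrite mxE. Qed.

Lemma givens_orth n (i j : 'I_n) c s : i != j -> c ^+ 2 + s ^+ 2 = 1 ->
  givens i j c s *m (givens i j c s)^T = 1%:M.
Proof.
move=> ij cs; have ji : j != i by rewrite eq_sym.
have H (x y : 'rV[R]_n) : dot (x *m givens i j c s) (y *m givens i j c s) = dot x y.
  rewrite /dot (bigD1 i)//= (bigD1 j)//= [RHS](bigD1 i)//= [in RHS](bigD1 j)//=.
  rewrite !mul_givens// !eqxx (negbTE ji) !addrA; congr (_ + _).
    transitivity ((c ^+ 2 + s ^+ 2) * (x 0 i * y 0 i + x 0 j * y 0 j)); first ring.
    by rewrite cs mul1r.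
  by apply: eq_bigr => k /andP[/negbTE ki /negbTE kj]; rewrite !mul_givens// ki kj.
apply/matrixP => k l.
transitivity (dot (delta_mx 0 k *m givens i j c s) (delta_mx 0 l *m givens i j c s)).
  by rewrite /dot mxE; apply: eq_bigr => r _; rewrite -!rowE !mxE.
rewrite H dotE trmx_delta mul_delta_mx_cond !mxE.
by case: eqP => _; rewrite ?mulr1n ?mulr0n !mxE.
Qed.

Lemma ginv_givens n (i j : 'I_n) c s : i != j -> c ^+ 2 + s ^+ 2 = 1 -> s != 0 ->
  ginv (givens i j c s).
Proof.
move=> ij cs s0; apply: ginv_row; first exact: givens_orth.
move=> f mf f0.
have mG : measurable_fun setT (fun M : mxm R 1 n => M *m givens i j c s : mxm R 1 n).
  exact: (measurable_mulmxr _ (@measurable_id _ _ setT)).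
have e1 := mgauss_setc2 ij (measurableT_comp mf mG) (fun M => f0 _).
apply: (etrans e1); apply: (etrans _ (esym (mgauss_setc2 ij mf f0))).
apply: eq_integral => M _.
have mF : measurable_fun setT (fun z : measurableTypeR R * measurableTypeR R => f (setc2 i j z M)).
  exact: (measurableT_comp (measurableT_comp mf (measurable_setc2 i j)) (pair2_measurable M)).
apply: (etrans _ (gam2_rot cs s0 mF (fun z => f0 _))).
apply: eq_integral => x _; apply: eq_integral => y _; congr f.
apply/matrixP => o l; rewrite ord1 mul_givens// !mxE !eqxx [j == i]eq_sym (negbTE ij).
by case: eqP => //; case: eqP.
Qed.

Definition proj n (J : {set 'I_n}) : 'M[R]_n := diag_mx (\row_j (j \in J)%:R).

Lemma mul_projE n (J : {set 'I_n}) p (M : 'M[R]_(p, n)) i j :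
  (M *m proj J) i j = if j \in J then M i j else 0.
Proof. by rewrite mul_mx_diag !mxE; case: ifP => _; rewrite ?mulr1 ?mulr0. Qed.

Lemma proj_mulE n (J : {set 'I_n}) q (M : 'M[R]_(n, q)) i j :
  (proj J *m M) i j = if i \in J then M i j else 0.
Proof. by rewrite mul_diag_mx !mxE; case: ifP => _; rewrite ?mul1r ?mul0r. Qed.

Lemma dot_ge0 n (x : 'rV[R]_n) : 0 <= dot x x.
Proof. by apply: sumr_ge0 => i _; rewrite -expr2 sqr_ge0. Qed.

Lemma dot_orth n (O : 'M[R]_n) x y : O *m O^T = 1%:M -> dot (x *m O) (y *m O) = dot x y.
Proof. by move=> OO; rewrite !dotE trmx_mul mulmxA -(mulmxA x) OO mulmx1. Qed.

Lemma dot_gt0 n (x : 'rV[R]_n) : x != 0 -> (0 < dot x x).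
Proof.
move=> x0; rewrite lt_neqAle dot_ge0 andbT eq_sym; apply: contra x0 => /eqP h.
apply/eqP/matrixP => a b; rewrite ord1 mxE; apply/eqP; rewrite -sqrf_eq0.
move/eqP: h; rewrite /dot psumr_eq0; last by move=> k _; rewrite -expr2 sqr_ge0.
by move=> /allP /(_ b); rewrite mem_index_enum -expr2; exact.
Qed.

(** Rotations in the planes of [i0] and [j], for [j] in [J], cancel the coordinates of [h] one after
    the other, and a final flip of coordinate [i0] corrects the sign. Only coordinates in [J] are
    involved, so [Q] commutes with [proj J] and is the identity on the complement. *)
Lemma ginv_transitive n (J : {set 'I_n}) (i0 : 'I_n) (h : 'rV[R]_n) :
  i0 \in J -> h *m proj J = h ->
  exists Q : 'M[R]_n, [/\ ginv Q, Q *m proj J = proj J *m Q,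
    (1%:M - proj J) *m Q = 1%:M - proj J &
    h *m Q = Num.sqrt (dot h h) *: delta_mx 0 i0].
Proof.
move=> iJ hJ.
suff [Q [gQ QJ Qf [r hQ]]] : exists Q : 'M[R]_n, [/\ ginv Q, Q *m proj J = proj J *m Q,
    (1%:M - proj J) *m Q = 1%:M - proj J &
    exists r, h *m Q = r *: delta_mx 0 i0].
  have rr : dot h h = r ^+ 2.
    rewrite -(dot_orth _ _ gQ.1) hQ /dot (bigD1 i0)//= !mxE !eqxx mulr1.
    by rewrite big1 ?addr0// => k /negbTE ki; rewrite !mxE ki andbF mulr0 mul0r.
  case: (leP 0 r) => r0.
    by exists Q; rewrite rr sqrtr_sqr ger0_norm.
  exists (Q *m flip i0); split.
  - exact: (ginv_mul gQ (ginv_flip i0)).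
  - rewrite -mulmxA (_ : flip i0 *m proj J = proj J *m flip i0) ?mulmxA ?QJ//.
    by rewrite !mulmx_diag; congr diag_mx; apply/rowP => k; rewrite !mxE mulrC.
  - rewrite mulmxA Qf; apply/matrixP => a k; rewrite mul_flipE; case: eqP => // ->.
    by rewrite !mxE; case: eqP => [->|_]; rewrite ?iJ ?mulr0n ?subrr ?oppr0// subr0 oppr0.
  rewrite mulmxA hQ rr sqrtr_sqr ltr0_norm// -scalemxAl.
  apply/matrixP => a k; rewrite mxE [RHS]mxE mul_flipE !mxE.
  by case: (k == i0); rewrite ?andbF ?mulr0 ?oppr0 ?mulrN ?mulNr.
suff [Q [gQ QJ Qf hQ]] : exists Q : 'M[R]_n, [/\ ginv Q, Q *m proj J = proj J *m Q,
    (1%:M - proj J) *m Q = 1%:M - proj J &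
    forall k, k != i0 -> (h *m Q) 0 k = if k \in enum J then 0 else h 0 k].
  exists Q; split=> //; exists ((h *m Q) 0 i0); apply/matrixP => a k.
  rewrite ord1 !mxE eqxx /=; case: (eqVneq k i0) => [->|ki]; first by rewrite mulr1.
  rewrite mulr0; have := hQ k ki; rewrite mem_enum mxE; case: ifP => // kJ ->.
  by rewrite -hJ mul_projE kJ.
have : {subset enum J <= J} by move=> k; rewrite mem_enum.
elim: (enum J) => [_|j s IH sJ].
  exists 1%:M; split; [exact: ginv1|by rewrite mul1mx mulmx1|by rewrite mulmx1|by move=> k _; rewrite mulmx1].
have [|Q [gQ QJ Qf hQ]] := IH; first by move=> k ks; apply: sJ; rewrite inE ks orbT.
have jJ : j \in J by apply: sJ; rewrite inE eqxx.
have [ji|ji] := eqVneq j i0.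
  by exists Q; split=> // k ki; rewrite inE ji (negbTE ki) /= hQ.
set a := (h *m Q) 0 i0; set b := (h *m Q) 0 j.
have [b0|b0] := eqVneq b 0.
  exists Q; split=> // k ki; rewrite inE; case: (eqVneq k j) => [->|_] /=; first exact: b0.
  exact: hQ.
have ij : i0 != j by rewrite eq_sym.
pose r := Num.sqrt (a ^+ 2 + b ^+ 2).
have r2 : r ^+ 2 = a ^+ 2 + b ^+ 2 by rewrite sqr_sqrtr// addr_ge0// sqr_ge0.
have ab0 : 0 < a ^+ 2 + b ^+ 2 by rewrite ltr_wpDl ?sqr_ge0// exprn_even_gt0.
have r0 : r != 0 by rewrite gt_eqF// sqrtr_gt0.
(* The angle for which coordinate [j] of the image, s a + c b, vanishes; [b != 0] provides the
   nonzero sine that [ginv_givens] asks for. *)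
pose G := givens i0 j (a / r) (- b / r).
exists (Q *m G); split.
- apply: ginv_mul => //; apply: ginv_givens => //.
    by rewrite !expr_div_n sqrrN -mulrDl -r2 divff// expf_neq0.
  by rewrite mulf_neq0 ?oppr_eq0 ?invr_eq0.
- rewrite -mulmxA.
  have -> : G *m proj J = proj J *m G.
    apply/matrixP => k l; rewrite mul_projE proj_mulE !mxE.
    case: (eqVneq k i0) => [->|ki]; first rewrite iJ.
      case: (eqVneq l i0) => [->|li]; first by rewrite iJ.
      by case: (eqVneq l j) => [->|lj]; [rewrite jJ|case: ifP].
    case: (eqVneq k j) => [->|kj]; first rewrite jJ.
      case: (eqVneq l i0) => [->|li]; first by rewrite iJ.
      by case: (eqVneq l j) => [->|lj]; [rewrite jJ|case: ifP].
    by case: (eqVneq k l) => [->|_] //=; case: ifP; case: ifP.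
  by rewrite mulmxA QJ mulmxA.
- rewrite mulmxA Qf; apply/matrixP => k l; rewrite mulmxBl mul1mx [LHS]mxE [X in _ + X]mxE proj_mulE.
  rewrite !mxE; case kJ : (k \in J).
    by rewrite subrr; case: (k == l) => //=; rewrite ?mulr1n ?mulr0n subrr.
  have -> : (k == i0) = false by apply: contraFF kJ => /eqP ->.
  have -> : (k == j) = false by apply: contraFF kJ => /eqP ->.
  by rewrite mul0rn subr0.
- move=> k ki; rewrite mulmxA mul_givens// (negbTE ki) inE.
  case: (eqVneq k j) => [_|kj] /=; last exact: hQ.
  by rewrite -/a -/b; field.
Qed.

End Transitivity.

(** * Probabilities as integrals of boolean functions *)

Section BoolIntegrals.
Context {R : realType}.
Local Notation mgauss := (@mgauss R).
Local Open Scope ereal_scope.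

Definition bE (b : bool) : \bar R := (b%:R)%:E.

Lemma bE_ge0 b : 0 <= bE b. Proof. by rewrite lee_fin ler0n. Qed.

Lemma bE_le1 b : bE b <= 1. Proof. by case: b; rewrite lee_fin// ler01. Qed.

Lemma bE_and a b : bE (a && b) = bE a * bE b.
Proof. by case: a; rewrite ?mul1e ?mul0e. Qed.

Lemma le_bE (a b : bool) : (a -> b) -> bE a <= bE b.
Proof. by case: a b => -[]// /(_ isT). Qed.

Lemma measurable_bE d (T : measurableType d) (F : T -> bool) :
  measurable_fun setT F -> measurable_fun setT (fun w => bE (F w)).
Proof.
move=> mF; apply/measurable_EFinP.
have -> : (fun w => (F w)%:R) = (fun w => if F w then 1%R else 0%R : R).
  by apply/funext => w; case: (F w).
by apply: measurable_fun_ifT => //; exact: measurable_cst.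
Qed.

Lemma measurable_boolP d (T : measurableType d) (F : T -> bool) :
  measurable_fun setT F -> measurable [set w | F w].
Proof. by move=> mF; have := mF measurableT [set true]; rewrite setTI; apply. Qed.

Lemma integral_bE d (T : measurableType d) (mu : {measure set T -> \bar R}) (F : T -> bool) :
  measurable_fun setT F -> \int[mu]_w bE (F w) = mu [set w | F w].
Proof.
move=> mF; rewrite -[X in mu X]setIT -(integral_indic mu measurableT (measurable_boolP mF)).
apply: eq_integral => w _; rewrite /bE indicE; congr ((_ : bool)%:R)%:E.
by apply/idP/idP => [/mem_set|/set_mem].
Qed.

Lemma int_bE_le1 p q (F : mxm R p q -> bool) : measurable_fun setT F ->
  \int[mgauss p q]_M bE (F M) <= 1.
Proof.
move=> mF; apply: (@le_trans _ _ (\int[mgauss p q]_M cst 1 M)).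
  apply: ge0_le_integral => //.
  - by move=> M _; exact: bE_ge0.
  - exact: measurable_bE.
  - by move=> M _; exact: bE_le1.
by rewrite integral_cst// mul1e; exact: probability_le1.
Qed.

Lemma int_bE_fin p q (F : mxm R p q -> bool) : measurable_fun setT F ->
  \int[mgauss p q]_M bE (F M) \is a fin_num.
Proof.
move=> mF; rewrite ge0_fin_numE; last by apply: integral_ge0 => M _; exact: bE_ge0.
exact: le_lt_trans (int_bE_le1 mF) (ltry _).
Qed.

Lemma mgauss_row p q (i : 'I_p) (f : mxm R 1 q -> \bar R) :
  measurable_fun setT f -> (forall M, 0 <= f M) ->
  \int[mgauss p q]_M f (row i M) = \int[mgauss 1 q]_M f M.
Proof.
move=> mf f0.
pose F k M : \bar R := if k == i then f M else 1.
transitivity (\int[mgauss p q]_M \prod_k F k (row k M)).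
  apply: eq_integral => M _; rewrite (bigD1 i)//= /F eqxx big1 ?mule1// => k.
  by move=> /negbTE ->.
rewrite mgauss_rows//.
- rewrite (bigD1 i)//= /F eqxx big1 ?mule1// => k /negbTE ->.
  by rewrite integral_cst// mul1e [LHS]probability_setT.
- by move=> k; rewrite /F; case: eqP.
- by move=> k M; rewrite /F; case: eqP.
Qed.

(** An orthogonal map on the row indices takes [om] to a positive multiple of a coordinate vector.
    The combination [om *m B] then has the law of a positive multiple of a single row, and [f] does
    not see the scale. *)
Lemma mgauss_comb p q (om : 'rV[R]_p) (f : mxm R 1 q -> \bar R) :
  om != 0%R -> measurable_fun setT f -> (forall M, 0 <= f M) ->
  (forall (c : R) M, (0 < c)%R -> f (c *: M)%R = f M) ->
  \int[mgauss p q]_B f (om *m B)%R = \int[mgauss 1 q]_M f M.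
Proof.
move=> om0 mf f0 fZ.
have [i0 _] : exists i0 : 'I_p, true.
  case: p om om0 => [|p] om om0; last by exists ord0.
  by move: om0; rewrite thinmx0 eqxx.
have projT : proj [set: 'I_p] = 1%:M :> 'M[R]_p.
  by apply/matrixP => i j; rewrite !mxE inE.
have [//||Q [gQ _ _ hQ]] := @ginv_transitive R p finset.setT i0 om.
- by rewrite inE.
- by rewrite projT mulmx1.
have d0 := dot_gt0 om0.
have mB p' (f' : 'M[R]_(1, p')) : measurable_fun setT (fun B : mxm R p' q => f' *m B : mxm R 1 q)%R.
  apply: measurable_mxP => i j; under [X in measurable_fun _ X]eq_fun do rewrite mxE.
  by apply: measurable_sum => k; apply: measurable_funM => //; exact: measurable_mxE.
have mg : measurable_fun setT (fun B : mxm R p q => f (om *m B)%R).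
  exact: (measurableT_comp mf (mB _ om)).
apply: (etrans (esym (mgauss_trmx mg (fun B => f0 _)))).
have mg' : measurable_fun setT (fun B : mxm R q p => f (om *m B^T)%R).
  exact: (measurableT_comp mg (@measurable_trmx R q p)).
apply: (etrans (esym ((ginv_tr gQ).2 q _ mg' (fun B => f0 _)))).
have mh : measurable_fun setT (fun B : mxm R p q => f (row i0 B)).
  exact: (measurableT_comp mf (@measurable_row R p q i0)).
apply: (etrans _ (mgauss_row i0 mf f0)).
apply: (etrans _ (mgauss_trmx mh (fun B => f0 _))).
apply: eq_integral => B _ /=.
rewrite trmx_mul trmxK mulmxA hQ -scalemxAl -rowE fZ// sqrtr_gt0//.
Qed.

End BoolIntegrals.

(** * Gaussian mass of circular cones *)

Section OpenCone.
Context {R : realType}.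
Local Notation mu := (@lebesgue_measure R).
Local Notation gam := (normal_prob (0 : R) 1).
Local Notation mgauss := (@mgauss R).
Local Open Scope ereal_scope.

Lemma gam_set1 (x : R) : gam [set x] = 0.
Proof.
by have /null_content_dominatesP := normal_prob_dominates (0 : R)%R 1%R; apply => //; exact: lebesgue_measure_set1.
Qed.

Lemma gam_itv_gt0 (a b : R) : (a < b)%R -> 0 < gam `]a, b[%classic.
Proof.
move=> ab; pose t := (`|a| + `|b|)%R.
have pt : (0 < @phi R t)%R.
  by rewrite /phi mulr_gt0 ?expR_gt0// invr_gt0 sqrtr_gt0 mulrn_wgt0// pi_gt0.
apply: (@lt_le_trans _ _ (\int[mu]_(x in `]a, b[) (phi t)%:E)).
  rewrite integral_cst// [X in _ * X]lebesgue_measure_itv/= lte_fin ab -EFinD -EFinM lte_fin.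
  by rewrite mulr_gt0// subr_gt0.
rewrite /normal_prob; apply: ge0_le_integral => //.
- by move=> x _; rewrite lee_fin ltW.
- apply/measurable_funTS/measurable_EFinP; exact: measurable_normal_pdf.
move=> x /=; rewrite in_itv/= => /andP[ax xb]; rewrite lee_fin normal_pdf01 /phi.
rewrite ler_wpM2l ?invr_ge0 ?sqrtr_ge0// ler_expR !mulNr lerN2 ler_wpM2r ?invr_ge0//.
have xt : (`|x| <= t)%R.
  rewrite ler_norml; apply/andP; split.
    apply: (le_trans _ (ltW ax)); rewrite opprD.
    by have := ler_norm (- a); rewrite normrN; have := normr_ge0 b; lra.
  apply: (le_trans (ltW xb)); have := ler_norm b; have := normr_ge0 a; rewrite /t; lra.
by rewrite -(real_normK (num_real x)) ler_sqr ?nnegrE ?addr_ge0.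
Qed.

Lemma dotZl n (c : R) (x y : 'rV[R]_n) : (dot (c *: x) y = c * dot x y)%R.
Proof. by rewrite !dotE -scalemxAl mxE. Qed.

Lemma dotC n (x y : 'rV[R]_n) : dot x y = dot y x.
Proof. by apply: eq_bigr => i _; rewrite mulrC. Qed.

Lemma dotZr n (c : R) (x y : 'rV[R]_n) : (dot x (c *: y) = c * dot x y)%R.
Proof. by rewrite dotC dotZl dotC. Qed.

Lemma dotDl n (x y z : 'rV[R]_n) : (dot (x + y) z = dot x z + dot y z)%R.
Proof. by rewrite !dotE mulmxDl mxE. Qed.

Lemma dot0l n (x : 'rV[R]_n) : dot 0%R x = 0%R.
Proof. by rewrite /dot big1// => i _; rewrite mxE mul0r. Qed.

Lemma measurable_dot d (T : measurableType d) n (X Y : T -> mxm R 1 n) :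
  measurable_fun setT X -> measurable_fun setT Y ->
  measurable_fun setT (fun w => dot (X w) (Y w)).
Proof.
move=> mX mY; apply: measurable_sum => k; apply: measurable_funM.
  exact: (measurableT_comp (@measurable_mxE R 1 n ord0 k) mX).
exact: (measurableT_comp (@measurable_mxE R 1 n ord0 k) mY).
Qed.

(* For c >= 0, h lies in the open circular cone of axis y whose half-angle has squared cosine c. *)
Definition cap n (c : R) (y h : 'rV[R]_n) : bool :=
  (0 < dot y h)%R && (c * (dot y y * dot h h) < dot y h ^+ 2)%R.

Lemma capC n c (y h : 'rV[R]_n) : cap c y h = cap c h y.
Proof. by rewrite /cap dotC (mulrC (dot y y)). Qed.

Lemma capZl n c a (y h : 'rV[R]_n) : (0 < a)%R -> cap c (a *: y) h = cap c y h.
Proof.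
move=> a0; rewrite /cap dotZl dotZr dotZl pmulr_rgt0//; congr (_ && _).
rewrite exprMn -[RHS](ltr_pM2l (exprn_gt0 2 a0)); congr (_ < _)%R; ring.
Qed.

Lemma cap_orth n c (Q : 'M[R]_n) y h : Q *m Q^T = 1%:M ->
  cap c (y *m Q)%R (h *m Q)%R = cap c y h.
Proof. by move=> QQ; rewrite /cap !dot_orth. Qed.

Lemma cap_le n (c c' : R) (y h : 'rV[R]_n) : (c' <= c)%R -> cap c y h -> cap c' y h.
Proof.
move=> cc /andP[p1 p2]; rewrite /cap p1; apply: le_lt_trans p2.
by rewrite ler_wpM2r// mulr_ge0// dot_ge0.
Qed.

Lemma measurable_cap d (T : measurableType d) n c (X Y : T -> mxm R 1 n) :
  measurable_fun setT X -> measurable_fun setT Y ->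
  measurable_fun setT (fun w => cap c (X w) (Y w)).
Proof.
move=> mX mY; apply: measurable_and; apply: measurable_fun_ltr => //.
- exact: measurable_dot.
- by apply: measurable_funM => //; apply: measurable_funM; exact: measurable_dot.
- by apply: measurable_funX; exact: measurable_dot.
Qed.

Lemma proj_idem n (J : {set 'I_n}) : (proj J *m proj J = proj J :> 'M[R]_n)%R.
Proof.
apply/matrixP => i j; rewrite mul_projE !mxE.
by case: ifP => // jJ; case: eqP => // ij; rewrite ij jJ.
Qed.

(** The cone contains, up to projection, a box of positive mass in which coordinate [i0] is large
    and the others are bounded by 1. A negative [c] is first raised to 0, which only shrinks the
    cone. *)
Lemma cap_axis_gt0 n (J : {set 'I_n}) (i0 : 'I_n) (c : R) : i0 \in J -> (c < 1)%R ->
  0 < \int[mgauss 1 n]_h bE (cap c (delta_mx 0 i0)%R (h *m proj J)%R).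
Proof.
move=> iJ c1.
pose c' := Num.max c 0%R.
have c'1 : (c' < 1)%R by rewrite gt_max c1 ltr01.
have c'0 : (0 <= c')%R by rewrite le_max lexx orbT.
(* Solves (1 - c') (L - 1) = c' n. With x = [h ord0 i0] > L >= 1 this gives c' n < (1 - c') x^2,
   hence c' (x^2 + n) < x^2. *)
pose L := (1 + c' * n%:R / (1 - c'))%R.
have L1 : (1 <= L)%R by rewrite lerDl divr_ge0 ?mulr_ge0// subr_ge0 ltW.
pose B (i : 'I_1) (j : 'I_n) : set R := if j == i0 then `]L, (L + 1)%R[%classic else `](-1)%R, 1%R[%classic.
have mB i j : measurable (B i j) by rewrite /B; case: ifP.
have mcap : measurable_fun setT (fun h : mxm R 1 n => cap c (delta_mx 0 i0)%R (h *m proj J)%R).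
  apply: measurable_cap; first exact: measurable_cst.
  exact: (measurable_mulmxr _ (@measurable_id _ _ setT)).
apply: (@lt_le_trans _ _ (mgauss 1 n (box B))).
  rewrite (mgaussE mB) big_ord1.
  elim/big_ind: _ => //; first exact: mule_gt0.
  by move=> j _; rewrite /B; case: ifP => _; apply: gam_itv_gt0; lra.
have mBB : measurable (box B : set (mxm R 1 n)) by exact: measurable_box.
rewrite -[X in mgauss 1 n X]setIT -(integral_indic (mgauss 1 n) measurableT mBB).
apply: ge0_le_integral => //.
- by apply/measurable_EFinP; exact: measurable_indic.
- exact: measurable_bE.
move=> h _; rewrite indicE; case: (boolP (h \in _)) => [/set_mem Bh|_]; last exact: bE_ge0.
suff -> : cap c (delta_mx 0 i0)%R (h *m proj J)%R by [].
have de x : (dot (delta_mx 0 i0) x = x ord0 i0)%R.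
  rewrite /dot (bigD1 i0)//= mxE !eqxx mul1r big1 ?addr0// => k /negbTE ki.
  by rewrite mxE ki andbF mul0r.
apply: (@cap_le n c'); first by rewrite le_max lexx.
rewrite /cap !de mul_projE iJ mxE !eqxx mul1r.
have := Bh ord0 i0; rewrite /B eqxx /= in_itv /= => /andP[hL _].
rewrite (le_lt_trans _ hL)/=; last by apply: le_trans L1.
have hh : (dot (h *m proj J) (h *m proj J) <= h ord0 i0 ^+ 2 + n%:R)%R.
  rewrite /dot (bigD1 i0)//= mul_projE iJ -expr2 lerD2l.
  apply: (@le_trans _ _ (\sum_(i < n) 1)%R); last by rewrite sumr_const card_ord.
  rewrite big_mkcond; apply: ler_sum => k _; case: ifP => // /negbTE ki.
  rewrite mul_projE; case: ifP => _; last by rewrite mul0r.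
  have := Bh ord0 k; rewrite /B ki /= in_itv /= => /andP[h1 h2]; nra.
apply: (@le_lt_trans _ _ (c' * (h ord0 i0 ^+ 2 + n%:R))%R); first by rewrite ler_wpM2l.
have : (c' * n%:R < (1 - c') * h ord0 i0 ^+ 2)%R; last by lra.
have Le : ((1 - c') * (L - 1) = c' * n%:R)%R.
  by rewrite /L addrAC subrr add0r mulrC divfK// subr_eq0 eq_sym lt_eqF.
rewrite -Le ltr_pM2l ?subr_gt0//.
have : (L <= L ^+ 2)%R by rewrite ler_eXnr.
have : (L ^+ 2 < h ord0 i0 ^+ 2)%R by rewrite ltr_pXn2r// nnegrE; lra.
lra.
Qed.

End OpenCone.

(** * Direction of a rotation-equivariant function of a Gaussian matrix *)

Section RotationInvariantDirection.
Context {R : realType}.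
Local Notation gam := (normal_prob (0 : R) 1).
Local Notation mgauss := (@mgauss R).
Local Notation bE := (@bE R).
Local Open Scope ereal_scope.
Variables (p n : nat) (J : {set 'I_n}) (i0 : 'I_n).
Hypothesis iJ : i0 \in J.
Local Notation P := (proj J : 'M[R]_n).
Local Notation e0 := (delta_mx 0 i0 : 'rV[R]_n)%R.

Let capP c y (h : mxm R 1 n) := cap c y (h *m P)%R.

Let mproj : measurable_fun setT (fun h : mxm R 1 n => h *m P : mxm R 1 n)%R.
Proof. exact: (measurable_mulmxr _ (@measurable_id _ _ setT)). Qed.

Let mcapP c y : measurable_fun setT (capP c y).
Proof. by apply: measurable_cap; [exact: measurable_cst|exact: mproj]. Qed.

Let fromaxis (h : 'rV[R]_n) : (h *m P = h -> h != 0 ->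
  exists Q : 'M[R]_n, [/\ ginv Q, Q *m P = P *m Q &
    exists2 r, 0 < r & h *m Q = r *: e0])%R.
Proof.
move=> hP h0; have [Q [gQ QP _ hQ]] := ginv_transitive iJ hP.
exists Q; split=> //; exists (Num.sqrt (dot h h)) => //.
by rewrite sqrtr_gt0 dot_gt0.
Qed.

Let int_cap c y : (y *m P = y)%R -> y != 0%R ->
  \int[mgauss 1 n]_h bE (capP c y h) = \int[mgauss 1 n]_h bE (capP c e0 h).
Proof.
move=> yP y0; have [Q [gQ QP [r r0 yQ]]] := fromaxis yP y0.
have mf := @measurable_bE R _ _ _ (mcapP c e0).
apply: (etrans _ (gQ.2 1%N _ mf (fun h => bE_ge0 _))).
apply: eq_integral => h _; rewrite /capP -(cap_orth _ _ _ gQ.1) yQ capZl//.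
by rewrite -!mulmxA QP.
Qed.

Variable Y : mxm R p n -> mxm R 1 n.
Hypothesis mY : measurable_fun setT Y.
Hypothesis YP : forall M, (Y M *m P = Y M)%R.
Hypothesis Yrot : forall (Q : 'M[R]_n) M, (Q *m Q^T = 1%:M)%R ->
  (Q *m P = P *m Q)%R -> (Y (M *m Q) = Y M *m Q)%R.

Let int_capY c h : (h *m P != 0)%R ->
  \int[mgauss p n]_M bE (capP c (Y M) h) = \int[mgauss p n]_M bE (cap c (Y M) e0).
Proof.
move=> h0; have hPP : (h *m P *m P = h *m P)%R by rewrite -mulmxA proj_idem.
have [Q [gQ QP [r r0 yQ]]] := fromaxis hPP h0.
have mf : measurable_fun setT (fun M : mxm R p n => bE (cap c (Y M) e0)).
  by apply: measurable_bE; apply: measurable_cap => //; exact: measurable_cst.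
apply: (etrans _ (gQ.2 p _ mf (fun h => bE_ge0 _))).
apply: eq_integral => M _; rewrite /capP -(cap_orth _ _ _ gQ.1) yQ Yrot ?gQ.1//.
by rewrite capC capZl// capC.
Qed.

Let int_capY_le c h :
  \int[mgauss p n]_M bE (capP c (Y M) h) <= \int[mgauss p n]_M bE (cap c (Y M) e0).
Proof.
have [h0|h0] := eqVneq (h *m P)%R 0%R; last by rewrite int_capY.
rewrite integral0_eq; first by apply: integral_ge0 => M _; exact: bE_ge0.
by move=> M _; rewrite /capP h0 /cap dotC dot0l ltxx.
Qed.

Let mcapY c : measurable_fun setT (fun z : mxm R p n * mxm R 1 n => bE (capP c (Y z.1) z.2)).
Proof.
apply: measurable_bE; apply: measurable_cap.
  exact: (measurableT_comp mY measurable_fst).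
exact: (measurableT_comp mproj measurable_snd).
Qed.

(** Both sides appear when the event that [h] lies in the cap around [Y M] is integrated over both
    variables. Integrating [M] first gives the left side for almost every [h]; integrating [h] first
    gives the right side, or 0 when [Y M = 0], which is why only an inequality holds. *)
Let cap_swap c :
  \int[mgauss p n]_M bE (cap c (Y M) e0) <= \int[mgauss 1 n]_h bE (capP c e0 h).
Proof.
set b := (X in X <= _); set a := (X in _ <= X).
have b0 : 0 <= b by apply: integral_ge0 => M _; exact: bE_ge0.
have a0 : 0 <= a by apply: integral_ge0 => M _; exact: bE_ge0.
have -> : b = \int[mgauss 1 n]_h \int[mgauss p n]_M bE (capP c (Y M) h).
  have mne : measurable_fun setT (fun x : R => bE (x != 0%R)).
    by apply: measurable_bE; apply: measurable_neg; apply: measurable_fun_eqr => //; exact: measurable_cst.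
  have ne1 : \int[mgauss 1 n]_h bE (h ord0 i0 != 0%R) = 1.
    apply: (etrans (mgauss_coord i0 mne (fun x => bE_ge0 _))).
    have m0 : measurable (~` [set (0 : R)%R]) by exact: measurableC.
    transitivity (\int[gam]_x (\1_(~` [set (0 : R)%R]) x)%:E).
      apply: eq_integral => x _; rewrite /bE indicE; congr ((_ : bool)%:R)%:E.
      apply/idP/idP => [/eqP x0|/set_mem/eqP//]; exact/mem_set.
    apply: (etrans (integral_indic gam measurableT m0)).
    rewrite setIT; apply: (etrans (probability_setC gam (measurable_set1 _))).
    by rewrite [X in _ - X]gam_set1 sube0.
  apply/eqP; rewrite eq_le; apply/andP; split; last first.
    apply: (@le_trans _ _ (\int[mgauss 1 n]_h (cst b h))).
      apply: ge0_le_integral => //.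
      - by move=> h _; apply: integral_ge0 => M _; exact: bE_ge0.
      - by apply: (measurable_fun_fubini_tonelli_G _ (mcapY c)) => z; exact: bE_ge0.
    by rewrite integral_cst// [X in _ * X]probability_setT mule1.
  apply: (@le_trans _ _ (\int[mgauss 1 n]_h (b * bE (h ord0 i0 != 0%R)))).
    rewrite ge0_integralZl// ?ne1 ?mule1//; last by move=> h _; exact: bE_ge0.
    exact: (measurableT_comp mne (@measurable_mxE R 1 n ord0 i0)).
  apply: ge0_le_integral => //.
  - by move=> h _; rewrite mule_ge0// bE_ge0.
  - apply: emeasurable_funM; first exact: measurable_cst.
    exact: (measurableT_comp mne (@measurable_mxE R 1 n ord0 i0)).
  - by apply: (measurable_fun_fubini_tonelli_G _ (mcapY c)) => z; exact: bE_ge0.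
  move=> h _; case: eqP => [_|/eqP h0]; first by rewrite mule0 integral_ge0// => M _; exact: bE_ge0.
  rewrite mule1 int_capY//; apply: contra h0 => /eqP/matrixP/(_ ord0 i0).
  by rewrite mul_projE iJ mxE => ->.
have sw := @fubini_tonelli _ _ _ _ R (mgauss p n) (mgauss 1 n) _ (mcapY c) (fun z => bE_ge0 _).
rewrite -[X in X <= _]sw.
apply: (@le_trans _ _ (\int[mgauss p n]_M (cst a M))); last first.
  by rewrite integral_cst// [X in _ * X]probability_setT mule1.
apply: ge0_le_integral => //.
- by move=> M _; apply: integral_ge0 => h _; exact: bE_ge0.
- by apply: (measurable_fun_fubini_tonelli_F _ (mcapY c)) => z; exact: bE_ge0.
move=> M _; have [y0|y0] := eqVneq (Y M) 0%R; last by rewrite /fubini_F /= int_cap.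
rewrite /fubini_F integral0_eq// => h _.
by rewrite /= y0 /capP /cap dot0l ltxx.
Qed.

Variable F : mxm R 1 n -> bool.
Hypothesis mF : measurable_fun setT F.
Let cn (k : nat) : R := (1 - k.+1%:R^-1)%R.

(* Put a cap around Y M and integrate over an independent Gaussian h: rotation invariance of
   both laws makes the probability that h falls in the cap around Y M, and that Y M falls in the
   cap around h, depend on the size of the cap only. When Y M is in F, small caps around it stay
   in F, so the mass of F under Y is at most its Gaussian mass. *)
Lemma direction_le :
  (forall y, y *m P = y -> F y -> y != 0 /\
    exists k, forall h, h *m P = h -> cap (cn k) y h -> F h)%R ->
  \int[mgauss p n]_M bE (F (Y M)) <= \int[mgauss 1 n]_h bE (F (h *m P)%R).
Proof.
move=> Fopen.
set g := (X in _ <= X).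
have mFP : measurable_fun setT (fun h : mxm R 1 n => F (h *m P)%R).
  exact: (measurableT_comp mF mproj).
pose out k M := \int[mgauss 1 n]_h bE (capP (cn k) (Y M) h && ~~ F (h *m P)%R).
have mout k : measurable_fun setT (out k).
  apply: (@measurable_fun_fubini_tonelli_F _ _ _ _ _ (mgauss 1 n)
    (fun z : mxm R p n * mxm R 1 n => bE (capP (cn k) (Y z.1) z.2 && ~~ F (z.2 *m P)%R))).
    apply: measurable_bE; apply: measurable_and.
      apply: measurable_cap; first exact: (measurableT_comp mY measurable_fst).
      exact: (measurableT_comp mproj measurable_snd).
    by apply: measurable_neg; exact: (measurableT_comp mFP measurable_snd).
  by move=> z; exact: bE_ge0.
(* Asking that the cap leave [F] on a null set only, and not that it be contained in [F], makes
   [A k] measurable. These sets increase to the event [F (Y M)] because [F] is open. *)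
pose A k : set (mxm R p n) := [set M | F (Y M)] `&` [set M | out k M = 0].
have mA k : measurable (A k).
  apply: measurableI.
    exact: measurable_boolP (measurableT_comp mF mY).
  by have := mout k measurableT [set 0] (emeasurable_set1 _); rewrite setTI.
have Ale k : mgauss p n (A k) <= g.
  have a0 : 0 < \int[mgauss 1 n]_h bE (capP (cn k) e0 h).
    by apply: cap_axis_gt0 => //; rewrite /cn ltrBlDr ltrDl invr_gt0.
  set a := (X in 0 < X) in a0.
  have afin : a \is a fin_num by exact: int_bE_fin.
  (* [a] is the Gaussian mass of a cap, the same for every axis in the span of [J]. On [A k] the cap
     around [Y M] has all this mass inside [F]; after an exchange of integrals, [cap_swap] returns
     the factor [a]. *)
  rewrite -(@lee_pmul2r _ a)//.
  have mAi : measurable_fun setT (fun M : mxm R p n => (\1_(A k) M)%:E : \bar R).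
    by apply/measurable_EFinP; exact: measurable_indic.
  have -> : mgauss p n (A k) * a = \int[mgauss p n]_M ((\1_(A k) M)%:E * a).
    rewrite ge0_integralZr//; last exact: ltW.
    by congr (_ * _); apply/esym; apply: (etrans (integral_indic _ measurableT (mA k))); rewrite setIT.
  have mcF : measurable_fun setT (fun z : mxm R p n * mxm R 1 n =>
      bE (capP (cn k) (Y z.1) z.2) * bE (F (z.2 *m P)%R)).
    apply: emeasurable_funM => //; apply: measurable_bE.
    exact: (measurableT_comp mFP measurable_snd).
  have cF0 z : 0 <= bE (capP (cn k) (Y z.1) z.2) * bE (F (z.2 *m P)%R).
    by rewrite mule_ge0// bE_ge0.
  apply: (@le_trans _ _ (\int[mgauss p n]_M \int[mgauss 1 n]_h
      (bE (capP (cn k) (Y M) h) * bE (F (h *m P)%R)))).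
    apply: ge0_le_integral => //.
    - by move=> M _; rewrite mule_ge0// ltW.
    - by apply: emeasurable_funM => //; exact: measurable_cst.
    - exact: (measurable_fun_fubini_tonelli_F _ mcF cF0).
    move=> M _; rewrite indicE; case: (boolP (M \in A k)) => [/set_mem[/= FM outM]|_]; last first.
      by rewrite mul0e; apply: integral_ge0 => h _; exact: (cF0 (M, h)).
    have [y0 _] := Fopen _ (YP M) FM.
    have mc := mcapP (cn k) (Y M).
    rewrite mul1e /a -(int_cap _ (YP M) y0).
    have -> : \int[mgauss 1 n]_h bE (capP (cn k) (Y M) h) =
      \int[mgauss 1 n]_h (bE (capP (cn k) (Y M) h && F (h *m P)%R) +
                          bE (capP (cn k) (Y M) h && ~~ F (h *m P)%R)).
      apply: eq_integral => h _; case: (capP _ _ _); case: (F _) => //=;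
      by rewrite /bE -EFinD ?addr0 ?add0r.
    rewrite ge0_integralD//.
    - rewrite [X in _ + X](_ : _ = 0)// adde0.
      by under eq_integral do rewrite bE_and.
    - by move=> h _; exact: bE_ge0.
    - by apply: measurable_bE; exact: measurable_and.
    - by move=> h _; exact: bE_ge0.
    - by apply: measurable_bE; apply: measurable_and => //; exact: measurable_neg.
  have sw := @fubini_tonelli _ _ _ _ R (mgauss p n) (mgauss 1 n) _ mcF cF0.
  rewrite [X in X <= _]sw.
  apply: (@le_trans _ _ (\int[mgauss 1 n]_h (bE (F (h *m P)%R) * a))).
    apply: ge0_le_integral => //.
    - by move=> h _; apply: integral_ge0 => M _; exact: cF0.
    - exact: (measurable_fun_fubini_tonelli_G _ mcF cF0).
    - by apply: emeasurable_funM; [exact: measurable_bE|exact: measurable_cst].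
    move=> h _; rewrite /fubini_G /= ge0_integralZr//.
    - by rewrite muleC lee_wpmul2l ?bE_ge0//; exact: le_trans (int_capY_le _ _) (cap_swap _).
    - by apply: measurable_bE; apply: measurable_cap => //; exact: measurable_cst.
    - by move=> M _; exact: bE_ge0.
    - exact: bE_ge0.
  rewrite ge0_integralZr//; first exact: measurable_bE.
    by move=> h _; exact: bE_ge0.
  exact: ltW.
have ndA : nondecreasing_seq A.
  apply/nondecreasing_seqP => k; apply/subsetPset => M [FM oM]; split=> //=.
  apply/eqP; rewrite eq_le; apply/andP; split; last by apply: integral_ge0 => h _; exact: bE_ge0.
  rewrite -oM; apply: ge0_le_integral => //.
  - by move=> h _; exact: bE_ge0.
  - by apply: measurable_bE; apply: measurable_and; [exact: mcapP|exact: measurable_neg].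
  - by apply: measurable_bE; apply: measurable_and; [exact: mcapP|exact: measurable_neg].
  move=> h _; apply: le_bE => /andP[ch ->]; rewrite andbT.
  apply: cap_le ch; rewrite /cn lerD2l lerN2 lef_pV2 ?posrE// ler_nat.
  by [].
have mUA : measurable (\bigcup_k A k) by exact: bigcupT_measurable.
have UA : \bigcup_k A k = [set M | F (Y M)].
  apply/seteqP; split=> [M [k _ []]//|M /= FM].
  have [y0 [k hk]] := Fopen _ (YP M) FM; exists k => //; split=> //=.
  rewrite /out integral0_eq// => h _; rewrite /capP.
  case: (boolP (cap _ _ _)) => //= ch; rewrite hk//.
  by rewrite -mulmxA proj_idem.
have leU : mgauss p n (\bigcup_k A k) <= g.
  have cvA : (mgauss p n \o A) @ \oo --> mgauss p n (\bigcup_k A k).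
    exact: nondecreasing_cvg_mu.
  have <- := cvg_lim (@ereal_hausdorff R) cvA.
  apply: lime_le; first by apply/cvg_ex; eexists; exact: cvA.
  by apply: nearW => k; exact: Ale.
by rewrite integral_bE; [rewrite -UA; exact: leU|exact: (measurableT_comp mF mY)].
Qed.

End RotationInvariantDirection.

(** * Measurability of matrix operations *)

Section MeasurableMatrixOps.
Context {R : realType}.

Lemma measurable_inv : measurable_fun setT (fun x : R => x^-1).
Proof.
have -> : [set: R] = [set x | x != 0] `|` [set 0].
  by apply/seteqP; split=> x //= _; case: (eqVneq x 0) => x0; [right|left].
have o : open [set x : R | x != 0] by exact: open_neq.
have m0 : measurable [set x : R | x != 0] by exact: open_measurable.
apply/measurable_funU => //; split.
  apply: open_continuous_measurable_fun => // x; rewrite inE /= => x0.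
  exact: inv_continuous.
exact: measurable_fun_set1.
Qed.

Variables (d : measure_display) (T : measurableType d).

Lemma measurable_mulmx p q r (X : T -> mxm R p q) (Y : T -> mxm R q r) :
  measurable_fun setT X -> measurable_fun setT Y ->
  measurable_fun setT (fun w => X w *m Y w : mxm R p r).
Proof.
move=> mX mY; apply: measurable_mxP => i j.
under [X in measurable_fun _ X]eq_fun do rewrite mxE.
apply: measurable_sum => k; apply: measurable_funM.
  exact: (measurableT_comp (@measurable_mxE R p q i k) mX).
exact: (measurableT_comp (@measurable_mxE R q r k j) mY).
Qed.

Lemma measurable_addmx p q (X Y : T -> mxm R p q) :
  measurable_fun setT X -> measurable_fun setT Y ->
  measurable_fun setT (fun w => (X w : 'M[R]_(p, q)) + Y w : mxm R p q).
Proof.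
move=> mX mY; apply: measurable_mxP => i j.
under [X in measurable_fun _ X]eq_fun do rewrite mxE.
apply: measurable_funD.
  exact: (measurableT_comp (@measurable_mxE R p q i j) mX).
exact: (measurableT_comp (@measurable_mxE R p q i j) mY).
Qed.

Lemma measurable_scalemx p q (c : R) (X : T -> mxm R p q) :
  measurable_fun setT X -> measurable_fun setT (fun w => c *: (X w : 'M[R]_(p, q)) : mxm R p q).
Proof.
move=> mX; apply: measurable_mxP => i j.
under [X in measurable_fun _ X]eq_fun do rewrite mxE.
by apply: measurable_funM => //; exact: (measurableT_comp (@measurable_mxE R p q i j) mX).
Qed.

Lemma measurable_usubmx m1 m2 n (X : T -> mxm R (m1 + m2) n) :
  measurable_fun setT X -> measurable_fun setT (fun w => usubmx (X w) : mxm R m1 n).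
Proof.
move=> mX; apply: measurable_mxP => i j.
under [X in measurable_fun _ X]eq_fun do rewrite mxE.
exact: (measurableT_comp (@measurable_mxE R _ n _ j) mX).
Qed.

Lemma measurable_dsubmx m1 m2 n (X : T -> mxm R (m1 + m2) n) :
  measurable_fun setT X -> measurable_fun setT (fun w => dsubmx (X w) : mxm R m2 n).
Proof.
move=> mX; apply: measurable_mxP => i j.
under [X in measurable_fun _ X]eq_fun do rewrite mxE.
exact: (measurableT_comp (@measurable_mxE R _ n _ j) mX).
Qed.

Lemma measurable_tr p q (X : T -> mxm R p q) :
  measurable_fun setT X -> measurable_fun setT (fun w => (X w)^T : mxm R q p).
Proof. by move=> mX; exact: (measurableT_comp (@measurable_trmx R p q) mX). Qed.

Lemma measurable_det n (X : T -> 'M[R]_n) :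
  (forall i j, measurable_fun setT (fun w => X w i j)) ->
  measurable_fun setT (fun w => \det (X w)).
Proof.
move=> mX; apply: measurable_sum => s; apply: measurable_funM => //.
by apply: measurable_prod => i _; exact: mX.
Qed.

Lemma measurable_invmx n (X : T -> mxm R n n) :
  measurable_fun setT X -> (forall w, X w \in unitmx) ->
  measurable_fun setT (fun w => invmx (X w) : mxm R n n).
Proof.
move=> mX uX.
have mE i j : measurable_fun setT (fun w => (X w : 'M[R]_n) i j).
  exact: (measurableT_comp (@measurable_mxE R n n i j) mX).
apply: measurable_mxP => i j.
rewrite (_ : (fun w => _) = (fun w => (\det (X w))^-1 * (\adj (X w)) i j)); last first.
  by apply/funext => w; rewrite /invmx uX mxE.
apply: measurable_funM; first exact: (measurableT_comp measurable_inv (measurable_det mE)).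
under [X in measurable_fun _ X]eq_fun do rewrite mxE.
apply: measurable_funM => //; apply: measurable_det => k l.
by under [X in measurable_fun _ X]eq_fun do rewrite !mxE; exact: mE.
Qed.

End MeasurableMatrixOps.

(** * The penalised minimiser on the span of one face *)

Section Face.
Context {R : realType}.

Lemma mul_projCE n (J : {set 'I_n}) p (M : 'M[R]_(p, n)) i j :
  (M *m (1%:M - proj J)) i j = if j \in J then 0 else M i j.
Proof.
rewrite mulmxBr mulmx1 mxE [X in _ + X]mxE mul_projE.
by case: ifP; rewrite ?subrr ?subr0.
Qed.

Local Notation mgauss := (@mgauss R).
Local Notation bE := (@bE R).
Variables (m n : nat) (J : {set 'I_n}).
Local Notation P := (proj J : 'M[R]_n).
Variable kappa : R.
Hypothesis kappa0 : 0 <= kappa.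

Definition ridge_mx (A : 'M[R]_(m, n)) : 'M[R]_n := 1%:M + kappa *: (A^T *m A).

Lemma ridge_unit A : ridge_mx A \in unitmx.
Proof.
rewrite -row_free_unit; apply: inj_row_free => v vA.
have : dot (v *m ridge_mx A) v = 0 by rewrite vA dot0l.
rewrite /ridge_mx mulmxDr mulmx1 -scalemxAr dotDl dotZl.
have -> : dot (v *m (A^T *m A)) v = dot (v *m A^T) (v *m A^T).
  by rewrite !dotE trmx_mul trmxK !mulmxA.
move=> h; apply/eqP; apply: contraT => /dot_gt0 v0.
have := mulr_ge0 kappa0 (dot_ge0 (v *m A^T)); lra.
Qed.

(* For [D = col_mx g A], the minimiser of [|x - g|^2 + kappa |A x|^2]. *)
Definition ridge (D : 'M[R]_(1 + m, n)) : 'rV[R]_n :=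
  usubmx D *m invmx (ridge_mx (dsubmx D)).

Lemma ridge_eq D x : x *m ridge_mx (dsubmx D) = usubmx D -> x = ridge D.
Proof. by move=> e; rewrite /ridge -e mulmxK// ridge_unit. Qed.

Lemma ridgeE D : ridge D *m ridge_mx (dsubmx D) = usubmx D.
Proof. by rewrite /ridge mulmxKV// ridge_unit. Qed.

Lemma ridge_proj D : D *m P = D -> ridge D *m P = ridge D.
Proof.
move=> DP; apply: ridge_eq.
have [gP AP] : usubmx D *m P = usubmx D /\ dsubmx D *m P = dsubmx D.
  by rewrite mul_usub_mx mul_dsub_mx DP.
have PS : P *m ridge_mx (dsubmx D) = ridge_mx (dsubmx D) *m P.
  rewrite /ridge_mx mulmxDr mulmxDl mulmx1 mul1mx -scalemxAr -scalemxAl; congr (_ + _ *: _).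
  have PT : P^T = P by rewrite tr_diag_mx.
  by rewrite -(mulmxA _ _ P) AP mulmxA -{1}PT -trmx_mul AP.
by rewrite -mulmxA PS mulmxA ridgeE.
Qed.

(** The objective is built from norms, so an orthogonal change of coordinates moves its minimiser
    along. This is the equivariance required by [direction_le]. *)
Lemma ridge_rot D Q : Q *m Q^T = 1%:M -> ridge (D *m Q) = ridge D *m Q.
Proof.
move=> QQ; apply/esym/ridge_eq; rewrite -mul_usub_mx -mul_dsub_mx -ridgeE.
rewrite /ridge_mx !mulmxDr mulmxDl !mulmx1 -!scalemxAr -scalemxAl; congr (_ + _ *: _).
by rewrite trmx_mul !mulmxA -(mulmxA _ Q) QQ mulmx1.
Qed.

Lemma measurable_ridge : measurable_fun setT (fun D : mxm R (1 + m) n => ridge D : mxm R 1 n).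
Proof.
have mi : measurable_fun setT (fun D : mxm R (1 + m) n => D) by exact: measurable_id.
apply: measurable_mulmx; first exact: measurable_usubmx.
apply: measurable_invmx; last by move=> D; exact: ridge_unit.
have mc := @measurable_cst _ _ (mxm R (1 + m) n) (mxm R n n) setT 1%:M.
apply: measurable_addmx => //; apply: measurable_scalemx; apply: measurable_mulmx.
  by apply: measurable_tr; exact: measurable_dsubmx.
exact: measurable_dsubmx.
Qed.

Variable i0 : 'I_n.
Hypothesis iJ : i0 \in J.
Variables F H : mxm R 1 n -> bool.
Hypotheses (mF : measurable_fun setT F) (mH : measurable_fun setT H).
Hypothesis Fopen : forall y, y *m P = y -> F y -> y != 0 /\
    exists k : nat, forall h, h *m P = h -> cap (1 - k.+1%:R^-1) y h -> F h.
Hypothesis HP : forall x, H (x *m (1%:M - P)) = H x.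
Hypothesis HZ : forall c x, 0 < c -> H (c *: (x : 'rV[R]_n)) = H x.

Local Notation Y D := (ridge (D *m P)).

Lemma measurable_ridge_proj : measurable_fun setT (fun D : mxm R (1 + m) n => Y D : mxm R 1 n).
Proof.
apply: (measurableT_comp measurable_ridge).
exact: (measurable_mulmxr _ (@measurable_id _ _ setT)).
Qed.

(** The optimality conditions of the penalised problem over a cone, in coordinates where the span of
    the face is that of [J]: the minimiser over the span falls in the relative interior [F], and the
    residual falls in the normal cone [H]. *)
Definition face_event (D : 'M[R]_(1 + m, n)) : bool :=
  F (Y D) && H (usubmx D - kappa *: (Y D *m (dsubmx D)^T *m dsubmx D)).

Lemma measurable_face_event : measurable_fun setT (face_event : mxm R (1 + m) n -> bool).
Proof.
have mi : measurable_fun setT (fun D : mxm R (1 + m) n => D) by exact: measurable_id.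
apply: measurable_and; first exact: (measurableT_comp mF measurable_ridge_proj).
apply: (measurableT_comp mH).
rewrite (_ : (fun D : mxm R (1 + m) n => _) =
  (fun D : mxm R (1 + m) n => usubmx D + (- kappa) *: (Y D *m (dsubmx D)^T *m dsubmx D))); last first.
  by apply/funext => D; rewrite scaleNr.
apply: measurable_addmx; first exact: measurable_usubmx.
apply: measurable_scalemx; apply: measurable_mulmx; last exact: measurable_dsubmx.
apply: measurable_mulmx; first exact: measurable_ridge_proj.
by apply: measurable_tr; exact: measurable_dsubmx.
Qed.

(* Given the columns in J, the remaining coordinates of the residual form a scaled
   standard Gaussian vector, so the cone H is hit with its own Gaussian probability. *)
Lemma face_event_le :
  (\int[mgauss (1 + m) n]_D bE (face_event D) <=
   (\int[mgauss 1 n]_h bE (F (h *m P))) * \int[mgauss 1 n]_h bE (H h))%E.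
Proof.
have PP := @proj_idem R n J.
have mev := @measurable_bE R _ _ _ measurable_face_event.
rewrite (mgauss_mix (fun=> (fun j => j \in J)) mev); last by move=> ?; exact: bE_ge0.
(* Outside [J] the residual is [om A *m B]: a combination of the rows of the fresh copy [B] with
   coefficients fixed by the columns in [J]. The first coefficient is 1, so [om A] never vanishes
   and [mgauss_comb] applies. *)
pose om (A : 'M[R]_(1 + m, n)) : 'rV[R]_(1 + m) :=
  row_mx 1%:M (- (kappa *: (Y A *m (dsubmx A *m P)^T))).
have key (A B : mxm R (1 + m) n) : face_event (mix (fun=> (fun j => j \in J)) A B) = F (Y A) && H (om A *m B).
  set D : 'M[R]_(1 + m, n) := mix _ A B.
  have DP : D *m P = (A : 'M[R]_(1 + m, n)) *m P.
    by apply/matrixP => i j; rewrite !mul_projE; case: ifP => // jJ; rewrite /D /mix mxE jJ.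
  have DQ : D *m (1%:M - P) = (B : 'M[R]_(1 + m, n)) *m (1%:M - P).
    by apply/matrixP => i j; rewrite !mul_projCE; case: ifP => // jJ; rewrite /D /mix mxE jJ.
  rewrite /face_event DP; congr (_ && _).
  rewrite -HP -[RHS]HP; congr H.
  have -> : Y A *m (dsubmx D)^T = Y A *m (dsubmx A *m P)^T.
    have PT : P^T = P by rewrite tr_diag_mx.
    have e : P *m (dsubmx D)^T = (dsubmx A *m P)^T.
      by rewrite -[X in X *m _]PT -trmx_mul mul_dsub_mx DP -mul_dsub_mx.
    by rewrite -[in LHS](ridge_proj (D := A *m P)) -?mulmxA ?PP// e.
  transitivity (om A *m (D *m (1%:M - P))); last by rewrite DQ mulmxA.
  rewrite mulmxA /om -[X in _ = row_mx _ _ *m X *m _](vsubmxK D) mul_row_col mul1mx; congr (_ *m _).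
  by rewrite mulNmx -scalemxAl.
have om0 A : om A != 0.
  apply/eqP => /matrixP/(_ 0 (lshift m 0)); rewrite /om row_mxEl !mxE eqxx /=.
  by move/eqP; rewrite oner_eq0.
have mHb := @measurable_bE R _ _ _ mH.
under eq_integral => A _.
  under eq_integral => B _ do rewrite key bE_and.
  rewrite ge0_integralZl//; last 3 first.
  - apply: (measurableT_comp mHb); apply: measurable_mulmx; last exact: measurable_id.
    exact: measurable_cst.
  - by move=> B _; exact: bE_ge0.
  - exact: bE_ge0.
  rewrite (mgauss_comb (f := fun x => bE (H x)) (om0 A) mHb); first over.
    by move=> ?; exact: bE_ge0.
  by move=> c M c0; rewrite HZ.
rewrite /= ge0_integralZr//; last 3 first.
- by apply: measurable_bE; exact: (measurableT_comp mF measurable_ridge_proj).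
- by move=> D _; exact: bE_ge0.
- by apply: integral_ge0 => ? _; exact: bE_ge0.
rewrite lee_wpmul2r//; first by apply: integral_ge0 => ? _; exact: bE_ge0.
apply: (direction_le iJ) => //.
- exact: measurable_ridge_proj.
- by move=> M; rewrite ridge_proj// -mulmxA PP.
by move=> Q M QQ QP; rewrite -mulmxA QP mulmxA ridge_rot.
Qed.

End Face.

(** * Almost sure injectivity on small coordinate subspaces *)

Section Injectivity.
Context {R : realType}.
Local Notation gam := (normal_prob (0 : R) 1).
Local Notation mgauss := (@mgauss R).
Local Notation bE := (@bE R).
Variables (m n : nat).

(** The Gram matrix of the columns in [J], completed by the identity outside [J]: a vanishing
    determinant, which is a measurable condition, produces a kernel vector of [A] supported in
    [J]. *)
Definition gram (J : {set 'I_n}) (A : 'M[R]_(m, n)) : 'M[R]_n :=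
  (1%:M - proj J) + (A *m proj J)^T *m (A *m proj J).

Lemma tr_proj (J : {set 'I_n}) : (proj J)^T = proj J :> 'M[R]_n.
Proof. by rewrite tr_diag_mx. Qed.

Lemma gram_kernel J A (v : 'rV[R]_n) : v *m gram J A = 0 ->
  v *m proj J = v /\ v *m A^T = 0.
Proof.
move=> vG; have PP := @proj_idem R n J.
have vQ : v *m (1%:M - proj J) = 0.
  transitivity (v *m gram J A *m (1%:M - proj J)); last by rewrite vG mul0mx.
  rewrite -mulmxA /gram mulmxDl -!mulmxA; congr (_ *m _).
  have -> : proj J *m (1%:M - proj J) = 0 :> 'M[R]_n by rewrite mulmxBr mulmx1 PP subrr.
  have QQ : (1%:M - proj J) *m (1%:M - proj J) = 1%:M - proj J :> 'M[R]_n.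
    by rewrite mulmxBr mulmx1 mulmxBl mul1mx PP subrr subr0.
  by rewrite QQ !mulmx0 addr0.
have vP : v *m proj J = v.
  by apply/eqP; rewrite eq_sym -subr_eq0 -{1}(mulmx1 v) -mulmxBr vQ.
split=> //; have : dot (v *m A^T) (v *m A^T) = 0.
  have := congr1 (fun x => dot x v) vG; rewrite dot0l mulmxDr vQ add0r => <-.
  rewrite !dotE !trmx_mul trmxK tr_proj !mulmxA vP.
  by rewrite -[in RHS](mulmxA _ (proj J)) -[X in _ *m (X *m _)]tr_proj -trmx_mul vP.
by move=> h; apply/eqP; apply: contraT => /dot_gt0; rewrite h ltxx.
Qed.

Lemma gramP J A : \det (gram J A) = 0 -> exists v : 'rV[R]_n,
  [/\ v != 0, v *m proj J = v & v *m A^T = 0].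
Proof.
move=> d0; have : ~~ row_free (gram J A) by rewrite row_free_unit unitmxE d0 unitr0.
rewrite -kermx_eq0 => /rowV0Pn[v /sub_kermxP /gram_kernel[h1 h2] v0].
by exists v.
Qed.

Lemma rank_proj (J : {set 'I_n}) : (\rank (proj J : 'M[R]_n) <= #|J|)%N.
Proof.
move: {2}#|J| (erefl #|J|) => k; elim: k J => [|k IH] J kJ.
  rewrite kJ; have -> : J = finset.set0 by apply/eqP; rewrite -cards_eq0 kJ.
  rewrite (_ : proj _ = 0) ?mxrank0//.
  by apply/matrixP => i j; rewrite !mxE inE mul0rn.
have /card_gt0P[j jJ] : (0 < #|J|)%N by rewrite kJ.
have e : proj J = delta_mx j j + proj (J :\ j) :> 'M[R]_n.
  apply/matrixP => a b; rewrite !mxE !inE.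
  case: (eqVneq a b) => [<-|ab]; last first.
    by rewrite !mulr0n addr0; case: (eqVneq a j) => //= aj; case: (eqVneq b j) => // bj; move: ab; rewrite aj bj eqxx.
  by rewrite !mulr1n; case: (eqVneq a j) => [->|_] /=; rewrite ?jJ ?addr0 ?add0r.
have kJ' : #|J :\ j| = k by move: kJ; rewrite (cardsD1 j J) jJ add1n => -[].
rewrite e kJ -add1n; apply: leq_trans (mxrank_add _ _) _.
by rewrite mxrank_delta leq_add2l -[X in (_ <= X)%N]kJ'; exact: IH.
Qed.

Lemma measurable_gram J : measurable_fun setT (fun A : mxm R m n => \det (gram J A)).
Proof.
have mi : measurable_fun setT (fun A : mxm R m n => A) by exact: measurable_id.
have mAP : measurable_fun setT (fun A : mxm R m n => A *m proj J : mxm R m n).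
  exact: measurable_mulmxr.
have mc := @measurable_cst _ _ (mxm R m n) (mxm R n n) setT (1%:M - proj J).
have mG : measurable_fun setT (fun A : mxm R m n => gram J A : mxm R n n).
  apply: measurable_addmx => //; apply: measurable_mulmx => //.
  exact: measurable_tr.
apply: measurable_det => i j.
exact: (measurableT_comp (@measurable_mxE R n n i j) mG).
Qed.

(* Adding one column: it would have to be orthogonal to a fixed nonzero vector. *)
Lemma gram_ae (J : {set 'I_n}) : (#|J| <= m)%N ->
  (\int[mgauss m n]_A bE (\det (gram J A) == 0)%R = 0)%E.
Proof.
have mb' J' : measurable_fun setT (fun A : mxm R m n => \det (gram J' A) == 0).
  by apply: measurable_fun_eqr; [exact: measurable_gram|exact: measurable_cst].
have mb J' := @measurable_bE R _ _ _ (mb' J').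
move: {2}#|J| (erefl #|J|) => k; elim: k J => [|k IH] J kJ Jm.
  have -> : J = finset.set0 by apply/eqP; rewrite -cards_eq0 kJ.
  rewrite integral0_eq// => A _.
  have -> : gram finset.set0 A = 1%:M.
    rewrite /gram; have -> : proj finset.set0 = 0 :> 'M[R]_n.
      by apply/matrixP => i j; rewrite !mxE inE mul0rn.
    by rewrite mulmx0 subr0 mulmx0 addr0.
  by rewrite det1 oner_eq0.
have /card_gt0P[j jJ] : (0 < #|J|)%N by rewrite kJ.
have kJ' : #|J :\ j| = k by move: kJ; rewrite (cardsD1 j J) jJ add1n => -[].
have km : (k < m)%N by rewrite -kJ.
have {}IH := IH (J :\ j) kJ' _; rewrite kJ' in IH; have {}IH := IH (ltnW km).
rewrite (mgauss_mix (fun=> (fun l => l != j)) (mb J)); last by move=> ?; exact: bE_ge0.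
apply/eqP; rewrite eq_le; apply/andP; split; last first.
  by apply: integral_ge0 => A _; apply: integral_ge0 => B _; exact: bE_ge0.
rewrite -[X in (_ <= X)%E]IH; apply: ge0_le_integral => //.
- by move=> A _; apply: integral_ge0 => B _; exact: bE_ge0.
- apply: (@measurable_fun_fubini_tonelli_F _ _ _ _ _ (mgauss m n)
    (fun z : mxm R m n * mxm R m n => bE (\det (gram J (mix (fun=> (fun l => l != j)) z.1 z.2)) == 0))).
    apply: (measurableT_comp (mb J)); exact: measurable_mix.
  by move=> z; exact: bE_ge0.
move=> A _; have [dA|dA] /= := eqVneq (\det (gram (J :\ j) A)) 0.
  apply: int_bE_le1.
  apply: (measurableT_comp (mb' J)).
  by apply: measurable_mix; [exact: measurable_cst|exact: measurable_id].
(* The k < m columns other than [j] are annihilated by some [nu != 0]. A kernel vector for [J] has a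
   nonzero coordinate [j], as the smaller system is regular, so [nu] must annihilate the fresh
   column [j] as well. *)
have : (kermx (A *m proj (J :\ j)) != 0).
  rewrite kermx_eq0 /row_free neq_ltn; apply/orP; left.
  apply: leq_ltn_trans (mxrankM_maxr _ _) _; apply: leq_ltn_trans (rank_proj _) _.
  by rewrite kJ'.
move=> /rowV0Pn[nu /sub_kermxP nuA nu0].
have mz : measurable_fun setT (fun M : mxm R 1 n => bE (M ord0 j == 0)).
  by apply: measurable_bE; apply: measurable_fun_eqr; [exact: measurable_mxE|exact: measurable_cst].
have mz1 : measurable_fun setT (fun x : R => bE (x == 0)).
  by apply: measurable_bE; apply: measurable_fun_eqr; [exact: measurable_id|exact: measurable_cst].
apply: (@le_trans _ _ (\int[mgauss m n]_B bE ((nu *m B) ord0 j == 0)%R)%E).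
  apply: ge0_le_integral => //.
  - by move=> B _; exact: bE_ge0.
  - apply: (measurableT_comp (mb J)).
    by apply: measurable_mix; [exact: measurable_cst|exact: measurable_id].
  - apply: (measurableT_comp mz); apply: measurable_mulmx; [exact: measurable_cst|exact: measurable_id].
  move=> B _; apply: le_bE => /eqP /gramP[v [v0 vP vA]].
  set D : 'M[R]_(m, n) := mix _ A B in vA.
  have Dj l : l \in J :\ j -> (nu *m D) 0 l = 0.
    move=> lJ; have := congr1 (fun M : 'rV[R]_n => M 0 l) nuA.
    rewrite mulmxA mul_projE lJ !mxE => e; rewrite -[RHS]e; apply: eq_bigr => i _.
    by rewrite /D /mix mxE; move: lJ; rewrite !inE => /andP[-> _].
  have nuvE : dot (nu *m D) v = (nu *m B) 0 j * v 0 j.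
    rewrite /dot (bigD1 j)//= big1 ?addr0; last first.
      move=> l lj; case lJ : (l \in J); first by rewrite Dj ?mul0r// !inE lj.
      by rewrite -vP mul_projE lJ mulr0.
    congr (_ * _); rewrite !mxE; apply: eq_bigr => i _.
    by rewrite /D /mix mxE eqxx.
  have : dot (nu *m D) v = 0.
    by rewrite dotE -mulmxA -[D]trmxK -trmx_mul vA trmx0 mulmx0 mxE.
  rewrite nuvE => /eqP; rewrite mulf_eq0 => /orP[//|/eqP vj0].
  have : v *m gram (J :\ j) A = 0.
    have vP' : v *m proj (J :\ j) = v.
      apply/matrixP => a l; rewrite mul_projE !inE; case: (eqVneq l j) => [->|lj] /=.
        by rewrite ord1 vj0.
      by rewrite -[in RHS]vP mul_projE.
    have vA' : v *m A^T = 0.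
      rewrite -vA; apply/matrixP => a l; rewrite !mxE; apply: eq_bigr => i _.
      rewrite !mxE; case: (eqVneq i j) => [->|ij] //=.
      by rewrite ord1 vj0 !mul0r.
    rewrite /gram mulmxDr mulmxBr mulmx1 vP' subrr add0r trmx_mul tr_proj !mulmxA vP'.
    by rewrite vA' !mul0mx.
  move=> /(congr1 (fun x => x *m invmx (gram (J :\ j) A))).
  by rewrite mulmxK ?unitmxE ?unitfE// mul0mx => v00; rewrite v00 eqxx in v0.
rewrite (mgauss_comb (f := fun M => bE (M ord0 j == 0)) nu0 mz); last 2 first.
- by move=> ?; exact: bE_ge0.
- by move=> c M c0; rewrite mxE mulf_eq0 gt_eqF.
have -> : (\int[mgauss 1 n]_M bE (M ord0 j == 0)%R = 0)%E; last exact: bE_ge0.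
apply: (etrans (mgauss_coord j mz1 (fun x => bE_ge0 _))).
apply: (etrans (integral_bE gam _)).
  by apply: measurable_fun_eqr; [exact: measurable_id|exact: measurable_cst].
rewrite (_ : [set w : R | w == 0] = [set 0]); first exact: gam_set1.
by apply/seteqP; split=> x /= /eqP.
Qed.

End Injectivity.

(** * Exponential moments of squared normal variables *)

Section GaussianMoments.
Context {R : realType}.
Local Notation mu := (@lebesgue_measure R).
Local Notation gam := (normal_prob (0 : R) 1).
Local Open Scope ereal_scope.

Lemma int_gam_cst (c : R) : \int[gam]_x c%:E = c%:E.
Proof. by rewrite integral_cst// [X in _ * X]probability_setT mule1. Qed.

Lemma measurable_gamE (f : R -> \bar R) : measurable_fun setT f ->
  measurable_fun setT (fun x => f x * (phi x)%:E).
Proof.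
by move=> mf; apply: emeasurable_funM => //; apply/measurable_EFinP; exact: measurable_phi.
Qed.

Lemma mfE (f : R -> R) : measurable_fun setT f -> measurable_fun setT (fun x => (f x)%:E : \bar R).
Proof. by move=> mf; apply/measurable_EFinP. Qed.

Lemma int_gamZ (c : R) (g : R -> \bar R) : (0 <= c)%R -> measurable_fun setT g ->
  (forall x, 0 <= g x) -> \int[gam]_x (c%:E * g x) = c%:E * \int[gam]_x g x.
Proof. by move=> c0 mg g0; exact: (ge0_integralZl gam measurableT mg (fun x _ => g0 x)). Qed.

Lemma int_gam1D (g : R -> \bar R) : measurable_fun setT g ->
  (forall x, 0 <= g x) -> \int[gam]_x (1 + g x) = 1 + \int[gam]_x g x.
Proof.
move=> mg g0; have p (x : R) : [set: R] x -> 0 <= cst (1 : \bar R) x by move=> _; rewrite lee_fin ler01.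
have e := ge0_integralD gam measurableT p (@measurable_cst _ _ _ _ _ _) (fun x _ => g0 x) mg.
exact: (etrans e (congr1 (fun u => u + _) (int_gam_cst 1))).
Qed.

Lemma le_int_gam (f g : R -> \bar R) : measurable_fun setT f -> measurable_fun setT g ->
  (forall x, 0 <= f x) -> (forall x, f x <= g x) -> \int[gam]_x f x <= \int[gam]_x g x.
Proof. by move=> mf mg f0 fg; apply: ge0_le_integral. Qed.

Lemma gam_mgf (a : R) : \int[gam]_x (expR (a * x))%:E = (expR (a ^+ 2 / 2))%:E.
Proof.
have mf : measurable_fun setT (fun x : R => (expR (a * x))%:E : \bar R).
  apply: mfE; apply: measurableT_comp => //; exact: measurable_funM.
have e1 := integral_gam mf (fun x => expR_ge0 _ : 0 <= _%:E).
have mp : measurable_fun setT (fun x => (phi x)%:E : \bar R) by apply: mfE; exact: measurable_phi.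
have p0 (x : R) : 0 <= (phi x)%:E by rewrite lee_fin phi_ge0.
apply: (etrans e1).
transitivity (\int[mu]_x ((expR (a ^+ 2 / 2))%:E * (phi (x + - a))%:E)).
  apply: eq_integral => x _; rewrite -!EFinM /phi; congr EFin.
  rewrite mulrCA -expRD [RHS]mulrCA -expRD; by congr (_ * expR _)%R; field.
have mps : measurable_fun setT (fun x : R => (phi (x + - a))%:E : \bar R).
  apply: mfE; apply: (measurableT_comp measurable_phi); exact: measurable_funD.
have E0 : 0 <= (expR (a ^+ 2 / 2))%:E :> \bar R by rewrite lee_fin expR_ge0.
rewrite ge0_integralZl//.
rewrite [X in _ * X](_ : _ = 1) ?mule1//.
have -> := integral_lebesgue_shift (- a) mp p0.
under eq_integral do rewrite -normal_pdf01.
exact: integral_normal_pdf.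
Qed.

Section Scale.
Variables (s : R).
Hypothesis s0 : (0 < s)%R.
Let z := Num.sqrt (1 + s).
Let eta := (s / (2 * (1 + s)))%R.

Let s1 : (0 < 1 + s)%R. Proof. by rewrite addr_gt0. Qed.
Let z0 : (0 < z)%R. Proof. by rewrite sqrtr_gt0. Qed.
Let z2 : (z ^+ 2 = 1 + s)%R. Proof. by rewrite sqr_sqrtr// ltW. Qed.
Let etaz : (eta * z ^+ 2 = s / 2)%R.
Proof. by rewrite z2 /eta; field; rewrite gt_eqF. Qed.

(** As 1/2 - eta = 1/(2 z^2), the factor exp(eta x^2) turns [phi x] into [phi (x / z)]; substituting
    z x for x brings out the factor [z]. *)
Lemma gam_tilt (f : R -> \bar R) : measurable_fun setT f -> (forall x, 0 <= f x) ->
  \int[gam]_x (f x * (expR (eta * x ^+ 2))%:E) = z%:E * \int[gam]_x f (z * x)%R.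
Proof.
move=> mf f0.
have me : measurable_fun setT (fun x : R => (expR (eta * x ^+ 2))%:E : \bar R).
  apply: mfE; apply: measurableT_comp => //; apply: measurable_funM => //; exact: measurable_funX.
have mfe := emeasurable_funM mf me.
have fe0 x : 0 <= f x * (expR (eta * x ^+ 2))%:E by rewrite mule_ge0// lee_fin expR_ge0.
have mz : measurable_fun setT (fun x : R => (z * x)%R) by exact: measurable_funM.
have e1 := integral_gam mfe fe0.
have mg := measurable_gamE mfe.
have g0 x : 0 <= f x * (expR (eta * x ^+ 2))%:E * (phi x)%:E by rewrite mule_ge0// lee_fin phi_ge0.
have e2 := integral_lebesgue_scale z0 mg g0.
have e3 := integral_gam (measurableT_comp mf mz) (fun x => f0 _).
apply: (etrans e1); apply: (etrans (esym e2)); congr (_ * _); apply: (etrans _ (esym e3)).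
apply: eq_integral => x _ /=; rewrite -muleA -EFinM; congr (_ * _%:E).
rewrite /phi mulrCA -expRD; congr (_ * expR _)%R.
by rewrite !exprMn mulrA etaz z2; field.
Qed.

Lemma gam_exp_sqr (tau : R) :
  \int[gam]_x (expR (eta * (x - tau) ^+ 2))%:E = (z * expR (s * tau ^+ 2 / 2))%:E.
Proof.
pose f (x : R) : \bar R := (expR (eta * tau ^+ 2))%:E * (expR ((- 2 * eta * tau) * x))%:E.
have mx c : measurable_fun setT (fun x : R => (expR (c * x))%:E : \bar R).
  by apply: mfE; apply: measurableT_comp => //; exact: measurable_funM.
have mf : measurable_fun setT f by apply: emeasurable_funM => //; exact: measurable_cst.
have f0 x : 0 <= f x by rewrite mule_ge0// lee_fin expR_ge0.
transitivity (\int[gam]_x (f x * (expR (eta * x ^+ 2))%:E)).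
  apply: eq_integral => x _; rewrite /f -!EFinM -!expRD; congr (expR _)%:E; ring.
have e : \int[gam]_x f (z * x)%R =
    (expR (eta * tau ^+ 2))%:E * (expR ((- 2 * eta * tau * z) ^+ 2 / 2))%:E.
  transitivity (\int[gam]_x ((expR (eta * tau ^+ 2))%:E * (expR ((- 2 * eta * tau * z) * x))%:E)).
    by apply: eq_integral => x _; rewrite /f [(- 2 * eta * tau * (z * x))%R]mulrA.
  have E0 (a : R) : 0 <= (expR a)%:E by rewrite lee_fin expR_ge0.
  apply: (etrans (ge0_integralZl gam measurableT (mx _) (fun x _ => E0 _) (E0 _))).
  exact: (congr1 (fun u => _ * u) (gam_mgf _)).
apply: (etrans (gam_tilt mf f0)); rewrite e -!EFinM; congr (_ * _)%:E; rewrite -expRD; congr expR.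
transitivity (eta * tau ^+ 2 + 2 * eta * tau ^+ 2 * (eta * z ^+ 2))%R; first by field.
by rewrite etaz /eta; field; rewrite gt_eqF.
Qed.

Lemma gam_exp0 : \int[gam]_x (expR (eta * x ^+ 2))%:E = z%:E.
Proof.
transitivity (\int[gam]_x (expR (eta * (x - 0) ^+ 2))%:E).
  by apply: eq_integral => x _; rewrite subr0.
by rewrite gam_exp_sqr expr0n mulr0 mul0r expR0 mulr1.
Qed.

End Scale.

Definition m2 : \bar R := \int[gam]_x (x ^+ 2)%:E.

Lemma msqr (tau : R) : measurable_fun setT (fun x : R => ((x - tau) ^+ 2)%:E : \bar R).
Proof. by apply: mfE; apply: measurable_funX; exact: measurable_funB. Qed.

(** Both bounds start from the exact value [z] of the mean of exp(eta x^2). They use 1 + u <= exp u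
    and exp u <= 1 + u exp u; the last term is computed by [gam_tilt], which contributes z^3. *)
Lemma m2_bounds (s : R) : (0 < s)%R -> let z := Num.sqrt (1 + s) in
  let eta := (s / (2 * (1 + s)))%R in
  (1 + eta%:E * m2 <= z%:E) /\ (z%:E <= 1 + (eta * z ^+ 3)%:E * m2).
Proof.
move=> s0 z eta.
have s1 : (0 < 1 + s)%R by rewrite addr_gt0.
have eta0 : (0 < eta)%R by rewrite divr_gt0// mulr_gt0.
have z0 : (0 < z)%R by rewrite sqrtr_gt0.
have mx2 : measurable_fun setT (fun x : R => (x ^+ 2)%:E : \bar R).
  by apply: mfE; exact: measurable_funX.
have x20 (x : R) : 0 <= (x ^+ 2)%:E by rewrite lee_fin sqr_ge0.
have me : measurable_fun setT (fun x : R => (expR (eta * x ^+ 2))%:E : \bar R).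
  apply: mfE; apply: measurableT_comp => //; apply: measurable_funM => //; exact: measurable_funX.
have mex2 c : measurable_fun setT (fun x : R => c%:E * (x ^+ 2)%:E).
  by apply: emeasurable_funM => //; exact: measurable_cst.
have ex0 c x : (0 <= c)%R -> 0 <= c%:E * (x ^+ 2)%:E :> \bar R by move=> c0; rewrite mule_ge0.
have e0 := gam_exp0 s0.
have etaW := ltW eta0.
split.
  have h1 := int_gamZ etaW mx2 x20.
  have h2 := int_gam1D (mex2 eta) (fun x => ex0 eta x etaW).
  rewrite -h1 -h2 -[X in _ <= X]e0; apply: le_int_gam => //.
  - by apply: emeasurable_funD => //; exact: measurable_cst.
  - by move=> x; rewrite adde_ge0// ?ex0// lee_fin ler01.
  by move=> x; rewrite -EFinM -EFinD lee_fin; exact: expR_ge1Dx.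
pose g (x : R) : \bar R := (x ^+ 2)%:E * (expR (eta * x ^+ 2))%:E.
have mg : measurable_fun setT g by exact: emeasurable_funM.
have g0 x : 0 <= g x by rewrite mule_ge0// lee_fin expR_ge0.
have h1 : (eta * z ^+ 3)%:E * m2 = \int[gam]_x (eta%:E * g x).
  rewrite (int_gamZ etaW mg g0) EFinM -muleA; congr (_ * _).
  apply/esym/(etrans (gam_tilt s0 mx2 x20)).
  rewrite exprS EFinM -muleA; congr (_ * _).
  apply: (etrans _ (int_gamZ (sqr_ge0 z) mx2 x20)).
  by apply: eq_integral => x _; rewrite exprMn EFinM.
have mm : measurable_fun setT (fun x : R => eta%:E * g x).
  by apply: emeasurable_funM => //; exact: measurable_cst.
have etaE0 : 0 <= eta%:E by rewrite lee_fin.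
have h2 := int_gam1D mm (fun x => mule_ge0 etaE0 (g0 x)).
rewrite h1 -h2.
rewrite -[X in X <= _]e0; apply: le_int_gam => //.
- by apply: emeasurable_funD => //; exact: measurable_cst.
move=> x; rewrite /g -!EFinM -EFinD lee_fin mulrA.
have := expR_ge1Dx (- (eta * x ^+ 2)); rewrite expRN => h.
have E0 := expR_gt0 (eta * x ^+ 2).
have := ler_wpM2r (ltW E0) h; rewrite mulVf ?gt_eqF//; lra.
Qed.

(** The value of [s] is taken such that [z = 1 + dl], which makes the two bounds of [m2_bounds]
    rational in [dl]; both tend to 1 with [dl]. A gap to 1 is refuted by a [dl] of at most an eighth
    of it. *)
Lemma m2E : m2 = 1.
Proof.
have m20 : 0 <= m2 by apply: integral_ge0 => x _; rewrite lee_fin sqr_ge0.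
have key (dl : R) : (0 < dl)%R ->
    (m2 <= (2 * (1 + dl) ^+ 2 / (2 + dl))%:E) /\ ((2 / ((1 + dl) * (2 + dl)))%:E <= m2).
  move=> d0; pose s := ((1 + dl) ^+ 2 - 1)%R.
  have s0 : (0 < s)%R by rewrite /s; nra.
  have zE : Num.sqrt (1 + s) = (1 + dl)%R.
    by rewrite /s addrC subrK sqrtr_sqr ger0_norm// addr_ge0// ltW.
  have [] := m2_bounds s0; rewrite zE.
  set eta := (s / _)%R.
  have sE : (1 + s = (1 + dl) ^+ 2)%R by rewrite /s addrC subrK.
  have eta0 : (0 < eta)%R by rewrite divr_gt0// mulr_gt0// sE exprn_gt0// addr_gt0.
  have etaE : (eta * (2 * (1 + dl) ^+ 2) = dl * (2 + dl))%R.
    rewrite /eta sE divfK; first by rewrite /s; ring.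
    by rewrite mulf_neq0// expf_neq0// gt_eqF// addr_gt0.
  case: m2 m20 => [v| |]// v0 h1 h2; last first.
    by move: h1; rewrite gt0_muley ?lte_fin.
  move: v0 h1 h2; rewrite -!EFinM -!EFinD !lee_fin => v0 h1 h2.
  have dd : (0 < 2 + dl)%R by rewrite addr_gt0.
  have d1 : (0 < 1 + dl)%R by rewrite addr_gt0.
  split.
    rewrite ler_pdivlMr//.
    rewrite -(ler_pM2l d0) (_ : dl * (v * (2 + dl)) = eta * v * (2 * (1 + dl) ^+ 2))%R; last first.
      by rewrite mulrAC etaE; ring.
    rewrite (_ : (dl * (2 * (1 + dl) ^+ 2) = dl * (2 * (1 + dl) ^+ 2))%R)//.
    by rewrite ler_pM2r; [lra|rewrite mulr_gt0// exprn_gt0].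
  rewrite ler_pdivrMr ?mulr_gt0//.
  rewrite -(ler_pM2l d0) (_ : dl * (v * ((1 + dl) * (2 + dl))) = eta * (1 + dl) ^+ 3 * v * 2)%R; last first.
    transitivity ((dl * (2 + dl)) * (1 + dl) * v)%R; first by ring.
    by rewrite -etaE; ring.
  lra.
case: m2 m20 key => [v| |]// v0 key; last by have [] := key 1%R ltr01.
have {}key dl : (0 < dl)%R -> (v <= 2 * (1 + dl) ^+ 2 / (2 + dl))%R /\ (2 / ((1 + dl) * (2 + dl)) <= v)%R.
  by move=> /key; rewrite !lee_fin.
rewrite lee_fin in v0.
congr EFin; apply/eqP; rewrite eq_le; apply/andP; split; rewrite leNgt; apply/negP => v1.
  pose dl := Num.min 1%R ((v - 1) / 8)%R.
  have d0 : (0 < dl)%R by rewrite lt_min ltr01 divr_gt0// subr_gt0.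
  have d1 : (dl <= 1)%R by rewrite ge_min lexx.
  have d2 : (dl <= (v - 1) / 8)%R by rewrite ge_min lexx orbT.
  have [+ _] := key dl d0; rewrite ler_pdivlMr; [nra|lra].
pose dl := ((1 - v) / 8)%R.
have d0 : (0 < dl)%R by rewrite divr_gt0// subr_gt0.
have d1 : (dl <= 1)%R by rewrite /dl; lra.
have [_] := key dl d0; rewrite ler_pdivrMr; last by rewrite mulr_gt0//; lra.
have e : (v = 1 - 8 * dl)%R by rewrite /dl; field.
rewrite e; nra.
Qed.

End GaussianMoments.

(** * Elementary inequalities for the tilt *)

Lemma sqrt1D_le (R : realType) (s : R) : 0 < s -> s <= 2^-1 ->
  Num.sqrt (1 + s) <= 1 + s / 2 - s ^+ 2 / 8 + s ^+ 3 / 16.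
Proof.
move=> s0 sh.
have h2 : s ^+ 2 <= s * 2^-1 by rewrite expr2 ler_wpM2l// ltW.
have h3 : 0 <= s ^+ 3 by rewrite exprn_ge0// ltW.
have r0 : 0 <= 1 + s / 2 - s ^+ 2 / 8 + s ^+ 3 / 16 by lra.
rewrite -(@ler_pXn2r _ 2%N)// ?nnegrE ?sqrtr_ge0// sqr_sqrtr; last by lra.
(* The upper bound is the cubic Taylor polynomial of the square root; its square exceeds 1 + s by
   exactly this product. *)
rewrite -subr_ge0 [X in 0 <= X](_ : _ = s ^+ 4 / 64 * (5 - s + s ^+ 2 / 4)); last by field.
apply: mulr_ge0; first by rewrite divr_ge0// exprn_ge0// ltW.
have := sqr_ge0 s; lra.
Qed.

Section RealInequalities.
Variables (R : realType) (s : R).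

Lemma eta_le_half : 0 < s -> s / (2 * (1 + s)) <= s / 2.
Proof. by move=> s0; rewrite ler_pdivrMr; [have := sqr_ge0 s; lra|lra]. Qed.

Lemma eta_ge_quad : 0 < s -> s / 2 - s ^+ 2 / 2 <= s / (2 * (1 + s)).
Proof.
move=> s0; rewrite ler_pdivlMr; last by lra.
have h : 0 <= s ^+ 3 by rewrite exprn_ge0// ltW.
lra.
Qed.

Lemma sqrt1D_le1 : 0 < s -> s <= 2^-1 -> Num.sqrt (1 + s) <= 1 + s / 2.
Proof.
move=> s0 sh; apply: (le_trans (sqrt1D_le s0 sh)); have h : 0 <= s ^+ 2 * (2 - s).
  by rewrite mulr_ge0 ?sqr_ge0//; lra.
lra.
Qed.

(** Since [Num.sqrt (1 + s)] is at most exp(s / 2), the exponent on the right has s^2 (1 + v) / 4 to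
    spare. *)
Lemma sqrt1D_expR_le (v : R) : 0 < s -> s <= 2^-1 -> 0 <= v ->
  Num.sqrt (1 + s) * expR (s * v / 2) <= expR (s / 2 * (1 + s / 2) * (1 + v)).
Proof.
move=> s0 sh v0; apply: (@le_trans _ _ (expR (s / 2) * expR (s * v / 2))).
  by rewrite ler_wpM2r ?expR_ge0// (le_trans (sqrt1D_le1 s0 sh))//; exact: expR_ge1Dx.
rewrite -expRD ler_expR.
have h1 := sqr_ge0 s; have h2 := mulr_ge0 h1 v0; lra.
Qed.

(** The fourth power of exp(a / 4) >= 1 + a / 4, whose quadratic coefficient is 6 / 16. *)
Lemma expR_ge_quad (a : R) : 0 <= a -> 1 + a + 3 / 8 * a ^+ 2 <= expR a.
Proof.
move=> a0.
have -> : expR a = expR (a / 4) ^+ 2 ^+ 2.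
  by rewrite !expr2 -!expRD; congr expR; field.
have h2 : (1 + a / 4) ^+ 2 ^+ 2 <= expR (a / 4) ^+ 2 ^+ 2.
  have p1 : 0 <= 1 + a / 4 by rewrite addr_ge0// divr_ge0.
  rewrite ler_sqr ?nnegrE ?sqr_ge0// ler_sqr ?nnegrE ?expR_ge0//; exact: expR_ge1Dx.
apply: le_trans h2; have a3 : 0 <= a ^+ 3 by exact: exprn_ge0.
have a4 : 0 <= a ^+ 4 by exact: exprn_ge0.
rewrite -subr_ge0 (_ : _ - _ = a ^+ 3 / 16 + a ^+ 4 / 256); last by field.
by rewrite addr_ge0// divr_ge0.
Qed.

(** The closing step of [exp_dm_le], with v = tau^2 and q the mean of [dp]. After division by exp(s
    v / 2) the first-order terms in s cancel. For v = 0 and q = 1/2 the second-order terms of the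
    estimates used also balance, except for the square of the exponent [a]: hence the quadratic
    bound on exp and the importance of q <= 1/2. *)
Lemma one_sided_ineq (eta q v : R) : 0 < s -> s <= 2^-1 -> 0 <= eta -> eta <= s / 2 -> s / 2 - s ^+ 2 / 2 <= eta ->
  0 <= q -> q <= 2^-1 -> 0 <= v ->
  Num.sqrt (1 + s) * expR (s * v / 2) <= eta * q + expR (s / 2 * (1 + s / 2) * (1 + v - q)).
Proof.
move=> s0 sh eta0 eta_le eta_ge q0 qh v0.
pose beta := s / 2 * (1 + s / 2).
pose a := beta + s ^+ 2 / 4 * v - beta * q.
have -> : expR (s / 2 * (1 + s / 2) * (1 + v - q)) = expR a * expR (s * v / 2).
  by rewrite -expRD; congr expR; rewrite /a /beta; field.
have Ev := expR_gt0 (s * v / 2).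
have ev1 : 1 - s * v / 2 <= (expR (s * v / 2))^-1.
  by rewrite -expRN; exact: expR_ge1Dx.
suff main : Num.sqrt (1 + s) <= eta * q * (expR (s * v / 2))^-1 + expR a.
  by have := ler_wpM2r (ltW Ev) main; rewrite mulrDl divfK ?gt_eqF.
have h1 := ler_wpM2l (mulr_ge0 eta0 q0) ev1.
have b0 : 0 <= s / 4 * (1 + s / 2) by rewrite mulr_ge0 ?divr_ge0 ?addr_ge0 ?divr_ge0 ?ltW.
have a0 : s / 4 * (1 + s / 2) <= a.
  have g1 : 0 <= s ^+ 2 / 4 * v by rewrite mulr_ge0// divr_ge0// sqr_ge0.
  have g2 : s / 4 * (1 + s / 2) * (1 - 2 * q) >= 0 by rewrite mulr_ge0//; lra.
  rewrite /a /beta; lra.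
have ea := expR_ge_quad (le_trans b0 a0).
have a2 : s ^+ 2 / 16 * (1 + s / 2) ^+ 2 <= a ^+ 2.
  rewrite (_ : _ * _ = (s / 4 * (1 + s / 2)) ^+ 2); last by field.
  by rewrite ler_sqr ?nnegrE//; exact: le_trans a0.
apply: (le_trans (sqrt1D_le s0 sh)).
suff : 1 + s / 2 - s ^+ 2 / 8 + s ^+ 3 / 16 <=
    eta * q * (1 - s * v / 2) + (1 + a + 3 / 8 * (s ^+ 2 / 16 * (1 + s / 2) ^+ 2)) by lra.
have k1 : (s / 2 - s ^+ 2 / 2) * q <= eta * q by rewrite ler_wpM2r.
have k2 : eta * q * (s * v / 2) <= s / 2 * q * (s * v / 2).
  by rewrite ler_wpM2r ?ler_wpM2r// divr_ge0// mulr_ge0// ltW.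
have k3 : s ^+ 2 * (q * v) <= s ^+ 2 * (v / 2).
  by rewrite ler_wpM2l ?sqr_ge0// mulrC ler_wpM2l.
have k4 : s ^+ 2 * q <= s ^+ 2 / 2 by rewrite ler_wpM2l ?sqr_ge0.
have k5 : s ^+ 3 <= s ^+ 2 / 2 by rewrite exprSr ler_wpM2l ?sqr_ge0.
have k6 : 0 <= s ^+ 2 * v by rewrite mulr_ge0// sqr_ge0.
have k8 : 0 <= s ^+ 4 by rewrite exprn_ge0// ltW.
have k9 : 0 <= s ^+ 3 by rewrite exprn_ge0// ltW.
rewrite /a /beta; clear h1 a0 a2 ea b0 ev1 Ev eta_ge eta_le; clear a beta; lra.
Qed.

(** For x > 0 the tilt cancels the growth of the square in the exponent of [phi (z * x + tau)], and
    the cross term -z x tau is at most -x tau because [tau] is nonnegative. *)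
Lemma tilt_pointwise (z eta x tau : R) : 1 <= z -> eta * z ^+ 2 = (z ^+ 2 - 1) / 2 -> 0 <= tau ->
  Num.max 0 (z * x) ^+ 2 * expR (eta * Num.max 0 (z * x) ^+ 2) * phi (z * x + tau) <=
  z ^+ 2 * (Num.max 0 x ^+ 2 * phi (x + tau)).
Proof.
move=> z1 ez t0; have z0 : 0 < z by exact: lt_le_trans z1.
case: (leP x 0) => x0.
  have zx : z * x <= 0 by rewrite pmulr_rle0.
  by rewrite (max_idPl zx) expr0n /= !mul0r mulr0.
have zx : 0 <= z * x by rewrite mulr_ge0// ltW.
rewrite (max_idPr zx) -mulrA.
rewrite exprMn -mulrA ler_wpM2l ?sqr_ge0// ler_wpM2l ?sqr_ge0//.
rewrite /phi mulrCA -expRD ler_wpM2l ?invr_ge0 ?sqrtr_ge0// ler_expR mulrA ez.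
have h : x * tau <= z * (x * tau) by rewrite ler_peMl//; apply: mulr_ge0 => //; exact: ltW.
lra.
Qed.

End RealInequalities.

(** * One-sided squares: means and exponential moments *)

Section OneSidedSquares.
Context {R : realType}.
Local Notation mu := (@lebesgue_measure R).
Local Notation gam := (normal_prob (0 : R) 1).
Local Open Scope ereal_scope.

(** The squared distance from [x] to the half-line below [tau]; [dm] is the one to the half-line
    above. They are the contributions of the coordinates off K and in K_L to the distance to the
    polar cone. *)
Definition dp (tau x : R) : R := (Num.max 0 (x - tau) ^+ 2)%R.
Definition dm (tau x : R) : R := (Num.max 0 (tau - x) ^+ 2)%R.

Lemma dp_ge0 tau x : (0 <= dp tau x)%R. Proof. exact: sqr_ge0. Qed.
Lemma dm_ge0 tau x : (0 <= dm tau x)%R. Proof. exact: sqr_ge0. Qed.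

Lemma measurable_dp tau : measurable_fun setT (dp tau).
Proof.
apply: measurable_funX; apply: measurable_maxr; first exact: measurable_cst.
exact: measurable_funB.
Qed.

Lemma measurable_dm tau : measurable_fun setT (dm tau).
Proof.
apply: measurable_funX; apply: measurable_maxr; first exact: measurable_cst.
exact: measurable_funB.
Qed.

Lemma dpm tau x : (dp tau x + dm tau x = (x - tau) ^+ 2)%R.
Proof.
rewrite /dp /dm; case: (leP x tau) => h.
  rewrite (max_idPl _) ?subr_le0// (max_idPr _) ?subr_ge0// expr0n add0r.
  by rewrite -sqrrN opprB.
by rewrite (max_idPr _) ?subr_ge0 ?ltW// (max_idPl _) ?subr_le0 ?ltW// expr0n addr0.
Qed.

Lemma dpm0 tau x : dp tau x = 0%R \/ dm tau x = 0%R.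
Proof.
rewrite /dp /dm; case: (leP x tau) => h; [left|right].
  by rewrite (max_idPl _) ?subr_le0// expr0n.
by rewrite (max_idPl _) ?subr_le0 ?ltW// expr0n.
Qed.

Definition qp tau : \bar R := \int[gam]_x (dp tau x)%:E.
Definition qm tau : \bar R := \int[gam]_x (dm tau x)%:E.

Lemma qp_ge0 tau : 0 <= qp tau.
Proof. by apply: integral_ge0 => x _; rewrite lee_fin dp_ge0. Qed.

Lemma qm_ge0 tau : 0 <= qm tau.
Proof. by apply: integral_ge0 => x _; rewrite lee_fin dm_ge0. Qed.

Lemma int_gamD (f g : R -> \bar R) : measurable_fun setT f -> measurable_fun setT g ->
  (forall x, 0 <= f x) -> (forall x, 0 <= g x) ->
  \int[gam]_x (f x + g x) = \int[gam]_x f x + \int[gam]_x g x.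
Proof. by move=> mf mg f0 g0; apply: ge0_integralD. Qed.

(** Averaging over x and -x removes the cross term and leaves the second moment. *)
Lemma int_sqr_shift tau : \int[gam]_x ((x - tau) ^+ 2)%:E = (1 + tau ^+ 2)%:E.
Proof.
have V0 : 0 <= \int[gam]_x ((x - tau) ^+ 2)%:E.
  by apply: integral_ge0 => x _; rewrite lee_fin sqr_ge0.
have e1 : \int[gam]_x ((- x - tau) ^+ 2)%:E = \int[gam]_x ((x - tau) ^+ 2)%:E.
  by apply: (gam_opp (msqr tau)) => x; rewrite lee_fin sqr_ge0.
have mn : measurable_fun setT (fun x : R => ((- x - tau) ^+ 2)%:E : \bar R).
  by apply: mfE; apply: measurable_funX; apply: measurable_funB => //; exact: measurable_funN.
have e2 : \int[gam]_x (((x - tau) ^+ 2)%:E + ((- x - tau) ^+ 2)%:E) =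
    \int[gam]_x ((x - tau) ^+ 2)%:E + \int[gam]_x ((- x - tau) ^+ 2)%:E.
  by apply: int_gamD => // [|x|x]; [exact: msqr|rewrite lee_fin sqr_ge0|rewrite lee_fin sqr_ge0].
have mx2 : measurable_fun setT (fun x : R => (x ^+ 2)%:E : \bar R).
  by apply: mfE; exact: measurable_funX.
have x20 (x : R) : 0 <= (x ^+ 2)%:E by rewrite lee_fin sqr_ge0.
have e3 : \int[gam]_x (((x - tau) ^+ 2)%:E + ((- x - tau) ^+ 2)%:E) = (2 * (1 + tau ^+ 2))%:E.
  transitivity (\int[gam]_x (2%:E * ((x ^+ 2)%:E + (tau ^+ 2)%:E))).
    by apply: eq_integral => x _; rewrite -!EFinD -EFinM; congr EFin; ring.
  have mc := @measurable_cst _ _ R (\bar R) setT (tau ^+ 2)%:E.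
  have c0 (x : R) : 0 <= cst (tau ^+ 2)%:E x :> \bar R by rewrite lee_fin sqr_ge0.
  apply: (etrans (int_gamZ _ (emeasurable_funD mx2 mc) (fun x => adde_ge0 (x20 x) (c0 x)))) => //.
  rewrite (EFinM 2); congr (_ * _); apply: (etrans (int_gamD mx2 mc x20 c0)).
  rewrite EFinD; congr (_ + _); first exact: m2E.
  exact: int_gam_cst.
move: e2; rewrite e3 e1.
case: (\int[gam]_x ((x - tau) ^+ 2)%:E) V0 => [v| |]//= _ [] e.
by congr EFin; lra.
Qed.

Lemma qpD tau : qp tau + qm tau = (1 + tau ^+ 2)%:E.
Proof.
rewrite -int_sqr_shift; apply/esym.
transitivity (\int[gam]_x ((dp tau x)%:E + (dm tau x)%:E)).
  by apply: eq_integral => x _; rewrite -EFinD dpm.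
apply: int_gamD => [||x|x]; [by apply: mfE; exact: measurable_dp|by apply: mfE; exact: measurable_dm| |].
- by rewrite lee_fin dp_ge0.
- by rewrite lee_fin dm_ge0.
Qed.

Lemma qp_fin tau : qp tau \is a fin_num.
Proof. by have := qpD tau; have := qp_ge0 tau; have := qm_ge0 tau; case: qp; case: qm. Qed.

Lemma qm_fin tau : qm tau \is a fin_num.
Proof. by have := qpD tau; have := qp_ge0 tau; have := qm_ge0 tau; case: qp; case: qm. Qed.

Lemma qm0E : qm 0 = qp 0.
Proof.
rewrite /qm /qp.
have := @gam_opp R (fun x => (dp 0 x)%:E) (mfE (measurable_dp 0)) => H.
rewrite -H; last by move=> x; rewrite lee_fin dp_ge0.
by apply: eq_integral => x _; rewrite /dp /dm sub0r subr0.
Qed.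

(** At tau = 0 the two one-sided means agree by symmetry and add up to 1; [dp] decreases in
    [tau]. *)
Lemma qp_le_half tau : (0 <= tau)%R -> qp tau <= (2^-1)%:E.
Proof.
move=> t0; have q0 : qp 0 = (2^-1)%:E.
  have := qpD 0; rewrite qm0E; case: (qp 0) (qp_fin 0) => [v| |]// _ [] e.
  by congr EFin; move: e; rewrite expr0n /=; lra.
rewrite -q0; apply: le_int_gam.
- by apply: mfE; exact: measurable_dp.
- by apply: mfE; exact: measurable_dp.
- by move=> x; rewrite lee_fin dp_ge0.
move=> x; rewrite lee_fin /dp subr0.
have h : (Num.max 0 (x - tau) <= Num.max 0 x)%R.
  by rewrite ge_max !le_max lexx/= gerBl t0 orbT.
by rewrite ler_pXn2r// nnegrE le_max lexx.
Qed.

Section Exponential.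
Variable s : R.
Hypotheses (s0 : (0 < s)%R) (s_half : (s <= 2^-1)%R).
Let z := Num.sqrt (1 + s).
Let eta := (s / (2 * (1 + s)))%R.
Let beta := (s / 2 * (1 + s / 2))%R.

Let s1 : (0 < 1 + s)%R. Proof. by rewrite addr_gt0. Qed.
Let z0 : (0 < z)%R. Proof. by rewrite sqrtr_gt0. Qed.
Let z2 : (z ^+ 2 = 1 + s)%R. Proof. by rewrite sqr_sqrtr// ltW. Qed.
Let eta0 : (0 < eta)%R. Proof. by rewrite divr_gt0// mulr_gt0. Qed.
Let eta_le : (eta <= s / 2)%R. Proof. exact: eta_le_half. Qed.
Let eta_ge : (s / 2 - s ^+ 2 / 2 <= eta)%R. Proof. exact: eta_ge_quad. Qed.

Let mexp f : measurable_fun setT f -> measurable_fun setT (fun x : R => (expR (eta * f x))%:E : \bar R).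
Proof. by move=> mf; apply: mfE; apply: measurableT_comp => //; exact: measurable_funM. Qed.

Lemma exp_sqr_le tau :
  \int[gam]_x (expR (eta * (x - tau) ^+ 2))%:E <= (expR (beta * (1 + tau ^+ 2)))%:E.
Proof.
rewrite (gam_exp_sqr s0) lee_fin; apply: sqrt1D_expR_le => //; exact: sqr_ge0.
Qed.

(** From exp u <= 1 + u exp u: by [tilt_pointwise] the tilted mean of [dp] is at most z^3 times its
    mean, and eta z^3 = (s / 2) z <= (s / 2) (1 + s / 2). This is the origin of [beta], which the
    other two kinds of coordinates share. *)
Lemma exp_dp_le tau : (0 <= tau)%R ->
  \int[gam]_x (expR (eta * dp tau x))%:E <= (expR (beta * fine (qp tau)))%:E.
Proof.
move=> t0.
have md := measurable_dp tau.
pose g (x : R) : \bar R := (dp tau x)%:E * (expR (eta * dp tau x))%:E.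
have mg : measurable_fun setT g by apply: emeasurable_funM; [exact: mfE|exact: mexp].
have g0 x : 0 <= g x by rewrite mule_ge0// lee_fin ?dp_ge0 ?expR_ge0.
have meg : measurable_fun setT (fun x => eta%:E * g x).
  by apply: emeasurable_funM => //; exact: measurable_cst.
have eg0 x : 0 <= eta%:E * g x by rewrite mule_ge0// lee_fin ltW.
have step1 : \int[gam]_x (expR (eta * dp tau x))%:E <= 1 + eta%:E * \int[gam]_x g x.
  rewrite -(int_gamZ (ltW eta0) mg g0) -(int_gam1D meg eg0).
  apply: le_int_gam => //.
  - exact: mexp.
  - by apply: emeasurable_funD => //; exact: measurable_cst.
  move=> x; rewrite /g -!EFinM -EFinD lee_fin mulrA.
  have := expR_ge1Dx (- (eta * dp tau x)); rewrite expRN => h.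
  have E0 := expR_gt0 (eta * dp tau x).
  have := ler_wpM2r (ltW E0) h; rewrite mulVf ?gt_eqF//; lra.
have step2 : \int[gam]_x g x <= (z ^+ 3)%:E * qp tau.
  have mG := measurable_gamE mg.
  have G0 x : 0 <= g x * (phi x)%:E by rewrite mule_ge0// lee_fin phi_ge0.
  have mS : measurable_fun setT (fun x : R => g (x + tau)%R * (phi (x + tau))%:E).
    apply: (measurableT_comp mG); exact: measurable_funD.
  have e1 := integral_lebesgue_shift tau mG G0.
  have e2 := integral_lebesgue_scale z0 mS (fun x => G0 (x + tau)%R).
  have mD := measurable_gamE (mfE md).
  have D0 x : 0 <= (dp tau x)%:E * (phi x)%:E by rewrite mule_ge0// lee_fin ?dp_ge0 ?phi_ge0.
  have e3 := integral_lebesgue_shift tau mD D0.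
  have e4 := integral_gam mg g0.
  have e5 := integral_gam (mfE md) (fun x => dp_ge0 tau x : 0 <= _%:E).
  rewrite /qp e4 e5 -e1 -e2 -e3.
  rewrite exprS EFinM -muleA; apply: lee_wpmul2l; first by rewrite lee_fin ltW.
  have mDS : measurable_fun setT (fun x : R => (dp tau (x + tau))%:E * (phi (x + tau))%:E).
    apply: (measurableT_comp mD); exact: measurable_funD.
  have zz0 : 0 <= (z ^+ 2)%:E by rewrite lee_fin sqr_ge0.
  rewrite -(ge0_integralZl mu measurableT mDS (fun x _ => D0 _) zz0).
  apply: ge0_le_integral => //.
  - apply: (measurableT_comp mS); exact: measurable_funM.
  - by apply: emeasurable_funM => //; exact: measurable_cst.
  move=> x _; rewrite /g -!EFinM lee_fin /dp !addrK.
  apply: tilt_pointwise => //.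
    by rewrite -(@ler_pXn2r _ 2%N)// ?nnegrE ?(ltW z0)// z2 expr1n lerDl ltW.
  by rewrite z2 /eta; field; rewrite gt_eqF.
have [q qE] : exists q, qp tau = q%:E by exists (fine (qp tau)); rewrite fineK// qp_fin.
rewrite qE /= in step2 *.
have q0 : (0 <= q)%R by rewrite -lee_fin -qE qp_ge0.
apply: (le_trans step1); apply: (@le_trans _ _ (1 + eta%:E * ((z ^+ 3)%:E * q%:E))).
  by rewrite leeD2l// lee_wpmul2l// lee_fin ltW.
rewrite -!EFinM -EFinD lee_fin; apply: le_trans (expR_ge1Dx _); rewrite lerD2l mulrA ler_wpM2r//.
have -> : (eta * z ^+ 3 = s / 2 * z)%R.
  by rewrite exprSr mulrA z2 /eta; congr (_ * _)%R; field; rewrite gt_eqF.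
by rewrite ler_wpM2l ?sqrt1D_le1// divr_ge0// ltW.
Qed.

(* The two one-sided squares sum to (x - tau)^2 and one of them vanishes, so the bound for dm
   follows from the exact transform of (x - tau)^2 and the fact that qp <= 1/2. *)
Lemma exp_dm_le tau : (0 <= tau)%R ->
  \int[gam]_x (expR (eta * dm tau x))%:E <= (expR (beta * fine (qm tau)))%:E.
Proof.
move=> t0.
have mp := measurable_dp tau; have mm := measurable_dm tau.
have step1 : \int[gam]_x (expR (eta * dm tau x))%:E + eta%:E * qp tau <=
    (z * expR (s * tau ^+ 2 / 2))%:E.
  have d0 (x : R) : 0 <= (dp tau x)%:E by rewrite lee_fin dp_ge0.
  have E0 (x : R) : 0 <= (expR (eta * dm tau x))%:E by rewrite lee_fin expR_ge0.
  have ed0 (x : R) : 0 <= eta%:E * (dp tau x)%:E by rewrite mule_ge0// lee_fin ltW.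
  have med : measurable_fun setT (fun x : R => eta%:E * (dp tau x)%:E).
    by apply: emeasurable_funM; [exact: measurable_cst|exact: mfE].
  rewrite -(int_gamZ (ltW eta0) (mfE mp) d0) -(int_gamD (mexp mm) med E0 ed0).
  rewrite -(gam_exp_sqr s0); apply: le_int_gam.
  - by apply: emeasurable_funD => //; exact: mexp.
  - by apply: mexp; apply: measurable_funX; exact: measurable_funB.
  - by move=> x; rewrite adde_ge0.
  move=> x; rewrite -EFinM -EFinD lee_fin -dpm.
  case: (dpm0 tau x) => ->; first by rewrite mulr0 addr0 add0r.
  by rewrite mulr0 expR0 addr0; exact: expR_ge1Dx.
have := qpD tau; have := qp_le_half t0; have := qp_ge0 tau.
case: (qp tau) (qp_fin tau) step1 => [q| |]// _ step1.
case: (qm tau) (qm_fin tau) => [M| |]// _; rewrite !lee_fin => q0 qh [] qM.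
have V0 : 0 <= \int[gam]_x (expR (eta * dm tau x))%:E.
  by apply: integral_ge0 => x _; rewrite lee_fin expR_ge0.
move: step1 V0; case: (\int[gam]_x _) => [V| |]//.
rewrite -EFinM -EFinD !lee_fin /= => h V0.
have Me : M = (1 + tau ^+ 2 - q)%R by rewrite -qM addrC addrK.
rewrite -(lerD2r (eta * q)); apply: (le_trans h); rewrite [leRHS]addrC Me.
by apply: one_sided_ineq => //; [exact: ltW|exact: sqr_ge0].
Qed.

End Exponential.

End OneSidedSquares.

(** * Polyhedral cones given by lists of half-spaces *)

Section Halfspaces.
Context {R : realType}.
Variable n : nat.
Implicit Types (ls : seq 'rV[R]_n) (y h : 'rV[R]_n).

(** Meant for relative interiors of faces, while [negl] is for normal cones. The vertex is excluded
    even when [ls] is empty, because a cap needs a nonzero axis. *)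
Definition posl ls y := (y != 0) && all (fun l => 0 < dot l y) ls.
Definition negl ls y := all (fun l => dot l y <= 0) ls.

Lemma poslZ ls c y : 0 < c -> posl ls (c *: y) = posl ls y.
Proof.
move=> c0; rewrite /posl scaler_eq0 negb_or gt_eqF//=; congr (_ && _).
by apply: eq_all => l; rewrite dotZr pmulr_rgt0.
Qed.

Lemma neglZ ls c y : 0 < c -> negl ls (c *: y) = negl ls y.
Proof. by move=> c0; apply: eq_all => l; rewrite dotZr pmulr_rle0. Qed.

Lemma measurable_all d (T : measurableType d) (I : eqType) (s : seq I) (f : I -> T -> bool) :
  (forall i, measurable_fun setT (f i)) -> measurable_fun setT (fun w => all (f^~ w) s).
Proof.
move=> mf; elim: s => [|i s IH] /=; first exact: measurable_cst.
exact: measurable_and.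
Qed.

Lemma measurable_dotl l : measurable_fun setT (fun y : mxm R 1 n => dot l y).
Proof. by apply: measurable_dot; [exact: measurable_cst|exact: measurable_id]. Qed.

Lemma measurable_negl ls : measurable_fun setT (negl ls : mxm R 1 n -> bool).
Proof.
apply: (@measurable_all _ _ _ _ (fun l (y : mxm R 1 n) => dot l y <= 0)) => l.
by apply: measurable_fun_ler; [exact: measurable_dotl|exact: measurable_cst].
Qed.

Lemma neq0_dot y : (y != 0) = (0 < dot y y).
Proof.
apply/idP/idP => [/dot_gt0//|]; apply: contraTneq => ->.
by rewrite dot0l ltxx.
Qed.

Lemma measurable_posl ls : measurable_fun setT (posl ls : mxm R 1 n -> bool).
Proof.
apply: measurable_and.
  rewrite (_ : (fun y : mxm R 1 n => y != 0) = (fun y => 0 < dot y y)); last first.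
    by apply/funext => y; exact: neq0_dot.
  apply: measurable_fun_ltr; first exact: measurable_cst.
  by apply: measurable_dot; exact: measurable_id.
apply: (@measurable_all _ _ _ _ (fun l (y : mxm R 1 n) => 0 < dot l y)) => l.
by apply: measurable_fun_ltr; [exact: measurable_cst|exact: measurable_dotl].
Qed.

Lemma dotDr y h (w : 'rV[R]_n) : dot y (h + w) = dot y h + dot y w.
Proof. by rewrite dotC dotDl !(dotC y). Qed.

Lemma cauchy_schwarz y h : dot y h ^+ 2 <= dot y y * dot h h.
Proof.
have [->|/dot_gt0 h0] := eqVneq h 0; first by rewrite dotC !dot0l expr0n mulr0.
have := dot_ge0 (dot h h *: y + (- dot y h) *: h).
rewrite dotDl !dotDr !dotZl !dotZr (dotC h y) => H.
have : 0 <= dot h h * (dot h h * dot y y - dot y h ^+ 2) by apply: le_trans H _; rewrite le_eqVlt; apply/orP; left; apply/eqP; ring.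
by rewrite pmulr_rge0// subr_ge0 mulrC.
Qed.

Lemma cap_halfspace l y : y != 0 -> 0 < dot l y ->
  exists k : nat, forall h, cap (1 - k.+1%:R^-1) y h -> 0 < dot l h.
Proof.
move=> y0 ly.
have yy := dot_gt0 y0.
have ll : 0 < dot l l.
  by apply: dot_gt0; apply: contraTneq ly => ->; rewrite dot0l ltxx.
(* The squared cosine of the angle between [l] and [y]. As e <= 1, an aperture dl <= e / 2 satisfies
   dl (1 + e) <= e, which contradicts [H2]. *)
pose e := dot l y ^+ 2 / (dot l l * dot y y).
have e0 : 0 < e by rewrite divr_gt0 ?exprn_gt0 ?mulr_gt0.
have [k ke] : exists k : nat, k.+1%:R^-1 <= e / 2.
  have [k hk] := @ltr_add_invr R 0 (e / 2) (divr_gt0 e0 (ltr0Sn _ _)).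
  by exists k; rewrite ltW// -[X in X < _]add0r.
exists k => h /andP[yh ch].
have hh : 0 < dot h h.
  by apply: dot_gt0; apply: contraTneq yh => ->; rewrite dotC dot0l ltxx.
(* If dot l h <= 0, the component of h orthogonal to y would be too large. *)
pose t := dot y h / dot y y.
have t0 : 0 < t by rewrite divr_gt0.
pose w := h + (- t) *: y.
have hE : dot l h = t * dot l y + dot l w.
  by rewrite /w dotDr dotZr; ring.
have wE : dot w w = dot h h - dot y h ^+ 2 / dot y y.
  rewrite /w dotDl !dotDr !dotZl !dotZr (dotC h y) /t.
  by field; rewrite gt_eqF.
rewrite ltNge; apply/negP => lh.
have lw : t * dot l y <= - dot l w by rewrite hE in lh; lra.
have lw2 : (t * dot l y) ^+ 2 <= dot l w ^+ 2.
  have p : 0 <= t * dot l y by rewrite mulr_ge0 ?ltW.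
  by rewrite -(sqrrN (dot l w)) ler_sqr ?nnegrE//; exact: le_trans p lw.
have := le_trans lw2 (cauchy_schwarz l w); rewrite wE => H.
have tE : (t * dot l y) ^+ 2 = e * dot l l * (dot y h ^+ 2 / dot y y).
  by rewrite /t /e; field; rewrite !gt_eqF.
rewrite tE in H.
have H2 : e * (dot y h ^+ 2 / dot y y) <= dot h h - dot y h ^+ 2 / dot y y.
  by rewrite -(ler_pM2l ll); apply: le_trans H; rewrite le_eqVlt; apply/orP; left; apply/eqP; ring.
set X := dot y h ^+ 2 / dot y y in H2.
have X1 : (1 - k.+1%:R^-1) * dot h h < X.
  by rewrite /X ltr_pdivlMr//; apply: le_lt_trans ch; rewrite le_eqVlt; apply/orP; left; apply/eqP; ring.
have Xh : X <= dot h h by rewrite /X ler_pdivrMr// mulrC cauchy_schwarz.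
have e1 : e <= 1 by rewrite /e ler_pdivrMr ?mulr_gt0// mul1r cauchy_schwarz.
set dl := k.+1%:R^-1 in ke X1.
have dl0 : 0 < dl by rewrite invr_gt0.
have k1 : dl * (1 + e) <= e.
  have e2 : 1 + e <= 2 by lra.
  by have := ler_wpM2l (ltW dl0) e2; lra.
have P1 : (1 + e) * ((1 - dl) * dot h h) < (1 + e) * X by rewrite ltr_pM2l// addr_gt0.
have P2 : dl * (1 + e) * dot h h <= e * dot h h by rewrite ler_wpM2r// ltW.
lra.
Qed.

Lemma posl_open ls y : posl ls y -> y != 0 /\
  exists k : nat, forall h, cap (1 - k.+1%:R^-1) y h -> posl ls h.
Proof.
move=> /andP[y0 p]; split=> //; elim: ls p => [_|l ls IH] /=.
  exists 0%N => h /andP[yh _]; rewrite /posl andbT.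
  by apply: contraTneq yh => ->; rewrite dotC dot0l ltxx.
move=> /andP[/(cap_halfspace y0)[k1 h1] /IH[k2 h2]].
have mono k k' : (k <= k')%N -> 1 - k.+1%:R^-1 <= 1 - k'.+1%:R^-1 :> R.
  by move=> kk; rewrite lerD2l lerN2 lef_pV2 ?posrE// ler_nat.
exists (maxn k1 k2) => h ch; rewrite /posl /=.
have /andP[-> ->] := h2 h (cap_le (mono _ _ (leq_maxr k1 k2)) ch).
by rewrite (h1 h (cap_le (mono _ _ (leq_maxl k1 k2)) ch)).
Qed.

Lemma negl_proj ls (J : {set 'I_n}) y : (forall l, l \in ls -> l *m proj J = 0) ->
  negl ls (y *m (1%:M - proj J)) = negl ls y.
Proof.
move=> lsJ; apply: eq_in_all => l /lsJ lJ; congr (_ <= 0).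
rewrite dotC dotE -mulmxA -[in LHS](tr_proj J).
rewrite mulmxBl mul1mx -trmx_mul lJ trmx0 subr0 -dotE dotC//.
Qed.

End Halfspaces.

(** * Gaussian change of scale on a coordinate subspace *)

Section Tilt.
Context {R : realType}.
Local Notation mgauss := (@mgauss R).
Local Notation bE := (@bE R).
Local Open Scope ereal_scope.
Variables (n : nat) (s : R).
Hypothesis s0 : (0 < s)%R.
Let z := Num.sqrt (1 + s).
Let eta := (s / (2 * (1 + s)))%R.

Definition scl (r : seq 'I_n) (x : mxm R 1 n) : mxm R 1 n :=
  \row_k if k \in r then (z * x ord0 k)%R else x ord0 k.

Lemma measurable_scl r : measurable_fun setT (scl r).
Proof.
apply: measurable_mxP => i j; rewrite /scl.
case jr : (j \in r).
  under [X in measurable_fun _ X]eq_fun do rewrite mxE jr.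
  by apply: measurable_funM => //; exact: measurable_mxE.
by under [X in measurable_fun _ X]eq_fun do rewrite mxE jr; exact: measurable_mxE.
Qed.

Lemma mgauss_tilt1 (j : 'I_n) (f : mxm R 1 n -> \bar R) :
  measurable_fun setT f -> (forall x, 0 <= f x) ->
  \int[mgauss 1 n]_x (f x * (expR (eta * x ord0 j ^+ 2))%:E) =
  z%:E * \int[mgauss 1 n]_x f (scl [:: j] x).
Proof.
move=> mf f0.
have me : measurable_fun setT (fun x : mxm R 1 n => (expR (eta * x ord0 j ^+ 2))%:E : \bar R).
  apply/measurable_EFinP; apply: measurableT_comp => //; apply: measurable_funM => //.
  by apply: measurable_funX; exact: measurable_mxE.
have e0 (x : mxm R 1 n) : 0 <= (expR (eta * x ord0 j ^+ 2))%:E by rewrite lee_fin expR_ge0.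
have e1 := mgauss_setc j (emeasurable_funM mf me) (fun x => mule_ge0 (f0 x) (e0 x)).
have mS := measurableT_comp mf (measurable_setc j).
have mG : measurable_fun setT (fun x : R => \int[mgauss 1 n]_M f (setc j x M)).
  by apply: (@measurable_fun_fubini_tonelli_F _ _ _ _ _ (mgauss 1 n) _ mS) => w; exact: f0.
have G0 (x : R) : 0 <= \int[mgauss 1 n]_M f (setc j x M) by exact: integral_ge0.
have e2 := gam_tilt s0 mG G0.
apply: (etrans e1); apply: etrans; first last.
  have e3 := mgauss_setc j (measurableT_comp mf (measurable_scl [:: j])) (fun x => f0 _).
  exact: (esym (congr1 (fun u => z%:E * u) e3)).
apply: etrans; last first.
  apply: etrans; first exact: e2.
  congr (_ * _); apply: eq_integral => x _; apply: eq_integral => M _ /=; congr f.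
  apply/matrixP => a k; rewrite /setc /scl !mxE !inE.
  by case: (k == j).
apply: eq_integral => x _.
have mfx : measurable_fun setT (fun M : mxm R 1 n => f (setc j x M)).
  exact: (measurableT_comp mS (pair1_measurable (x : measurableTypeR R))).
have E0 : 0 <= (expR (eta * x ^+ 2))%:E :> \bar R by rewrite lee_fin expR_ge0.
rewrite -(ge0_integralZr (mgauss 1 n) measurableT mfx (fun M _ => f0 _) E0).
by apply: eq_integral => M _; rewrite /= [in X in _ * X]mxE eqxx.
Qed.

Lemma mgauss_tilt (r : seq 'I_n) (f : mxm R 1 n -> \bar R) : uniq r ->
  measurable_fun setT f -> (forall x, 0 <= f x) ->
  \int[mgauss 1 n]_x (f x * (expR (eta * \sum_(j <- r) x ord0 j ^+ 2))%:E) =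
  (z ^+ size r)%:E * \int[mgauss 1 n]_x f (scl r x).
Proof.
elim: r f => [|j r IH] f /=.
  move=> _ mf f0; rewrite mul1e; apply: eq_integral => x _.
  rewrite big_nil mulr0 expR0 mule1; congr f.
  by apply/matrixP => a k; rewrite ord1 mxE.
move=> /andP[jr ur] mf f0.
have mfj := measurableT_comp mf (measurable_scl [:: j]).
have IHj := IH _ ur mfj (fun x => f0 _).
rewrite exprS EFinM -muleA.
have -> : \int[mgauss 1 n]_x f (scl (j :: r) x) = \int[mgauss 1 n]_x f (scl [:: j] (scl r x)).
  apply: eq_integral => x _; congr f; apply/matrixP => a k; rewrite /scl !mxE !inE.
  by case: (eqVneq k j) => [->|//]; rewrite (negbTE jr).
rewrite -[X in _ = _ * X]IHj.
have msum : measurable_fun setT (fun x : mxm R 1 n => (expR (eta * \sum_(j <- r) x ord0 j ^+ 2))%:E : \bar R).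
  apply/measurable_EFinP; apply: measurableT_comp => //; apply: measurable_funM => //.
  by apply: measurable_sum => k; apply: measurable_funX; exact: measurable_mxE.
have s0' (x : mxm R 1 n) : 0 <= (expR (eta * \sum_(j <- r) x ord0 j ^+ 2))%:E by rewrite lee_fin expR_ge0.
have e := mgauss_tilt1 j (emeasurable_funM mf msum) (fun x => mule_ge0 (f0 x) (s0' x)).
apply: etrans; last first.
  apply: (etrans e); congr (_ * _); apply: eq_integral => x _ /=; congr (_ * (expR (_ * _))%:E).
  apply: eq_big_seq => k kr; rewrite /scl mxE inE; case: eqP => // kj.
  by move: jr; rewrite -kj kr.
apply: eq_integral => x _; rewrite big_cons mulrDr expRD EFinM -muleA; congr (_ * _).
by rewrite muleC.
Qed.

Lemma mgauss_indep (J : {set 'I_n}) (F H : mxm R 1 n -> bool) :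
  measurable_fun setT F -> measurable_fun setT H ->
  (forall x, H (x *m (1%:M - proj J))%R = H x) ->
  (\int[mgauss 1 n]_h bE (F (h *m proj J)%R)) * \int[mgauss 1 n]_h bE (H h) =
  \int[mgauss 1 n]_h bE (F (h *m proj J)%R && H h).
Proof.
move=> mF mH HP.
have mFP : measurable_fun setT (fun h : mxm R 1 n => F (h *m proj J)%R).
  exact: (measurableT_comp mF (measurable_mulmxr _ (@measurable_id _ _ setT))).
have mFH := @measurable_bE R _ _ _ (measurable_and mFP mH).
have e1 := mgauss_mix (fun=> (fun j => j \in J)) mFH (fun _ => bE_ge0 _).
apply/esym; apply: (etrans e1).
have H0 : 0 <= \int[mgauss 1 n]_h bE (H h) by apply: integral_ge0 => ? _; exact: bE_ge0.
have e2 := ge0_integralZr (mgauss 1 n) measurableT (@measurable_bE R _ _ _ mFP) (fun h _ => bE_ge0 _) H0.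
apply: etrans; last exact: e2.
apply: eq_integral => A _.
have e3 := ge0_integralZl (mgauss 1 n) measurableT (@measurable_bE R _ _ _ mH) (fun h _ => bE_ge0 _) (bE_ge0 (F (A *m proj J)%R)).
apply: etrans; last exact: e3.
apply: eq_integral => B _; rewrite bE_and.
have -> : (mix (fun=> (fun j => j \in J)) A B *m proj J = (A : 'M[R]_(1, n)) *m proj J)%R.
  by apply/matrixP => i j; rewrite !mul_projE; case: ifP => // jJ; rewrite /mix mxE jJ.
rewrite -HP -[in RHS]HP; congr (_ * bE (H _)).
by apply/matrixP => i j; rewrite !mul_projCE; case: ifP => // jJ; rewrite /mix mxE jJ.
Qed.

(** Tilting the coordinates in [J] rescales them by [z], with one factor [z] for each. The first
    cone is homogeneous and the second does not involve these coordinates, so neither event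
    changes. *)
Lemma face_weight (J : {set 'I_n}) (ls1 ls2 : seq 'rV[R]_n) :
  (forall l, l \in ls2 -> l *m proj J = 0)%R ->
  (z ^+ #|J|)%:E * ((\int[mgauss 1 n]_h bE (posl ls1 (h *m proj J)%R)) *
    \int[mgauss 1 n]_h bE (negl ls2 h)) =
  \int[mgauss 1 n]_h (bE (posl ls1 (h *m proj J)%R && negl ls2 h) *
     (expR (eta * dot (h *m proj J)%R (h *m proj J)%R))%:E).
Proof.
move=> lsJ.
have mF := @measurable_posl R n ls1; have mH := @measurable_negl R n ls2.
have mFP : measurable_fun setT (fun h : mxm R 1 n => posl ls1 (h *m proj J)%R).
  exact: (measurableT_comp mF (measurable_mulmxr _ (@measurable_id _ _ setT))).
have mFH := @measurable_bE R _ _ _ (measurable_and mFP mH).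
rewrite (mgauss_indep mF mH (fun x => negl_proj x lsJ)).
have e := mgauss_tilt (enum_uniq (mem J)) mFH (fun _ => bE_ge0 _).
rewrite -cardE in e.
apply/esym; apply: etrans; last first.
  apply: (etrans e); congr (_ * _); apply: eq_integral => x _.
  have zgt0 : (0 < z)%R by rewrite sqrtr_gt0 addr_gt0.
  congr bE; congr (_ && _).
    have -> : (scl (enum J) x *m proj J = z *: ((x : 'M[R]_(1, n)) *m proj J))%R.
      apply/matrixP => i j; rewrite [RHS]mxE !mul_projE mxE mem_enum ord1.
      case: ifP => jJ; last by rewrite mulr0.
      by rewrite jJ (ord1 i).
    exact: poslZ.
  rewrite -(negl_proj _ lsJ) -[RHS](negl_proj _ lsJ); congr (negl _ _).
  apply/matrixP => i j; rewrite !mul_projCE; case: ifP => // jJ.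
  by rewrite /scl mxE mem_enum jJ (ord1 i).
apply: eq_integral => h _; congr (_ * (expR (_ * _))%:E).
rewrite big_enum /= /dot [RHS]big_mkcond; apply: eq_bigr => j _.
by rewrite mul_projE; case: ifP => _; rewrite ?mul0r.
Qed.

End Tilt.

(** * Faces of the descent cone in rotated coordinates *)

Section Faces.
Context {R : realType}.
Variables (n : nat) (Kh KL : {set 'I_n}) (idef : 'I_n).
Implicit Types (I : {set 'I_n}) (d g y : 'rV[R]_n) (f : {set 'I_n} * bool).

Definition sg (i : 'I_n) : R := if i \in KL then -1 else 1.

Definition descent_cone d : Prop :=
  (forall i, i \notin Kh -> 0 <= sg i * d 0 i) /\ \sum_i d 0 i <= 0.

Definition one I : 'rV[R]_n := \row_i (i \in I)%:R.
(** The default [idef] serves only the empty set, which [valid] excludes. *)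
Definition axis I : 'I_n := odflt idef [pick i in I].
Definition ex i : 'rV[R]_n := delta_mx 0 i.

Lemma axis_in I : I != finset.set0 -> axis I \in I.
Proof.
rewrite /axis; case: pickP => [x //|I0] /set0Pn[x xI].
by have := I0 x; rewrite xI.
Qed.

Lemma one_proj I : one I *m proj I = one I.
Proof. by apply/matrixP => i j; rewrite mul_projE mxE; case: (j \in I). Qed.

Lemma dot_one I y : dot (one I) y = \sum_(i in I) y 0 i.
Proof.
rewrite /dot [RHS]big_mkcond; apply: eq_bigr => i _.
by rewrite mxE; case: ifP => _; rewrite ?mul1r ?mul0r.
Qed.

Lemma dot_ex i y : dot (ex i) y = y 0 i.
Proof.
rewrite /dot (bigD1 i)//= big1 ?addr0 => [|k ki]; rewrite mxE eqxx /=.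
  by rewrite eqxx mul1r.
by rewrite (negbTE ki) mul0r.
Qed.

Lemma dot_one_one I : dot (one I) (one I) = #|I|%:R.
Proof.
rewrite dot_one (eq_bigr (fun=> 1)) => [|i iI]; last by rewrite mxE iI.
by rewrite sumr_const.
Qed.

Lemma dotNl d y : dot (- d) y = - dot d y.
Proof. by rewrite -scaleN1r dotZl mulN1r. Qed.

(** Taking the indicator of [I] to an axis turns the zero-sum hyperplane in the coordinates [I] into
    a coordinate subspace. Without the sum constraint the span already is one, and the identity
    serves. *)
Lemma rot_ex f : exists U : 'M[R]_n, ginv U /\ (f.1 != finset.set0 ->
  [/\ U *m proj f.1 = proj f.1 *m U, (1%:M - proj f.1) *m U = 1%:M - proj f.1 &
  f.2 -> one f.1 *m U = Num.sqrt #|f.1|%:R *: ex (axis f.1)]).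
Proof.
case: f => I [] /=; last first.
  by exists 1%:M; split=> [|_]; [exact: ginv1|by split=> //; rewrite mulmx1 ?mul1mx].
have [->|I0] := eqVneq I finset.set0; first by exists 1%:M; split=> //; exact: ginv1.
have [Q [gQ QP PQ hQ]] := ginv_transitive (axis_in I0) (one_proj I).
by exists Q; split=> // _; split=> // _; rewrite hQ dot_one_one.
Qed.

(* A face f = (I, b) of descent_cone: I is the set of coordinates that are not forced to be 0,
   and b tells whether the sum constraint is active. rot f maps the linear span of the face
   onto the coordinate subspace indexed by fdim f; in these coordinates lsF lists the strict
   inequalities that cut out the relative interior of the face, and lsH those of its normal cone. *)
Definition rot f : 'M[R]_n := sval (cid (rot_ex f)).

Lemma rotP f : ginv (rot f) /\ (f.1 != finset.set0 ->
  [/\ rot f *m proj f.1 = proj f.1 *m rot f, (1%:M - proj f.1) *m rot f = 1%:M - proj f.1 &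
  f.2 -> one f.1 *m rot f = Num.sqrt #|f.1|%:R *: ex (axis f.1)]).
Proof. by rewrite /rot; case: cid. Qed.

Lemma rot_tr f : rot f *m (rot f)^T = 1%:M.
Proof. by have [[]] := rotP f. Qed.

Definition fdim f : {set 'I_n} := if f.2 then f.1 :\ axis f.1 else f.1.
(** Its product with [g] is [lam], the multiplier of the sum constraint: the mean of [g] over the
    active coordinates, or 0 when the constraint is slack. *)
Definition fmean f : 'rV[R]_n := if f.2 then (#|f.1|%:R)^-1 *: one f.1 else 0.
Definition lsF f : seq 'rV[R]_n :=
  [seq l *m rot f | l <- (if f.2 then [::] else [:: - one f.1]) ++
    [seq sg i *: ex i | i <- enum (f.1 :\: Kh)]].
Definition lsH f : seq 'rV[R]_n :=
  [seq l *m rot f | l <- - fmean f :: [seq sg i *: (ex i - fmean f) | i <- enum (~: f.1)]].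
(** The coordinates in [Kh] are unconstrained, so no face forces them to vanish; an empty set of
    free coordinates would leave only the vertex. *)
Definition valid f := (Kh \subset f.1) && (f.1 != finset.set0).
Definition on_face f g := posl (lsF f) (g *m rot f *m proj (fdim f)) && negl (lsH f) (g *m rot f).
Definition face_pt f g : 'rV[R]_n := g *m rot f *m proj (fdim f) *m (rot f)^T.
Definition lam f g : R := dot (fmean f) g.

Lemma rot_trC f : (rot f)^T *m rot f = 1%:M.
Proof. by apply: mulmx1C; exact: rot_tr. Qed.

Lemma ex_notin_proj I i : i \notin I -> ex i *m proj I = 0.
Proof.
move=> iI; apply/matrixP => a b; rewrite mul_projE !mxE ord1 eqxx /=.
by case: ifP => // bI; case: eqP => // bi; move: iI; rewrite -bi bI.
Qed.

Lemma ex_notin_rot f i : valid f -> i \notin f.1 -> ex i *m rot f = ex i.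
Proof.
move=> /andP[_ f0] iI; have [_ /(_ f0)[_ h _]] := rotP f.
have e : ex i *m (1%:M - proj f.1) = ex i by rewrite mulmxBr mulmx1 ex_notin_proj// subr0.
by rewrite -{1}e -mulmxA h.
Qed.

Lemma proj_setD1 I i : i \in I -> proj (I :\ i) = proj I - (ex i)^T *m ex i :> 'M[R]_n.
Proof.
move=> iI; apply/matrixP => a b; rewrite !mxE big_ord1 !mxE eqxx /= !in_setD1.
have [<-|ab] := eqVneq a b; rewrite ?mulr0n ?mulr1n.
  by have [->|ai] := eqVneq a i; rewrite ?iI/= ?mulr1 ?subrr ?mul0r ?subr0.
rewrite sub0r; have [ai|_] := eqVneq a i; last by rewrite mul0r oppr0.
have [bi|_] := eqVneq b i; last by rewrite mulr0 oppr0.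
by move: ab; rewrite ai bi eqxx.
Qed.

Lemma lsH_proj f l : valid f -> l \in lsH f -> l *m proj (fdim f) = 0.
Proof.
move=> vf /mapP[l' l'H ->].
have /andP[_ f0] := vf.
have [_ /(_ f0)[h1 _ h3]] := rotP f.
have sub i : i \notin f.1 -> ex i *m rot f *m proj (fdim f) = 0.
  move=> iI; rewrite ex_notin_rot// ex_notin_proj//.
  by rewrite /fdim; case: ifP => // _; rewrite in_setD1 (negbTE iI) andbF.
have mean0 : fmean f *m rot f *m proj (fdim f) = 0.
  move: h3; rewrite /fmean /fdim; case: f.2; last by rewrite !mul0mx.
  move=> /(_ isT) h; rewrite -scalemxAl h -!scalemxAl ex_notin_proj ?scaler0//.
  by rewrite in_setD1 eqxx.
move: l'H; rewrite inE => /orP[/eqP ->|/mapP[i]].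
  by rewrite !mulNmx mean0 oppr0.
rewrite mem_enum finset.in_setC => iI ->.
by rewrite -!scalemxAl !mulmxBl mean0 sub// subr0 scaler0.
Qed.

(** The orthogonal projection on the span of the face, back in the original coordinates: restrict to
    the free coordinates and, when the sum constraint is active, subtract their mean. *)
Lemma face_ptE f g : valid f -> face_pt f g = g *m proj f.1 - lam f g *: one f.1.
Proof.
move=> vf; have /andP[_ f0] := vf.
have [_ /(_ f0)[h1 _ h3]] := rotP f.
have cardn0 : 0 < (#|f.1|%:R : R) by rewrite ltr0n card_gt0.
rewrite /face_pt /lam /fmean /fdim; move: h3; case: f.2; last first.
  by move=> _; rewrite dot0l scale0r subr0 -(mulmxA g) h1 mulmxA -(mulmxA _ (rot f)) rot_tr mulmx1.
move=> /(_ isT) h3; rewrite proj_setD1 ?axis_in// mulmxBr mulmxBl; congr (_ - _).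
  by rewrite -(mulmxA g) h1 mulmxA -(mulmxA _ (rot f)) rot_tr mulmx1.
have e1 : ex (axis f.1) *m (rot f)^T = (Num.sqrt #|f.1|%:R)^-1 *: one f.1.
  have -> : ex (axis f.1) = (Num.sqrt #|f.1|%:R)^-1 *: (one f.1 *m rot f).
    by rewrite h3 scalerA mulVf ?scale1r// gt_eqF// sqrtr_gt0.
  by rewrite -scalemxAl -mulmxA rot_tr mulmx1.
have e2 : rot f *m (ex (axis f.1))^T = (Num.sqrt #|f.1|%:R)^-1 *: (one f.1)^T.
  by rewrite -[LHS]trmxK trmx_mul trmxK e1 linearZ.
have -> : g *m rot f *m ((ex (axis f.1))^T *m ex (axis f.1)) *m (rot f)^T =
  g *m (rot f *m (ex (axis f.1))^T) *m (ex (axis f.1) *m (rot f)^T) by rewrite !mulmxA.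
rewrite e1 e2 -!scalemxAr -!scalemxAl !scalerA -invfM -expr2 sqr_sqrtr ?ltW//.
rewrite dotZl -scalerA; congr (_ *: _).
apply/matrixP => i j; rewrite !mxE big_ord1 ord1 dotC dotE; congr (_ * _).
by rewrite !mxE.
Qed.

Lemma dot_rot f g y : dot (g *m rot f) (y *m rot f) = dot g y.
Proof. by rewrite dot_orth// rot_tr. Qed.

Lemma dot_face_pt f g : dot (face_pt f g) (face_pt f g) =
  dot (g *m rot f *m proj (fdim f)) (g *m rot f *m proj (fdim f)).
Proof. by rewrite /face_pt dot_orth// trmxK rot_trC. Qed.

Lemma face_pt_rot f g : face_pt f g *m rot f = g *m rot f *m proj (fdim f).
Proof. by rewrite /face_pt -mulmxA rot_trC mulmx1. Qed.

(** The Karush-Kuhn-Tucker conditions without the rotation: strict primal constraints on the face, a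
    nonnegative multiplier, and dual inequalities at the coordinates forced to 0. *)
Lemma on_faceP f g (y := face_pt f g) : reflect
  [/\ y != 0, f.2 || (\sum_(i in f.1) y 0 i < 0),
   (forall i, i \in f.1 -> i \notin Kh -> 0 < sg i * y 0 i), 0 <= lam f g &
   (forall i, i \notin f.1 -> sg i * (g 0 i - lam f g) <= 0)] (on_face f g).
Proof.
rewrite /on_face /posl /negl -face_pt_rot -/y.
have -> : (y *m rot f != 0) = (y != 0) by rewrite !neq0_dot dot_rot.
rewrite !all_map all_cat /= !all_map.
have a1 : all (preim (mulmx^~ (rot f)) (fun l => 0 < dot l (y *m rot f)))
  (if f.2 then [::] else [:: - one f.1]) = f.2 || (\sum_(i in f.1) y 0 i < 0).
  case: f.2 => //=; rewrite andbT dot_rot dotNl dot_one oppr_gt0//.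
rewrite a1 dot_rot dotNl oppr_le0 -/(lam f g).
apply: (iffP idP) => [/andP[/andP[y0 /andP[s /allP p]] /andP[l /allP q]]|[y0 s p l q]].
  split=> // i iI; [move=> iK|].
    by have := p i; rewrite mem_enum finset.in_setD iK iI /= dot_rot dotZl dot_ex; apply.
  have := q i; rewrite mem_enum finset.in_setC iI /= dot_rot dotZl dotDl dotNl dot_ex; exact.
rewrite y0 s l /=; apply/andP; split; apply/allP => i; rewrite mem_enum.
  by rewrite finset.in_setD => /andP[iK iI]; rewrite /= dot_rot dotZl dot_ex p.
by rewrite finset.in_setC => iI; rewrite /= dot_rot dotZl dotDl dotNl dot_ex q.
Qed.

End Faces.

(** * Projection on the descent cone *)

Section ConeProjection.
Context {R : realType}.
Variables (n : nat) (Kh KL : {set 'I_n}) (idef : 'I_n).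
Implicit Types (I : {set 'I_n}) (d g y : 'rV[R]_n) (f : {set 'I_n} * bool).
Local Notation sg := (@sg R n KL).
Local Notation descent_cone := (@descent_cone R n Kh KL).
Local Notation valid := (valid Kh).
Local Notation on_face := (@on_face R n Kh KL idef).
Local Notation face_pt := (@face_pt R n idef).

(** Moreau's characterisation of the nearest point: the residual is orthogonal to [y] and lies in
    the polar cone. *)
Definition cone_proj g y : Prop :=
  [/\ descent_cone y, dot (g - y) y = 0 & forall d, descent_cone d -> dot (g - y) d <= 0].

Lemma dotBl d y g : dot (d - y) g = dot d g - dot y g.
Proof. by rewrite dotDl dotNl. Qed.

Lemma dotBr d y g : dot d (y - g) = dot d y - dot d g.
Proof. by rewrite dotC dotBl !(dotC d). Qed.

Lemma cone_proj_inj g y1 y2 : cone_proj g y1 -> cone_proj g y2 -> y1 = y2.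
Proof.
move=> [c1 e1 h1] [c2 e2 h2].
have := h1 _ c2; have := h2 _ c1; rewrite dotBl => k1; rewrite dotBl => k2.
rewrite dotBl in e1; rewrite dotBl in e2.
have [/eqP|/dot_gt0] := eqVneq (y1 - y2) 0; first by rewrite subr_eq0 => /eqP.
rewrite dotBl !dotBr (dotC y1 y2) => h; exfalso; move: h.
by apply/negP; rewrite -leNgt; move: k1 k2 e1 e2; rewrite (dotC y1 y2); lra.
Qed.

Lemma sgK i : sg i * sg i = 1.
Proof. by rewrite /sg; case: ifP => _; rewrite ?mulrNN mulr1. Qed.

Lemma sg_neq0 i : sg i != 0.
Proof. by rewrite /sg; case: ifP => _; rewrite ?oppr_eq0 oner_neq0. Qed.

Lemma sum_supp I d : (forall i, i \notin I -> d 0 i = 0) -> \sum_i d 0 i = \sum_(i in I) d 0 i.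
Proof.
move=> h; rewrite [RHS]big_mkcond; apply: eq_bigr => i _.
by case: ifP => // iI; rewrite h// iI.
Qed.

(** The conditions of [on_faceP] are sufficient for optimality. The last two equations recover [f]
    from [y], so that, projections being unique, distinct faces carry disjoint events. *)
Lemma on_face_proj f g (y := face_pt f g) : valid f -> on_face f g ->
  [/\ cone_proj g y, y != 0, f.1 = Kh :|: [set i | y 0 i != 0]%SET & f.2 = (\sum_i y 0 i == 0)].
Proof.
move=> vf /on_faceP; rewrite -/y => -[y0 s p l q].
have /andP[KI f0] := vf.
have cardn0 : (#|f.1|%:R : R) != 0 by rewrite pnatr_eq0 cards_eq0.
have yin i : i \in f.1 -> y 0 i = g 0 i - lam f g.
  by move=> iI; rewrite /y (face_ptE _ _ vf)// mxE mul_projE iI !mxE iI mulr1.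
have yout i : i \notin f.1 -> y 0 i = 0.
  by move=> iI; rewrite /y (face_ptE _ _ vf)// mxE mul_projE (negbTE iI) !mxE (negbTE iI) mulr0 subr0.
clearbody y; have ssum := sum_supp yout.
have sum0 : f.2 -> \sum_i y 0 i = 0.
  move=> f2; rewrite ssum (eq_bigr (fun i => g 0 i - lam f g))//.
  rewrite big_split /= -dot_one sumr_const mulNrn -mulr_natl /lam /fmean f2 dotZl.
  by rewrite mulVKf// subrr.
have lam0 : ~~ f.2 -> lam f g = 0.
  by move=> /negbTE f2; rewrite /lam /fmean f2 dot0l.
have lamsum : lam f g * \sum_i y 0 i = 0.
  by case f2 : f.2; [rewrite sum0 ?f2// mulr0|rewrite lam0 ?f2// mul0r].
(* The residual is [lam f g] times the all-ones vector plus a vector supported off [f.1]; each part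
   has a sign against the cone. *)
have r_dot d : dot (g - y) d = lam f g * \sum_i d 0 i + \sum_(i | i \notin f.1) (g 0 i - lam f g) * d 0 i.
  rewrite mulr_sumr [X in _ = _ + X]big_mkcond -big_split; apply: eq_bigr => i _ /=.
  rewrite !mxE; case: (boolP (i \in f.1)) => iI /=; first by rewrite yin//; ring.
  by rewrite yout//; ring.
split => //.
- split.
  + split; last first.
      by case/orP: s => [/sum0 ->//|]; rewrite -ssum => /ltW.
    move=> i iK; have [iI|iI] := boolP (i \in f.1); first by rewrite ltW// p.
    by rewrite yout// mulr0.
  + rewrite r_dot lamsum add0r big1// => i iI.
    by rewrite yout// mulr0.
  + move=> d [d1 d2]; rewrite r_dot.
    have : \sum_(i | i \notin f.1) (g 0 i - lam f g) * d 0 i <= 0.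
      apply: sumr_le0 => i iI.
      have iK : i \notin Kh by apply: contra iI; exact: (fintype.subsetP KI).
      rewrite -[X in X <= _]mul1r -(sgK i) mulrACA.
      by rewrite mulr_le0_ge0 ?q ?d1.
    have := mulr_ge0_le0 l d2; lra.
- apply/setP => i; rewrite finset.in_setU finset.inE.
  apply/idP/idP => [iI|/orP[iK|]].
  + have [//|iK /=] := boolP (i \in Kh).
    by have := p _ iI iK; apply: contraTneq => ->; rewrite mulr0 ltxx.
  + exact: (fintype.subsetP KI).
  + by apply: contraNT => /yout ->.
- case f2 : f.2; first by rewrite sum0 ?f2// eqxx.
  by move: s; rewrite f2 /= -ssum => /lt_eqF.
Qed.

Lemma on_face_inj f f' g : valid f -> valid f' -> on_face f g -> on_face f' g -> f = f'.
Proof.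
move=> vf vf' /(on_face_proj vf)[p1 _ a1 b1] /(on_face_proj vf')[p2 _ a2 b2].
case: f f' {vf vf'} p1 a1 b1 p2 a2 b2 => I b [I' b'] /= p1 a1 b1 p2 a2 b2.
have e := cone_proj_inj p1 p2; rewrite -e in a2 b2.
by move: (face_pt _ _) a1 b1 a2 b2 => y -> -> -> ->.
Qed.

Lemma ex_min (T : finType) (A : {set T}) (t : T -> R) : (forall i, i \in A -> 0 < t i) ->
  exists2 e, 0 < e & forall i, i \in A -> e <= t i.
Proof.
move=> h; exists (\big[Order.min/1]_(i in A) t i).
  by apply: lt_bigmin => // i; exact: h.
by move=> i iA; exact: bigmin_le_cond.
Qed.

(** Necessity of the same conditions: [y] is perturbed along test directions that stay in the cone,
    and the residual has a nonpositive product with each of them. *)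
Lemma proj_on_face g y : cone_proj g y -> y != 0 ->
  exists f, [/\ valid f, on_face f g & face_pt f g = y].
Proof.
move=> [[yC1 yC2] ry rC] y0.
pose I := Kh :|: [set i | y 0 i != 0]%SET.
have yout i : i \notin I -> y 0 i = 0.
  by rewrite finset.in_setU finset.inE negb_or negbK => /andP[_ /eqP].
have I0 : I != finset.set0.
  apply: contraNneq y0 => IE; apply/eqP/matrixP => a i; rewrite ord1 mxE yout// IE.
  by rewrite finset.inE.
pose r := g - y.
pose f := (I, \sum_i y 0 i == 0).
have vf : valid f by rewrite /valid I0 andbT finset.subsetUl.
have ypos i : i \in I -> i \notin Kh -> 0 < sg i * y 0 i.
  rewrite finset.in_setU finset.inE => /orP[->//|yi iK].
  by rewrite lt_neqAle yC1// andbT eq_sym mulf_neq0// sg_neq0.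
pose t i : R := if i \in Kh then 1 else sg i * y 0 i.
have [e1 e10 e1t] : exists2 e, 0 < e & forall i, i \in I -> e <= t i.
  by apply: ex_min => i iI; rewrite /t; case: ifP => // iK; rewrite ypos// iK.
pose e := if \sum_i y 0 i == 0 then e1 else Num.min e1 (- \sum_i y 0 i).
have e0 : 0 < e.
  rewrite /e; case: ifP => // s0; rewrite lt_min e10 oppr_gt0 lt_neqAle s0 //.
have et i : i \in I -> e <= t i.
  move=> iI; apply: le_trans (e1t i iI); rewrite /e; case: ifP => // _.
  by rewrite ge_min lexx.
have test (v : 'rV[R]_n) : (forall i, i \in I -> `|v 0 i| <= 1) -> (forall i, i \notin I -> 0 <= sg i * v 0 i) ->
    \sum_i v 0 i <= (\sum_i y 0 i != 0)%:R -> dot r v <= 0.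
  move=> v1 v2 v3; have : descent_cone (y + e *: v).
    split=> [i iK|].
      rewrite !mxE mulrDr; have [iI|iI] := boolP (i \in I); last first.
        by rewrite yout// mulr0 add0r mulrCA mulr_ge0 ?v2// ltW.
      have := et i iI; rewrite /t (negbTE iK) => ei.
      have : `|sg i * (e * v 0 i)| <= e.
        rewrite normrM normrM (gtr0_norm e0) (_ : `|sg i| = 1) ?mul1r; last first.
          by rewrite /sg; case: ifP => _; rewrite ?normrN normr1.
        by rewrite ler_piMr ?v1// ltW.
      rewrite ler_norml => /andP[h _]; lra.
    under eq_bigr do rewrite !mxE.
    rewrite big_split /= -mulr_sumr.
    have h := ler_wpM2l (ltW e0) v3.
    move: h; rewrite /e; case: ifP => [/eqP -> /=|s0 /=]; first by rewrite mulr0 add0r.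
    rewrite mulr1 => h.
    have : Num.min e1 (- (\sum_i y 0 i)) <= - (\sum_i y 0 i) by rewrite ge_min lexx orbT.
    lra.
  move=> /rC; rewrite dotDr ry add0r dotZr pmulr_rle0//.
have rex c i : dot r (c *: ex i) = c * r 0 i by rewrite dotZr dotC dot_ex.
have exE c i j : (c *: ex i : 'rV[R]_n) 0 j = if j == i then c else 0.
  by rewrite !mxE eqxx /=; case: eqP; rewrite ?mulr1 ?mulr0.
have sum_ex c i : \sum_j (c *: ex i : 'rV[R]_n) 0 j = c.
  rewrite (bigD1 i)//= exE eqxx big1 ?addr0// => j ji.
  by rewrite exE (negbTE ji).
have norm_sg i : `|sg i| = 1 by rewrite /sg; case: ifP => _; rewrite ?normrN normr1.
have sg_le1 i : sg i <= 1 by rewrite (le_trans (ler_norm _))// norm_sg.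
(* [c] is the multiplier of the sum constraint. If that constraint is slack, both signs of [ex i]
   are admissible and force 0. If it is active, the differences [ex i - ex j] make the residual
   constant on [I], and [- ex i0] gives its sign. *)
have [c [c0 rc rout cs]] : exists c, [/\ 0 <= c, forall i, i \in I -> r 0 i = c,
    forall i, i \notin I -> sg i * (r 0 i - c) <= 0 & \sum_i y 0 i != 0 -> c = 0].
  have [s0|s0] := eqVneq (\sum_i y 0 i) 0; last first.
    exists 0; split=> //.
    - move=> i iI.
      have h1 : dot r (1 *: ex i) <= 0.
        apply: test => [j jI|j jI|]; rewrite ?sum_ex ?s0// exE; case: ifP => //.
        + by rewrite normr1.
        + by rewrite normr0.
        + by move/eqP => ji; move: jI; rewrite ji iI.
        + by rewrite mulr0.
      have h2 : dot r (- 1 *: ex i) <= 0.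
        apply: test => [j jI|j jI|]; rewrite ?sum_ex ?s0 ?lerN10// ?exE; [case: ifP|case: ifP|].
        + by rewrite normrN normr1.
        + by rewrite normr0.
        + by move/eqP => ji; move: jI; rewrite ji iI.
        + by rewrite mulr0.
        + by rewrite /=; lra.
      by move: h1 h2; rewrite !rex; lra.
    - move=> i iI; rewrite subr0 -rex; apply: test => [j jI|j jI|]; rewrite ?sum_ex ?s0// exE.
      + by case: eqP => [ji|]; [move: iI; rewrite -ji jI|rewrite normr0].
      + by case: eqP => [->|]; rewrite ?sgK ?mulr0.
  have [i0 i0I] := set0Pn _ I0.
  have sub v j : v - ex j = v + (- 1 : R) *: ex j :> 'rV[R]_n by rewrite scaleN1r.
  have sumB (v w : 'rV[R]_n) : \sum_j (v + w) 0 j = \sum_j v 0 j + \sum_j w 0 j.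
    by rewrite -big_split; apply: eq_bigr => j _; rewrite mxE.
  have rle i j : i \in I -> j \in I -> r 0 i <= r 0 j.
    move=> iI jI; have : dot r (1 *: ex i + (- 1) *: ex j) <= 0.
      apply: test => [k kI|k kI|].
      - rewrite mxE !exE; case: eqP; case: eqP => _ _; rewrite ?subrr ?addr0 ?add0r ?normr0 ?normrN ?normr1//.
      - rewrite mxE !exE; case: eqP => [ki|_]; first by move: kI; rewrite ki iI.
        case: eqP => [kj|_]; first by move: kI; rewrite kj jI.
        by rewrite addr0 mulr0.
      - by rewrite sumB !sum_ex s0 eqxx subrr.
    rewrite dotDr !rex; lra.
  have rE i : i \in I -> r 0 i = r 0 i0.
    by move=> iI; apply/eqP; rewrite eq_le !rle.
  exists (r 0 i0); split=> //.
  - have : dot r (- 1 *: ex i0) <= 0.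
      apply: test => [k kI|k kI|]; rewrite ?sum_ex ?s0 ?eqxx ?lerN10// exE; case: eqP => [ki|_].
      + by rewrite normrN normr1.
      + by rewrite normr0.
      + by move: kI; rewrite ki i0I.
      + by rewrite mulr0.
    by rewrite rex; lra.
  - move=> i iI; have : dot r (sg i *: ex i + (- sg i) *: ex i0) <= 0.
      apply: test => [k kI|k kI|].
      + rewrite mxE !exE; case: eqP => [ki|_]; first by move: iI; rewrite -ki kI.
        by rewrite add0r; case: eqP; rewrite ?normrN ?norm_sg ?normr0.
      + rewrite mxE !exE; case: (k =P i0) => [ki|_]; first by move: kI; rewrite ki i0I.
        by rewrite addr0; case: eqP => [->|]; rewrite ?sgK ?mulr0.
      + by rewrite sumB !sum_ex s0 eqxx subrr.
    by rewrite dotDr !rex; lra.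
have cardn0 : (#|I|%:R : R) != 0 by rewrite pnatr_eq0 cards_eq0.
have gE i : g 0 i = r 0 i + y 0 i by rewrite !mxE subrK.
have lamE : lam f g = c.
  rewrite /lam /fmean /=; case: (eqVneq (\sum_i y 0 i) 0) => [s0|s0]; last by rewrite dot0l cs.
  rewrite dotZl dot_one (eq_bigr (fun i => c + y 0 i)); last by move=> i iI; rewrite gE rc.
  by rewrite big_split /= -(sum_supp yout) s0 addr0 sumr_const -(mulr_natl c) mulKf.
have yE : face_pt f g = y.
  rewrite (face_ptE _ _ vf)// lamE; apply/matrixP => a i; rewrite ord1 mxE mul_projE [in X in _ + X = _]mxE [in X in _ + X = _]mxE [in X in _ + X = _]mxE /=.
  case: ifP => iI; first by rewrite gE rc// mulr1 addrAC subrr add0r.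
  by rewrite mulr0 subr0 yout// iI.
exists f; split=> //; apply/on_faceP; rewrite yE lamE; split=> //.
- rewrite /= -(sum_supp yout); have [//|s0] := eqVneq (\sum_i y 0 i) 0.
  by rewrite lt_neqAle s0.
- by move=> i iI; rewrite gE yout// addr0 rout.
Qed.

(** The vector [c] of the proof is [g] minus its nearest point v in the given subset of the polar
    cone. As <y, v> <= 0, |y|^2 = <y, g> <= <y, c>, and the Cauchy-Schwarz inequality concludes. *)
Lemma cone_proj_le (tau : R) g y : 0 <= tau -> cone_proj g y ->
  dot y y <= \sum_i (if i \in Kh then (g 0 i - tau) ^+ 2
    else if i \in KL then dm tau (g 0 i) else dp tau (g 0 i)).
Proof.
move=> t0 [[y1 y2] e _].
pose c : 'rV[R]_n := \row_i (if i \in Kh then g 0 i - tau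
  else if i \in KL then - Num.max 0 (tau - g 0 i) else Num.max 0 (g 0 i - tau)).
have cc : dot c c = \sum_i (if i \in Kh then (g 0 i - tau) ^+ 2
    else if i \in KL then dm tau (g 0 i) else dp tau (g 0 i)).
  apply: eq_bigr => i _; rewrite mxE -expr2 /dm /dp.
  by case: ifP => // _; case: ifP => // _; rewrite sqrrN.
rewrite -cc.
have cy : dot y y <= dot y c.
  have -> : dot y y = dot y g by move: e; rewrite dotBl (dotC g); lra.
  have : dot y g - tau * \sum_i y 0 i <= dot y c.
    rewrite mulr_sumr -sumrB; apply: ler_sum => i _; rewrite mxE.
    have -> : y 0 i * g 0 i - tau * y 0 i = y 0 i * (g 0 i - tau) by ring.
    case: ifP => // iK; have := y1 i (negbT iK); rewrite /sg.
    case: ifP => _; rewrite ?mulN1r ?mul1r => yi.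
      have h : tau - g 0 i <= Num.max 0 (tau - g 0 i) by rewrite le_max lexx orbT.
      have := ler_wpM2l yi h; lra.
    by apply: ler_wpM2l => //; rewrite le_max lexx orbT.
  have := mulr_ge0_le0 t0 y2; lra.
have [->|/dot_gt0 yy] := eqVneq y 0; first by rewrite dot0l dot_ge0.
have := cauchy_schwarz y c.
have h : dot y y ^+ 2 <= dot y c ^+ 2.
  by rewrite ler_sqr ?nnegrE ?dot_ge0// (le_trans (dot_ge0 _) cy).
by move=> /(le_trans h); rewrite expr2 ler_pM2l.
Qed.

End ConeProjection.

(** * Tail of the face probabilities *)

Section FaceSum.
Context {R : realType}.
Local Notation gam := (normal_prob (0 : R) 1).
Local Notation mgauss := (@mgauss R).
Local Notation bE := (@bE R).
Local Open Scope ereal_scope.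
Variables (n : nat) (Kh KL : {set 'I_n}) (idef : 'I_n).
Local Notation valid := (valid Kh).
Local Notation on_face := (@on_face R n Kh KL idef).
Local Notation rot := (@rot R n idef).
Local Notation fdim := (@fdim n idef).
Local Notation lsF := (@lsF R n Kh KL idef).
Local Notation lsH := (@lsH R n KL idef).

(** The product of the internal and the external solid angle of the face, that is, its share in the
    conic intrinsic volume of its dimension. *)
Definition face_prob (f : {set 'I_n} * bool) : \bar R :=
  (\int[mgauss 1 n]_h bE (posl (lsF f) (h *m proj (fdim f))%R)) *
  \int[mgauss 1 n]_h bE (negl (lsH f) h).

Lemma face_prob_ge0 f : 0 <= face_prob f.
Proof. by apply: mule_ge0; apply: integral_ge0 => h _; exact: bE_ge0. Qed.

Definition coord_sq (tau : R) (i : 'I_n) (x : R) : R :=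
  if i \in Kh then ((x - tau) ^+ 2)%R else if i \in KL then dm tau x else dp tau x.

Lemma measurable_coord_sq tau i : measurable_fun setT (coord_sq tau i).
Proof.
rewrite /coord_sq; case: (i \in Kh); last by case: (i \in KL); [exact: measurable_dm|exact: measurable_dp].
by apply: measurable_funX; exact: measurable_funB.
Qed.

Lemma exp_coord_sq_le (s tau : R) i : (0 < s)%R -> (s <= 2^-1)%R -> (0 <= tau)%R ->
  \int[gam]_x (expR (s / (2 * (1 + s)) * coord_sq tau i x))%:E <=
  (expR (s / 2 * (1 + s / 2) * (if i \in Kh then 1 + tau ^+ 2
     else if i \in KL then fine (qm tau) else fine (qp tau))))%:E.
Proof.
move=> s0 sh t0; rewrite /coord_sq; case: (i \in Kh); first exact: exp_sqr_le.
by case: (i \in KL); [exact: exp_dm_le|exact: exp_dp_le].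
Qed.

Lemma le_eprod (I : Type) (r : seq I) (a b : I -> \bar R) :
  (forall i, 0 <= a i) -> (forall i, a i <= b i) -> \prod_(i <- r) a i <= \prod_(i <- r) b i.
Proof.
move=> a0 ab; elim: r => [|i r IH]; first by rewrite !big_nil.
by rewrite !big_cons; apply: lee_pmul => //; exact: eprod_ge0.
Qed.

Lemma exp_sum_coord_sq_le (s tau : R) : (0 < s)%R -> (s <= 2^-1)%R -> (0 <= tau)%R ->
  \int[mgauss 1 n]_g (expR (s / (2 * (1 + s)) * \sum_i coord_sq tau i (g ord0 i)))%:E <=
  (expR (s / 2 * (1 + s / 2) * \sum_(i < n) (if i \in Kh then 1 + tau ^+ 2
     else if i \in KL then fine (qm tau) else fine (qp tau))))%:E.
Proof.
move=> s0 sh t0; set eta := (s / (2 * _))%R.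
pose h i x : \bar R := (expR (eta * coord_sq tau i x))%:E.
have mh i : measurable_fun setT (h i).
  apply/measurable_EFinP; apply: measurableT_comp => //; apply: measurable_funM => //.
  exact: measurable_coord_sq.
have h0 i x : 0 <= h i x by rewrite lee_fin expR_ge0.
apply: (@le_trans _ _ (\prod_i \int[gam]_x h i x)).
  rewrite le_eqVlt; apply/orP; left; apply/eqP.
  apply: etrans (mgauss_coords mh h0); apply: eq_integral => g _.
  by rewrite /h prodEFin -expR_sum mulr_sumr.
rewrite mulr_sumr expR_sum -prodEFin; apply: le_eprod => i.
  by apply: integral_ge0 => x _.
exact: exp_coord_sq_le.
Qed.

Lemma face_prob_sum_le m (s tau : R) : (0 < s)%R -> (s <= 2^-1)%R -> (0 <= tau)%R ->
  \sum_(f : {set 'I_n} * bool | valid f && (m < #|fdim f|)%N) face_prob f <=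
  ((Num.sqrt (1 + s) ^+ m.+1)^-1 * expR (s / 2 * (1 + s / 2) * \sum_(i < n) (if i \in Kh then 1 + tau ^+ 2
     else if i \in KL then fine (qm tau) else fine (qp tau))))%:E.
Proof.
move=> s0 sh t0; set z := Num.sqrt (1 + s); set eta := (s / (2 * (1 + s)))%R.
have z1 : (1 <= z)%R by rewrite -sqrtr1 ler_sqrt ?ltW ?addr_gt0//; lra.
have zm : (0 < z ^+ m.+1)%R by rewrite exprn_gt0// (lt_le_trans ltr01 z1).
rewrite EFinM lee_pdivlMl//.
pose w f h : \bar R := bE (posl (lsF f) (h *m proj (fdim f))%R && negl (lsH f) h) *
     (expR (eta * dot (h *m proj (fdim f))%R (h *m proj (fdim f))%R))%:E.
have mw f : measurable_fun setT (w f : mxm R 1 n -> \bar R).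
  have mP : measurable_fun setT (fun h : mxm R 1 n => (h *m proj (fdim f))%R : mxm R 1 n).
    exact: (measurable_mulmxr _ (@measurable_id _ _ setT)).
  apply: emeasurable_funM.
    apply: (@measurable_bE R _ _ _); apply: measurable_and; last exact: measurable_negl.
    exact: (measurableT_comp (@measurable_posl R n _) mP).
  apply/measurable_EFinP; apply: measurableT_comp => //; apply: measurable_funM => //.
  exact: measurable_dot.
have w0 f h : 0 <= w f h by rewrite mule_ge0 ?bE_ge0// lee_fin expR_ge0.
pose v f (g : mxm R 1 n) : \bar R := if valid f && (m < #|fdim f|)%N then w f (g *m rot f)%R else 0.
have mv f : measurable_fun setT (v f).
  rewrite /v; case: (valid f && (m < #|fdim f|)%N); last exact: measurable_cst.
  exact: (measurableT_comp (mw f) (measurable_mulmxr _ (@measurable_id _ _ setT))).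
have v0 f g : 0 <= v f g by rewrite /v; case: ifP.
(* As z >= 1 and the faces have dimension at least m + 1, the weight may be raised to the one in
   [face_weight]; invariance under [rot f] then brings all faces back to the same [g]. *)
have e1 : (z ^+ m.+1)%:E * \sum_(f : {set 'I_n} * bool | valid f && (m < #|fdim f|)%N) face_prob f <=
    \sum_(f : {set 'I_n} * bool) \int[mgauss 1 n]_g v f g.
  rewrite ge0_sume_distrr; last by move=> f _; exact: face_prob_ge0.
  rewrite big_mkcond; apply: lee_sum => f _.
  case: ifP => [/andP[vf mf]|_]; last by apply: integral_ge0 => g _.
  have fw := face_weight s0 (lsF f) (fun l => @lsH_proj R n Kh KL idef f l vf).
  apply: (@le_trans _ _ ((z ^+ #|fdim f|)%:E * face_prob f)).
    apply: lee_wpmul2r; first exact: face_prob_ge0.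
    by rewrite lee_fin ler_weXn2l.
  rewrite le_eqVlt; apply/orP; left; apply/eqP; apply: (etrans fw).
  have [[_ h] _] := @rotP R n idef f.
  apply: (etrans (esym (h 1%N (w f) (mw f) (w0 f)))).
  by apply: eq_integral => g _; rewrite /v vf mf.
apply: (le_trans e1).
have e2 := ge0_integral_sum (mgauss 1 n) measurableT mv (fun f g _ => v0 f g) (index_enum _).
rewrite -e2.
apply: le_trans (exp_sum_coord_sq_le s0 sh t0).
have mr : measurable_fun setT (fun g : mxm R 1 n => (expR (eta * \sum_i coord_sq tau i (g ord0 i)))%:E : \bar R).
  apply/measurable_EFinP; apply: measurableT_comp => //; apply: measurable_funM => //.
  apply: measurable_sum => i; apply: (measurableT_comp (measurable_coord_sq tau i)).
  exact: measurable_mxE.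
apply: ge0_le_integral => //.
- by move=> g _; apply: sume_ge0 => f _.
- exact: emeasurable_sum.
move=> g _.
have eta0 : (0 <= eta)%R by rewrite divr_ge0 ?mulr_ge0 ?addr_ge0// ltW.
(* At most one face carries [g], so the sum of the weights has at most one nonzero term. *)
have [f /andP[vf nf]|nof] := pickP (fun f => valid f && on_face f g).
  rewrite (bigD1 f)//= big1 ?adde0; last first.
    move=> f' ff'; rewrite /v; case: ifP => // /andP[vf' _].
    rewrite /w -/(on_face f' g); have [nf'|_] := boolP (on_face f' g); last by rewrite /bE mul0e.
    by move: ff'; rewrite (on_face_inj vf vf' nf nf') eqxx.
  have [cp _ _ _] := on_face_proj vf nf.
  rewrite /v vf /=; case: ifP => _; last by rewrite lee_fin expR_ge0.
  rewrite /w -/(on_face f g) nf /bE mul1e lee_fin ler_expR ler_wpM2l//.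
  rewrite -(dot_face_pt idef f g); exact: cone_proj_le cp.
rewrite big1 ?lee_fin ?expR_ge0// => f _; rewrite /v; case: ifP => // /andP[vf' _].
by rewrite /w -/(on_face f g); have := nof f; rewrite vf' /= => ->; rewrite /bE mul0e.
Qed.

End FaceSum.

(** * Minimisers of the penalised objective over the cone *)

Section RidgeMinimizer.
Context {R : realType}.
Variables (n m : nat) (Kh KL : {set 'I_n}) (A : 'M[R]_(m, n)) (g : 'rV[R]_n) (kappa : R).
Local Notation descent_cone := (@descent_cone R n Kh KL).
Local Notation cone_proj := (@cone_proj R n Kh KL).

Lemma descent_coneZ c d : 0 <= c -> descent_cone d -> descent_cone (c *: d).
Proof.
move=> c0 [d1 d2]; split=> [i iK|]; first by rewrite mxE mulrCA mulr_ge0// d1.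
by under eq_bigr do rewrite mxE; rewrite -mulr_sumr mulr_ge0_le0.
Qed.

Lemma descent_coneD d d' : descent_cone d -> descent_cone d' -> descent_cone (d + d').
Proof.
move=> [d1 d2] [d1' d2']; split=> [i iK|]; first by rewrite mxE mulrDr addr_ge0 ?d1 ?d1'.
under eq_bigr do rewrite mxE.
by rewrite big_split /= -oppr_ge0 opprD addr_ge0 ?oppr_ge0.
Qed.

Lemma descent_cone0 : descent_cone 0.
Proof. by split=> [i _|]; [rewrite mxE mulr0|rewrite big1// => i _; rewrite mxE]. Qed.

Lemma continuous_sum (T : topologicalType) (I : Type) (r : seq I) (F : I -> T -> R) :
  (forall i, continuous (F i)) -> continuous (fun x => \sum_(i <- r) F i x).
Proof.
move=> cF; elim: r => [|i r IH] x.
  by rewrite (_ : (fun _ => _) = fun=> 0); [exact: cvg_cst|apply/funext => y; rewrite big_nil].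
rewrite (_ : (fun _ => _) = fun y => F i y + \sum_(j <- r) F j y); last first.
  by apply/funext => y; rewrite big_cons.
by apply: cvgD; [exact: cF|exact: IH].
Qed.

Lemma continuous_add (T : topologicalType) (f h : T -> R) :
  continuous f -> continuous h -> continuous (fun x => f x + h x).
Proof. by move=> cf ch x; apply: cvgD; [exact: cf|exact: ch]. Qed.

Lemma continuous_mul (T : topologicalType) (f h : T -> R) :
  continuous f -> continuous h -> continuous (fun x => f x * h x).
Proof. by move=> cf ch x; apply: cvgM; [exact: cf|exact: ch]. Qed.

Lemma continuous_opp (T : topologicalType) (f : T -> R) :
  continuous f -> continuous (fun x => - f x).
Proof. by move=> cf x; apply: cvgN; exact: cf. Qed.

Lemma closed_ge0 (f : 'rV[R]_n -> R) : continuous f -> closed [set x | 0 <= f x].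
Proof.
move=> cf; rewrite (_ : [set x | _] = f @^-1` [set y | 0 <= y])//.
by apply: preimage_closed; [move=> x _; exact: cf|exact: closed_ge].
Qed.

Lemma closed_descent_cone : closed [set d : 'rV[R]_n | descent_cone d].
Proof.
have cc i : continuous (fun x : 'rV[R]_n => x 0 i) by exact: coord_continuous.
rewrite (_ : [set d : 'rV[R]_n | _] = [set d : 'rV[R]_n | 0 <= - \sum_i d 0 i] `&`
  \bigcap_(i in [set i | i \notin Kh]) [set d : 'rV[R]_n | 0 <= sg KL i * d 0 i]); last first.
  apply/seteqP; split=> d /= [d1 d2]; first by split; [rewrite oppr_ge0|move=> i iK; exact: d1].
  by split; [exact: d2|rewrite -oppr_ge0].
apply: closedI.
  apply: closed_ge0; apply: continuous_opp.
  exact: (@continuous_sum _ _ _ (fun i (x : 'rV[R]_n) => x 0 i) cc).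
apply: closed_bigI => i _; apply: closed_ge0.
by apply: continuous_mul; [exact: cst_continuous|exact: cc].
Qed.

Definition ridge_obj (x : 'rV[R]_n) : R :=
  dot (x - g) (x - g) + kappa * dot (x *m A^T) (x *m A^T).

Lemma continuous_ridge_obj : continuous ridge_obj.
Proof.
have cc i : continuous (fun x : 'rV[R]_n => x 0 i) by exact: coord_continuous.
have sq (f : 'rV[R]_n -> R) : continuous f -> continuous (fun x => f x * f x).
  by move=> cf; exact: continuous_mul.
rewrite (_ : ridge_obj = fun x => \sum_i (x 0 i - g 0 i) * (x 0 i - g 0 i) +
  kappa * \sum_k (\sum_i x 0 i * A k i) * (\sum_i x 0 i * A k i)).
  apply: continuous_add.
    apply: (@continuous_sum _ _ _ (fun i (x : 'rV[R]_n) => (x 0 i - g 0 i) * (x 0 i - g 0 i))) => i.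
    by apply: sq; apply: continuous_add; [exact: cc|exact: cst_continuous].
  apply: continuous_mul; first exact: cst_continuous.
  apply: (@continuous_sum _ _ _ (fun k (x : 'rV[R]_n) => (\sum_i x 0 i * A k i) * (\sum_i x 0 i * A k i))) => k.
  apply: sq; apply: (@continuous_sum _ _ _ (fun i (x : 'rV[R]_n) => x 0 i * A k i)) => i.
  by apply: continuous_mul; [exact: cc|exact: cst_continuous].
apply/funext => x; rewrite /ridge_obj /dot; congr (_ + _ * _).
  by apply: eq_bigr => i _; rewrite !mxE.
apply: eq_bigr => k _; rewrite !mxE.
by congr (_ * _); apply: eq_bigr => i _; rewrite mxE.
Qed.

Hypothesis kappa0 : 0 <= kappa.

(** The points of the cone that do at least as well as 0 form a closed set, and the term |x - g|^2
    confines them to a compact box. *)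
Lemma ridge_obj_min : exists2 y, descent_cone y &
  forall x, descent_cone x -> ridge_obj y <= ridge_obj x.
Proof.
pose B := [set x : 'rV[R]_n | descent_cone x] `&` [set x | 0 <= ridge_obj 0 - ridge_obj x].
have closedB : closed B.
  apply: closedI; first exact: closed_descent_cone.
  apply: closed_ge0; apply: continuous_add; first exact: cst_continuous.
  by apply: continuous_opp; exact: continuous_ridge_obj.
pose M := Num.sqrt (ridge_obj 0).
have compB : compact B.
  have Mc : compact [set v : 'rV[R]_n | forall i, v ord0 i \in `[g 0 i - M, g 0 i + M]].
    apply: (@rV_compact _ _ (fun i => `[g 0 i - M, g 0 i + M]%classic)).
    by move=> i; exact: segment_compact.
  apply: subclosed_compact closedB Mc _ => v [_ /= h] i.
  have : (v 0 i - g 0 i) ^+ 2 <= ridge_obj 0.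
    apply: (@le_trans _ _ (ridge_obj v)); last by rewrite -subr_ge0.
    have : 0 <= kappa * dot (v *m A^T) (v *m A^T) by rewrite mulr_ge0// dot_ge0.
    have : (v 0 i - g 0 i) ^+ 2 <= dot (v - g) (v - g).
      rewrite /dot (bigD1 i)//= !mxE -expr2 lerDl sumr_ge0// => j _.
      by rewrite -expr2 sqr_ge0.
    by rewrite /ridge_obj; lra.
  move=> /ler_wsqrtr; rewrite sqrtr_sqr -/M ler_norml in_itv /= => /andP[a b].
  by apply/andP; split; lra.
have B0 : B !=set0 by exists 0; split; [exact: descent_cone0|rewrite /= subrr].
have [y yB ymin] := compact_EVT_min B0 compB (continuous_subspaceT continuous_ridge_obj).
move: yB; rewrite inE => -[yC y0]; exists y => // x xC.
have [x0|x0] := lerP (ridge_obj x) (ridge_obj 0).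
  by apply: ymin; rewrite inE; split => //=; rewrite subr_ge0.
by apply: le_trans (ltW x0); rewrite -subr_ge0.
Qed.

Lemma ridge_obj_shift y d t : ridge_obj (y + t *: d) = ridge_obj y
  - 2 * t * dot (g - kappa *: (y *m A^T *m A) - y) d
  + t ^+ 2 * (dot d d + kappa * dot (d *m A^T) (d *m A^T)).
Proof.
have e : dot (y *m A^T *m A) d = dot (y *m A^T) (d *m A^T).
  by rewrite !dotE trmx_mul trmxK mulmxA.
have -> : g - kappa *: (y *m A^T *m A) - y = - (y - g) + (- kappa) *: (y *m A^T *m A).
  by rewrite opprB scaleNr addrAC.
rewrite /ridge_obj mulmxDl -scalemxAl (_ : y + t *: d - g = (y - g) + t *: d); last first.
  by rewrite addrAC.
move: (y - g) => u.
rewrite !(dotDl, dotDr, dotZl, dotZr, dotNl) e (dotC d u) (dotC (d *m _) (y *m _)).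
ring.
Qed.

Lemma ridge_cone_proj y : descent_cone y ->
  (forall x, descent_cone x -> ridge_obj y <= ridge_obj x) ->
  cone_proj (g - kappa *: (y *m A^T *m A)) y.
Proof.
move=> yC ymin; set G := g - _; pose r := G - y; rewrite /cone_proj -/r.
have small (d : 'rV[R]_n) : (forall t, 0 <= t -> t <= 1 -> descent_cone (y + t *: d)) -> dot r d <= 0.
  move=> h; rewrite leNgt; apply/negP => rd.
  pose Q := dot d d + kappa * dot (d *m A^T) (d *m A^T).
  have Q0 : 0 <= Q by rewrite addr_ge0 ?mulr_ge0 ?dot_ge0.
  pose t := Num.min 1 (dot r d / (Q + 1)).
  have Q1 : 0 < Q + 1 by lra.
  have t0 : 0 < t by rewrite lt_min ltr01 divr_gt0.
  have t1 : t <= 1 by rewrite ge_min lexx.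
  have tQ : t * (Q + 1) <= dot r d by rewrite -ler_pdivlMr// ge_min lexx orbT.
  have := ymin _ (h t (ltW t0) t1); rewrite ridge_obj_shift -/r -/Q => h1.
  have h2 : t * (2 * dot r d - t * Q) <= 0 by lra.
  rewrite pmulr_rle0// in h2; lra.
have yy : dot r y = 0.
  apply/eqP; rewrite eq_le; apply/andP; split.
    by apply: small => t t0 _; apply: descent_coneD => //; exact: descent_coneZ.
  have : dot r (- y) <= 0.
    apply: small => t t0 t1; rewrite (_ : _ + _ = (1 - t) *: y).
      by apply: descent_coneZ => //; rewrite subr_ge0.
    by rewrite scalerBl scale1r scalerN.
  by rewrite dotC dotNl dotC oppr_le0.
split=> // d dC; apply: small => t t0 _.
by apply: descent_coneD => //; exact: descent_coneZ.
Qed.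

End RidgeMinimizer.

(** * Faces that carry the penalised minimisers *)

Section RidgeFaces.
Context {R : realType}.
Variables (n m : nat) (Kh KL : {set 'I_n}) (idef : 'I_n).
Implicit Types (A : 'M[R]_(m, n)) (g d y : 'rV[R]_n) (f : {set 'I_n} * bool).
Local Notation descent_cone := (@descent_cone R n Kh KL).
Local Notation valid := (valid Kh).
Local Notation on_face := (@on_face R n Kh KL idef).
Local Notation face_pt := (@face_pt R n idef).
Local Notation rot := (@rot R n idef).
Local Notation fdim := (@fdim n idef).
Local Notation lsF := (@lsF R n Kh KL idef).
Local Notation lsH := (@lsH R n KL idef).

(** The squared Frobenius norm, summed by columns to fit [dot_mulmx_le]. *)
Definition frob p q (M : 'M[R]_(p, q)) : R := \sum_j dot (col j M)^T (col j M)^T.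

Lemma frob_ge0 p q (M : 'M[R]_(p, q)) : 0 <= frob M.
Proof. by apply: sumr_ge0 => j _; exact: dot_ge0. Qed.

Lemma dot_mulmx_le p q (M : 'M[R]_(p, q)) v : dot (v *m M) (v *m M) <= frob M * dot v v.
Proof.
rewrite mulr_suml; apply: ler_sum => j _.
have -> : (v *m M) 0 j = dot v (col j M)^T.
  by rewrite mxE; apply: eq_bigr => i _; rewrite !mxE.
by rewrite -expr2 mulrC cauchy_schwarz.
Qed.

(** Joins the two descriptions of the minimiser: a point of the face found as a projection of [G]
    solves the normal equations on the span, hence equals the [ridge] vector of the rotated data. *)
Lemma on_face_event kappa A g y f (G := g - kappa *: (y *m A^T *m A)) : 0 <= kappa ->
  face_pt f G = y -> on_face f G ->
  face_event (fdim f) kappa (posl (lsF f)) (negl (lsH f)) (col_mx g A *m rot f : 'M[R]_(1 + m, n)).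
Proof.
move=> kappa0 yE fG.
have yU : y *m rot f = G *m rot f *m proj (fdim f) by rewrite -yE face_pt_rot.
have PP := @proj_idem R n (fdim f).
have UU := @rot_tr R n idef f.
have ridgeE : ridge kappa ((col_mx g A *m rot f : 'M[R]_(1 + m, n)) *m proj (fdim f)) = y *m rot f.
  apply/esym/ridge_eq => //.
  rewrite !mul_col_mx col_mxKu col_mxKd /ridge_mx mulmxDr mulmx1 -scalemxAr.
  have -> : y *m rot f *m ((A *m rot f *m proj (fdim f))^T *m (A *m rot f *m proj (fdim f))) =
      y *m A^T *m A *m rot f *m proj (fdim f).
    rewrite !trmx_mul tr_proj !mulmxA; congr (_ *m _ *m _ *m _).
    rewrite yU -(mulmxA _ (proj _) (proj _)) PP -yU -(mulmxA y) UU mulmx1//.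
  by rewrite yU /G !mulmxBl -!scalemxAl subrK.
rewrite /face_event ridgeE mul_col_mx col_mxKu col_mxKd.
have -> : g *m rot f - kappa *: (y *m rot f *m (A *m rot f)^T *m (A *m rot f)) = G *m rot f.
  rewrite trmx_mul !mulmxA -(mulmxA y) UU mulmx1 mulmxBl -scalemxAl //.
by rewrite yU.
Qed.

(** Comparison with the best multiple of [d], on which the penalty vanishes, gives a value at most
    |g|^2 - delta, so <g, y> >= delta / 2 and [y] stays away from 0. Comparison with 0 bounds the
    penalty. *)
Lemma ridge_obj_eventually_small A g d : descent_cone d -> d *m A^T = 0 -> 0 < dot g d ->
  exists2 rho, 0 < rho & forall kappa y, 0 <= kappa ->
    (forall x, descent_cone x -> ridge_obj A g kappa y <= ridge_obj A g kappa x) ->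
    rho <= dot y y /\ kappa * dot (y *m A^T) (y *m A^T) <= dot g g.
Proof.
move=> dC Ad gd.
have dd : 0 < dot d d by apply: dot_gt0; apply: contraTneq gd => ->; rewrite dotC dot0l ltxx.
have gg : 0 < dot g g by apply: dot_gt0; apply: contraTneq gd => ->; rewrite dot0l ltxx.
pose delta := dot g d ^+ 2 / dot d d.
have delta0 : 0 < delta by rewrite divr_gt0// exprn_gt0.
exists (delta ^+ 2 / (4 * dot g g)); first by rewrite divr_gt0 ?exprn_gt0// mulr_gt0.
move=> kappa y kappa0 ymin.
have q0 : 0 <= kappa * dot (y *m A^T) (y *m A^T) by rewrite mulr_ge0 ?dot_ge0.
have yg0 := dot_ge0 (y - g).
have obj0 : ridge_obj A g kappa 0 = dot g g.
  by rewrite /ridge_obj mul0mx dot0l mulr0 addr0 sub0r dotNl dotC dotNl opprK.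
have := ymin _ (descent_cone0 Kh KL); rewrite obj0 {1}/ridge_obj => h0.
split; last by lra.
pose t := dot g d / dot d d.
have tC : descent_cone (t *: d) by apply: descent_coneZ => //; rewrite divr_ge0 ?ltW.
have := ymin _ tC; rewrite /ridge_obj -scalemxAl Ad scaler0 dot0l mulr0 addr0 => h1.
have objd : dot (t *: d - g) (t *: d - g) = dot g g - delta.
  rewrite dotBl !dotBr !dotZl !dotZr (dotC d g) /t /delta; field.
  by rewrite gt_eqF.
rewrite objd in h1.
have ye : dot (y - g) (y - g) = dot y y - 2 * dot g y + dot g g.
  by rewrite dotBl !dotBr (dotC y g); ring.
have yy := dot_ge0 y.
have h2 : delta / 2 <= dot g y by lra.
have h3 : (delta / 2) ^+ 2 <= dot g y ^+ 2.
  have h5 : 0 <= delta / 2 by rewrite divr_ge0// ltW.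
  by rewrite ler_sqr// nnegrE// (le_trans h5 h2).
have := le_trans h3 (cauchy_schwarz g y) => h4.
rewrite ler_pdivrMr ?mulr_gt0//.
have -> : delta ^+ 2 = 4 * (delta / 2) ^+ 2 by field.
lra.
Qed.

(** On a regular face |y|^2 is at most C |y A^T|^2, hence at most C |g|^2 / k, and this falls below
    [rho] for large [k]. The minimiser must therefore lie on a face of dimension above [m]. *)
Lemma kernel_face_event A g d : descent_cone d -> d *m A^T = 0 -> 0 < dot g d ->
  (forall f, valid f -> (#|fdim f| <= m)%N -> \det (gram (fdim f) (A *m rot f)) != 0) ->
  exists k0 : nat, forall k : nat, (k0 <= k)%N -> exists f,
    [/\ valid f, (m < #|fdim f|)%N & face_event (fdim f) k%:R (posl (lsF f)) (negl (lsH f))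
      (col_mx g A *m rot f : 'M[R]_(1 + m, n))].
Proof.
move=> dC Ad gd regular.
have [rho rho0 hrho] := ridge_obj_eventually_small dC Ad gd.
(* A minimiser on a regular face [f] satisfies [y *m rot f = (y *m A^T) *m M f]. Summing over all
   faces gives a constant available before the face is known, since the face depends on [k]. *)
pose M f := A *m rot f *m proj (fdim f) *m invmx (gram (fdim f) (A *m rot f)).
pose C := \sum_f frob (M f).
have C0 : 0 <= C by apply: sumr_ge0 => f _; exact: frob_ge0.
exists (Num.Def.archi_bound (C * dot g g / rho)).+1 => k kk.
have [y yC ymin] := @ridge_obj_min R n m Kh KL A g k%:R (ler0n _ _).
have [y1 y2] := hrho _ _ (ler0n _ k) ymin.
have y0 : y != 0 by rewrite neq0_dot; exact: lt_le_trans y1.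
have [f [vf fG yE]] := proj_on_face idef (ridge_cone_proj (ler0n _ k) yC ymin) y0.
exists f; split=> //; last exact: (on_face_event (ler0n _ k) yE fG).
rewrite ltnNge; apply/negP => fm.
have det0 := regular f vf fm.
have xE : y *m rot f = (y *m A^T) *m M f.
  have ug : gram (fdim f) (A *m rot f) \in unitmx by rewrite unitmxE unitfE.
  rewrite /M !mulmxA; apply: (canRL (mulmxK ug)).
  have yU : y *m rot f *m proj (fdim f) = y *m rot f.
    by rewrite -yE face_pt_rot -mulmxA proj_idem.
  rewrite /gram mulmxDr mulmxBr mulmx1 yU subrr add0r.
  rewrite !trmx_mul tr_proj !mulmxA yU -(mulmxA y (rot f) (rot f)^T) rot_tr mulmx1//.
have : dot y y <= C * dot (y *m A^T) (y *m A^T).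
  rewrite -(dot_rot idef f) xE; apply: (le_trans (dot_mulmx_le _ _)).
  rewrite ler_wpM2r ?dot_ge0// /C (bigD1 f)//= lerDl sumr_ge0// => f' _; exact: frob_ge0.
move=> h; have := le_trans y1 h => h'.
have bound : C * dot g g < rho * k%:R.
  rewrite (mulrC rho) -ltr_pdivrMr//.
  apply: (lt_le_trans (archi_boundP _)); first by rewrite divr_ge0 ?mulr_ge0 ?dot_ge0// ltW.
  by rewrite ler_nat ltnW.
have h1 := ler_wpM2l C0 y2.
have h2 := ler_wpM2r (ler0n _ k) h'.
by have := le_lt_trans h1 (lt_le_trans bound h2); rewrite (mulrC k%:R) mulrA ltxx.
Qed.

End RidgeFaces.

(** * Probability of the bad event *)

Section BadEvent.
Context {R : realType}.
Local Notation mgauss := (@mgauss R).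
Local Notation bE := (@bE R).
Local Open Scope ereal_scope.

Lemma limn_einf_ge (u : (\bar R)^nat) (b : \bar R) k0 :
  (forall k, (k0 <= k)%N -> b <= u k) -> b <= limn_einf u.
Proof.
move=> h; rewrite limn_einf_lim (cvg_lim _ (@cvg_einfs_sup _ u))//.
apply: (@le_trans _ _ (einfs u k0)); last by apply: ereal_sup_ubound; exists k0.
by apply: le_ereal_inf_tmp => _ [k /= kk <-]; exact: h.
Qed.

Lemma limn_einf_le (u : (\bar R)^nat) (b : \bar R) :
  (forall k, u k <= b) -> limn_einf u <= b.
Proof.
move=> h; rewrite limn_einf_lim (cvg_lim _ (@cvg_einfs_sup _ u))//.
apply: ge_ereal_sup => _ [k _ <-]; apply: le_trans (h k).
by apply: ereal_inf_lbound; exists k => /=.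
Qed.

Lemma measurable_limn_einf d (T : measurableType d) (f : (T -> \bar R)^nat) :
  (forall k, measurable_fun setT (f k)) -> measurable_fun setT (fun x => limn_einf (f^~ x)).
Proof.
move=> mf.
rewrite (_ : (fun x => _) = fun x => - limn_esup (fun k => - f k x)); last first.
  by apply/funext => x; rewrite -limn_einfN; congr limn_einf; apply/funext => k /=; rewrite oppeK.
apply: measurableT_comp => //; apply: measurable_fun_limn_esup => k.
exact: measurableT_comp.
Qed.

Variables (n m : nat) (Kh KL : {set 'I_n}) (idef : 'I_n).
Local Notation valid := (valid Kh).
Local Notation rot := (@rot R n idef).
Local Notation fdim := (@fdim n idef).
Local Notation lsF := (@lsF R n Kh KL idef).
Local Notation lsH := (@lsH R n KL idef).
Local Notation FT := ({set 'I_n} * bool)%type.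

Definition ridge_event (k : nat) (f : FT) (D : mxm R (1 + m) n) : bool :=
  [&& valid f, (m < #|fdim f|)%N &
    face_event (fdim f) k%:R (posl (lsF f)) (negl (lsH f)) (D *m rot f)%R].

Definition sing_event (f : FT) (A : mxm R m n) : bool :=
  [&& valid f, (#|fdim f| <= m)%N & \det (gram (fdim f) (A *m rot f)%R) == 0%R].

(* If g has a positive product with some d != 0 in descent_cone with A d = 0, the minimisers over
   the cone of [|x - g|^2 + k |A x|^2] stay away from 0 but their images under A tend to 0, so for
   large k they lie on faces of dimension > m unless A is singular on some smaller face. *)
Definition bad (D : mxm R (1 + m) n) : \bar R :=
  limn_einf (fun k => \sum_f bE (ridge_event k f D)) + \sum_f bE (sing_event f (dsubmx D)).

Lemma measurable_ridge_event k f : measurable_fun setT (ridge_event k f).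
Proof.
rewrite /ridge_event; apply: measurable_and; first exact: measurable_cst.
apply: measurable_and; first exact: measurable_cst.
have mR : measurable_fun setT (fun D : mxm R (1 + m) n => (D *m rot f)%R : mxm R (1 + m) n).
  exact: (measurable_mulmxr _ (@measurable_id _ _ setT)).
apply: (measurableT_comp _ mR); apply: measurable_face_event => //.
  exact: measurable_posl.
exact: measurable_negl.
Qed.

Lemma measurable_sing_event f : measurable_fun setT (sing_event f).
Proof.
rewrite /sing_event; apply: measurable_and; first exact: measurable_cst.
apply: measurable_and; first exact: measurable_cst.
have mR : measurable_fun setT (fun A : mxm R m n => (A *m rot f)%R : mxm R m n).
  exact: (measurable_mulmxr _ (@measurable_id _ _ setT)).
apply: measurable_fun_eqr; last exact: measurable_cst.
exact: (measurableT_comp (measurable_gram (fdim f)) mR).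
Qed.

Lemma measurable_bad : measurable_fun setT bad.
Proof.
apply: emeasurable_funD.
  apply: measurable_limn_einf => k; apply: emeasurable_sum => f.
  by apply: (@measurable_bE R _ _ _); exact: measurable_ridge_event.
apply: emeasurable_sum => f.
have md : measurable_fun setT (fun D : mxm R (1 + m) n => dsubmx D : mxm R m n).
  exact: measurable_dsubmx.
by have := @measurable_bE R _ _ _ (measurableT_comp (measurable_sing_event f) md).
Qed.

Lemma sum_bE_ge0 (h : FT -> bool) : 0 <= \sum_f bE (h f).
Proof. by apply: sume_ge0 => f _; exact: bE_ge0. Qed.

Lemma sum_bE_ge1 (h : FT -> bool) f : h f -> 1 <= \sum_f bE (h f).
Proof.
move=> hf; rewrite (bigD1 f)//= hf -[X in X <= _]adde0; apply: leeD => //.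
by apply: sume_ge0 => f' _; exact: bE_ge0.
Qed.

Lemma bad_ge0 D : 0 <= bad D.
Proof.
apply: adde_ge0; last exact: sum_bE_ge0.
by apply: (@limn_einf_ge _ _ 0%N) => k _; exact: sum_bE_ge0.
Qed.

Lemma kernel_bad (g : mxm R 1 n) (A : mxm R m n) (d : 'rV[R]_n) : descent_cone Kh KL d ->
  (d *m A^T = 0)%R -> (0 < dot g d)%R -> 1 <= bad (col_mx g A).
Proof.
move=> dC Ad gd; rewrite /bad.
have [[f fA]|ns] := pselect (exists f, sing_event f A).
  have -> : dsubmx (col_mx g A : mxm R (1 + m) n) = A by exact: col_mxKd.
  rewrite -[X in X <= _]add0e; apply: leeD; last exact: (@sum_bE_ge1 (sing_event^~ A) f).
  by apply: (@limn_einf_ge _ _ 0%N) => k _; exact: sum_bE_ge0.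
have [k0 hk] : exists k0 : nat, forall k : nat, (k0 <= k)%N -> exists f,
    ridge_event k f (col_mx g A).
  have [f vf fm|k0 hk] := @kernel_face_event R n m Kh KL idef A g d dC Ad gd.
    apply/negP => f0; apply: ns; exists f; rewrite /sing_event vf fm; exact: f0.
  by exists k0 => k /hk[f [vf mf ef]]; exists f; rewrite /ridge_event vf mf.
rewrite -[X in X <= _]adde0; apply: leeD; last exact: sum_bE_ge0.
by apply: (@limn_einf_ge _ _ k0) => k /hk[f ef]; exact: (@sum_bE_ge1 (ridge_event k ^~ _) f).
Qed.

(** The bound of [face_event_le] is the same for every penalty, so it survives the limit in [k]. *)
Lemma int_ridge_event_le k f :
  \int[mgauss (1 + m) n]_D bE (ridge_event k f D) <=
  if valid f && (m < #|fdim f|)%N then face_prob Kh KL idef f else 0.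
Proof.
case: ifP => [/andP[vf mf]|vmf]; last first.
  rewrite (eq_integral (cst 0)) ?integral0// => D _.
  by rewrite /ridge_event andbA vmf.
have [i0 i0J] : exists i0, i0 \in fdim f.
  by apply/card_gt0P; exact: leq_ltn_trans mf.
pose F : mxm R 1 n -> bool := posl (lsF f).
pose H : mxm R 1 n -> bool := negl (lsH f).
have mF : measurable_fun setT F by exact: measurable_posl.
have mH : measurable_fun setT H by exact: measurable_negl.
have mE := measurable_face_event (fdim f) (ler0n R k) mF mH.
have [[_ gi] _] := @rotP R n idef f.
have e := gi (1 + m)%N (fun D => bE (face_event (fdim f) k%:R F H D))
  (@measurable_bE R _ _ _ (mE m)) (fun D => bE_ge0 _).
have -> : \int[mgauss (1 + m) n]_D bE (ridge_event k f D) =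
    \int[mgauss (1 + m) n]_D bE (face_event (fdim f) k%:R F H D).
  apply: etrans e; apply: eq_integral => D _.
  by rewrite /ridge_event vf mf.
rewrite /face_prob; apply: (@face_event_le R m n (fdim f) k%:R (ler0n R k) i0 i0J F H mF mH).
- move=> y _ Fy; have [y0 [k' hk']] := @posl_open R n (lsF f) y Fy; split; first exact: y0.
  by exists k' => h _; exact: hk'.
- by move=> x; apply: negl_proj => l lH; exact: (lsH_proj vf lH).
- by move=> c x; exact: neglZ.
Qed.

Lemma int_sing_event f : \int[mgauss (1 + m) n]_D bE (sing_event f (dsubmx D)) = 0.
Proof.
have ms := measurable_sing_event f.
have msd : measurable_fun setT (fun D : mxm R (1 + m) n => sing_event f (dsubmx D)).
  have md : measurable_fun setT (fun D : mxm R (1 + m) n => dsubmx D : mxm R m n).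
    exact: measurable_dsubmx.
  exact: (measurableT_comp ms md).
have e := mgauss_col_mx (@measurable_bE R _ _ _ msd) (fun D => bE_ge0 _).
apply: (etrans e).
apply: integral0_eq => g _.
apply: (@etrans _ _ (\int[mgauss m n]_A bE (sing_event f A))).
  by apply: eq_integral => A _; congr (bE (sing_event f _)); exact: col_mxKd.
have [vfm|vfm] := boolP (valid f && (#|fdim f| <= m)%N); last first.
  rewrite (eq_integral (cst 0)) ?integral0// => A _.
  by rewrite /sing_event andbA (negbTE vfm).
have /andP[vf fm] := vfm.
have [[_ gi] _] := @rotP R n idef f.
have mg : measurable_fun setT (fun A : mxm R m n => \det (gram (fdim f) A) == 0%R).
  by apply: measurable_fun_eqr; [exact: measurable_gram|exact: measurable_cst].
have e' := gi m _ (@measurable_bE R _ _ _ mg) (fun A => bE_ge0 _).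
apply: etrans; last exact: (@gram_ae R m n (fdim f) fm).
apply: etrans e'; apply: eq_integral => A _.
by rewrite /sing_event vf fm.
Qed.

(** The threshold on [k] in [kernel_face_event] depends on [g] and [A], so only a lower limit is
    available pointwise; Fatou's lemma transfers the uniform bound to it, and the singular events
    are null. *)
Lemma int_bad_le : \int[mgauss (1 + m) n]_D bad D <=
  \sum_(f : FT | valid f && (m < #|fdim f|)%N) face_prob Kh KL idef f.
Proof.
have mr k f := @measurable_bE R _ _ _ (measurable_ridge_event k f).
have ms f : measurable_fun setT (fun D : mxm R (1 + m) n => bE (sing_event f (dsubmx D))).
  have md : measurable_fun setT (fun D : mxm R (1 + m) n => dsubmx D : mxm R m n).
    exact: measurable_dsubmx.
  by have := @measurable_bE R _ _ _ (measurableT_comp (measurable_sing_event f) md).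
have msum k : measurable_fun setT (fun D : mxm R (1 + m) n => \sum_f bE (ridge_event k f D)).
  exact: emeasurable_sum.
have l0 (D : mxm R (1 + m) n) : 0 <= limn_einf (fun k => \sum_f bE (ridge_event k f D)).
  by apply: (@limn_einf_ge _ _ 0%N) => k _; exact: sum_bE_ge0.
have e1 := ge0_integralD (mgauss (1 + m) n) measurableT (fun D _ => l0 D)
  (measurable_limn_einf msum) (fun D _ => sum_bE_ge0 (sing_event^~ (dsubmx D))) (emeasurable_sum _ ms).
rewrite [X in X <= _](_ : _ = \int[mgauss (1 + m) n]_D limn_einf (fun k => \sum_f bE (ridge_event k f D))); last first.
  apply: (etrans e1); apply: etrans (adde0 _); congr (_ + _).
  have e2 := ge0_integral_sum (mgauss (1 + m) n) measurableT ms (fun f D _ => bE_ge0 _) (index_enum _).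
  by apply: (etrans e2); apply: big1 => f _; exact: int_sing_event.
apply: le_trans (fatou _ measurableT msum (fun k D _ => sum_bE_ge0 (fun f => ridge_event k f D))) _.
apply: limn_einf_le => k.
have e3 := ge0_integral_sum (mgauss (1 + m) n) measurableT (mr k) (fun f D _ => bE_ge0 _) (index_enum _).
rewrite e3 [X in _ <= X]big_mkcond; apply: lee_sum => f _; exact: int_ridge_event_le.
Qed.

End BadEvent.

(** * Choice of the tilt parameter *)

Lemma expR_le_1D (R : realType) (s : R) : 0 <= s -> expR (s - s ^+ 2 / 2) <= 1 + s.
Proof.
move=> s0.
(* The quotient of the two sides: it equals 1 at 0 and its derivative is x^2 times an
   exponential. *)
pose f (x : R) : R := (1 + x) * expR (x ^+ 2 / 2 - x).
have df : forall x : R, is_derive x 1 f (x ^+ 2 * expR (x ^+ 2 / 2 - x)).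
  move=> x.
  assert (d1 : is_derive x 1 (fun x : R => x ^+ 2 / 2 - x) (x - 1)).
    apply: is_derive_eq.
    by rewrite /GRing.scale /=; field.
  have d2 := @is_derive1_comp R (@expR R) (fun x : R => x ^+ 2 / 2 - x) x _ _ (is_derive_expR _) d1.
  assert (d3 : is_derive x 1 (fun x : R => 1 + x) 1).
    by apply: is_derive_eq; rewrite add0r mulr1.
  have := @is_deriveM _ _ (fun x : R => 1 + x) _ _ _ _ _ d3 d2.
  move=> d4; apply: is_derive_eq d4 _. rewrite /GRing.scale /=. ring.
have cf : {within `[0, s], continuous f}.
  apply: continuous_subspaceT => x; apply: differentiable_continuous.
  by apply/derivable1_diffP; exact: (@ex_derive _ _ _ _ _ _ _ (df x)).
have := @ger0_derive1_le_cc R f 0 s (fun x _ => @ex_derive _ _ _ _ _ _ _ (df x)).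
move=> H; have : f 0 <= f s.
  apply: H => //; rewrite ?in_itv /= ?lexx ?s0//.
  by move=> x _; rewrite derive1E (@derive_val _ _ _ _ _ _ _ (df x)) mulr_ge0 ?sqr_ge0 ?expR_ge0.
rewrite /f addr0 mul1r expr0n /= mul0r subr0 expR0.
have -> : s ^+ 2 / 2 - s = - (s - s ^+ 2 / 2) by rewrite opprB.
by rewrite expRN ler_pdivlMr ?expR_gt0// mul1r.
Qed.

(* s = t / (2 n) minimises the resulting exponent n s^2 / 2 - s t / 2. *)
Lemma tilt_weight_le (R : realType) (m n : nat) (t delta : R) : (m < n)%N -> 0 < t ->
  0 <= delta -> delta + t <= m.+1%:R ->
  (Num.sqrt (1 + t / (2 * n%:R)) ^+ m.+1)^-1 *
    expR (t / (2 * n%:R) / 2 * (1 + t / (2 * n%:R) / 2) * delta) <= expR (- (t ^+ 2 / (8 * n%:R))).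
Proof.
move=> mn t0 d0 dm; set s := t / (2 * n%:R).
have n0 : 0 < (n%:R : R) by rewrite ltr0n; exact: leq_ltn_trans mn.
have s0 : 0 < s by rewrite divr_gt0// mulr_gt0.
have mn' : m.+1%:R <= n%:R :> R by rewrite ler_nat.
have sq1 : 0 < Num.sqrt (1 + s) ^+ m.+1 by rewrite exprn_gt0// sqrtr_gt0 addr_gt0.
have sqE : expR (m.+1%:R * ((s - s ^+ 2 / 2) / 2)) <= Num.sqrt (1 + s) ^+ m.+1.
  rewrite expRM_natl; apply: lerXn2r; rewrite ?nnegrE ?expR_ge0 ?sqrtr_ge0//.
  rewrite -(@ler_sqr R) ?nnegrE ?expR_ge0 ?sqrtr_ge0// sqr_sqrtr; last by rewrite addr_ge0// ltW.
  by rewrite -expRM_natl mulrCA divff// mulr1 expR_le_1D// ltW.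
rewrite mulrC ler_pdivrMr//.
apply: (le_trans _ (ler_wpM2l (expR_ge0 _) sqE)).
rewrite -expRD ler_expR.
have tE : t = 2 * n%:R * s by rewrite /s; field; rewrite gt_eqF.
have -> : t ^+ 2 / (8 * n%:R) = n%:R * s ^+ 2 / 2 by rewrite tE; field; rewrite gt_eqF.
(* With this bound on [delta] the exponent is at most (m + 1) s^2 / 2 - n s^2 - n s^3 / 2, and m + 1
   <= n. *)
have h1 : delta <= m.+1%:R - 2 * n%:R * s by rewrite -tE; lra.
have p1 : 0 <= s / 2 * (1 + s / 2) by rewrite mulr_ge0 ?addr_ge0 ?divr_ge0// ltW.
have h2 := ler_wpM2l p1 h1.
have h3 : s ^+ 2 * m.+1%:R <= s ^+ 2 * n%:R by rewrite ler_wpM2l ?sqr_ge0.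
have h4 : 0 <= n%:R * s ^+ 3 by rewrite mulr_ge0 ?exprn_ge0 ?ltW.
lra.
Qed.

(** * The bound as a sum of means, and half-space probabilities *)

Section BoundFun.
Context {R : realType}.
Local Notation mu := (@lebesgue_measure R).

Lemma gaussian_tail_eq (D : set R) (h : R -> R) (tau : R) : measurable D ->
  measurable_fun setT h -> (forall x, 0 <= h x) ->
  (forall x, D x -> h x = (x - tau) ^+ 2) -> (forall x, ~ D x -> h x = 0) ->
  Rintegral mu D (fun u => (u - tau) ^+ 2 * phi u) =
  fine (\int[normal_prob 0 1]_x (h x)%:E)%E.
Proof.
move=> mD mh h0 hD hN; rewrite integral_gam => [||x]; last 2 first.
- by apply/measurable_EFinP.
- by rewrite lee_fin.
rewrite /Rintegral integral_mkcond; congr fine; apply: eq_integral => x _.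
rewrite patchE; case: ifPn => [/set_mem Dx|/negP xD]; first by rewrite hD// EFinM.
by rewrite hN ?mul0e// => Dx; apply: xD; exact: mem_set.
Qed.

Lemma bound_funE khat kL Nk (tau : R) : bound_fun khat kL Nk tau =
  khat%:R * (1 + tau ^+ 2) + kL%:R * fine (qm tau) + Nk%:R * fine (qp tau).
Proof.
rewrite /bound_fun /qm /qp; congr (_ + _ * _ + _ * _).
- apply: gaussian_tail_eq => //; first exact: measurable_dm.
  + by move=> x; rewrite dm_ge0.
  + move=> x /=; rewrite in_itv /= => xt.
    by rewrite /dm max_r ?subr_ge0// -sqrrN opprB.
  + move=> x /=; rewrite in_itv /= => /negP; rewrite -ltNge => xt.
    by rewrite /dm max_l ?expr0n//= subr_le0 ltW.
- apply: gaussian_tail_eq => //; first exact: measurable_dp.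
  + by move=> x; rewrite dp_ge0.
  + move=> x /=; rewrite in_itv /= andbT => xt.
    by rewrite /dp max_r ?subr_ge0.
  + move=> x /=; rewrite in_itv /= andbT => /negP; rewrite -ltNge => xt.
    by rewrite /dp max_l ?expr0n//= subr_le0 ltW.
Qed.

Lemma bound_fun_ge0 khat kL Nk (tau : R) : 0 <= bound_fun khat kL Nk tau.
Proof.
rewrite bound_funE !addr_ge0// mulr_ge0 ?fine_ge0 ?qm_ge0 ?qp_ge0//.
by rewrite addr_ge0 ?sqr_ge0.
Qed.

(** The two open half-lines have equal mass by symmetry and the point 0 has none. *)
Lemma gam_half : ((2^-1)%:E <= \int[normal_prob (0 : R) 1]_x @bE R (0 < x)%R)%E.
Proof.
have mp : measurable_fun setT (fun x : R => 0 < x).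
  by apply: measurable_fun_ltr; [exact: measurable_cst|exact: measurable_id].
have mn : measurable_fun setT (fun x : R => 0 < - x).
  by apply: measurable_fun_ltr; [exact: measurable_cst|exact: measurable_funN].
have me : measurable_fun setT (fun x : R => x == 0).
  by apply: measurable_fun_eqr; [exact: measurable_id|exact: measurable_cst].
have e1 := @gam_opp R (fun x => @bE R (0 < x)) (@measurable_bE R _ _ _ mp) (fun x => bE_ge0 _).
have e2 : (\int[normal_prob (0 : R) 1]_x @bE R (x == 0)%R = 0)%E.
  apply: etrans (gam_set1 0); apply: (etrans (integral_bE (normal_prob (0 : R) 1) me)).
  by congr (normal_prob _ _ _); apply/seteqP; split=> x /= /eqP.
set v := (\int[_]_x _)%E.
have : (1 <= v + v + 0)%E.
  have ev : v = (\int[normal_prob (0 : R) 1]_x @bE R (0 < - x)%R)%E by exact: (esym e1).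
  rewrite {2}ev -e2.
  have i1 := int_gamD (@measurable_bE R _ _ _ mp) (@measurable_bE R _ _ _ mn) (fun x => bE_ge0 _) (fun x => bE_ge0 _).
  have i2 := int_gamD (emeasurable_funD (@measurable_bE R _ _ _ mp) (@measurable_bE R _ _ _ mn))
    (@measurable_bE R _ _ _ me) (fun x => adde_ge0 (bE_ge0 _) (bE_ge0 _)) (fun x => bE_ge0 _).
  apply: le_trans (_ : _ <= _)%E; last first.
    by rewrite le_eqVlt; apply/orP; left; apply/eqP; exact: (etrans i2 (congr1 (fun u => (u + _)%E) i1)).
  apply: (@le_trans _ _ (\int[normal_prob (0 : R) 1]_x cst 1 x)%E).
    by rewrite integral_cst// [X in (_ * X)%E]probability_setT mule1.
  apply: ge0_le_integral => //.
  - by apply: emeasurable_funD; [apply: emeasurable_funD|]; exact: measurable_bE.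
  - move=> x _ /=; rewrite /bE -!EFinD lee_fin oppr_gt0.
    by case: (ltgtP x 0) => _ /=; lra.
rewrite adde0; case: v => [v| |]; rewrite ?leNye ?leey// -EFinD !lee_fin; lra.
Qed.

(** [mgauss_comb] reduces the sign of [dot g d] to the sign of one normal coordinate. *)
Lemma halfspace_half n (d : 'rV[R]_n) : d != 0 ->
  ((2^-1)%:E <= \int[mgauss 1 n]_g @bE R (0 < dot g d)%R)%E.
Proof.
move=> d0.
have mp : measurable_fun setT (fun x : R => 0 < x).
  by apply: measurable_fun_ltr; [exact: measurable_cst|exact: measurable_id].
have mf : measurable_fun setT (fun M : mxm R 1 1 => @bE R (0 < M ord0 ord0)).
  apply: (@measurable_bE R _ _ _); apply: measurable_fun_ltr; first exact: measurable_cst.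
  exact: measurable_mxE.
have e1 := mgauss_comb d0 mf (fun M => bE_ge0 _).
have e2 := mgauss_coord (ord0 : 'I_1) (@measurable_bE R _ _ _ mp) (fun x => bE_ge0 _).
apply: (le_trans gam_half); rewrite -e2 -e1; last first.
  by move=> c M c0; rewrite mxE pmulr_rgt0.
have md : measurable_fun setT (fun B : mxm R n 1 => @bE R (0 < (d *m B) ord0 ord0)).
  have mdB : measurable_fun setT (fun B : mxm R n 1 => d *m B : mxm R 1 1).
    by apply: measurable_mulmx; [exact: measurable_cst|exact: measurable_id].
  exact: (measurableT_comp mf mdB).
have e3 := mgauss_trmx md (fun B => bE_ge0 _).
rewrite le_eqVlt; apply/orP; left; apply/eqP; apply: (etrans (esym e3)).
by apply: eq_integral => g _; rewrite dotC dotE.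
Qed.

End BoundFun.

(** * Assembly *)

Section Main.
Context {R : realType}.
Local Notation mgauss := (@mgauss R).

Lemma int_bad_small (n m : nat) (Kh KL : {set 'I_n}) (idef : 'I_n) (khat kL Nk : nat) (eps : R) :
  (forall tau : R, \sum_(i < n) (if i \in Kh then 1 + tau ^+ 2
     else if i \in KL then fine (qm tau) else fine (qp tau)) = bound_fun khat kL Nk tau) ->
  0 < eps -> eps <= 1 ->
  m%:R >= inf [set bound_fun khat kL Nk tau | tau in [set t : R | 0 <= t]]
          + Num.sqrt (8 * ln (4 / eps) * n%:R) ->
  (\int[mgauss (1 + m) n]_D bad Kh KL idef D <= (eps / 4)%:E)%E.
Proof.
move=> hsum eps0 eps1; set S := [set _ | _ in _]; set t := Num.sqrt _ => hm.
have n0 : 0 < (n%:R : R) by rewrite ltr0n; case: (n) idef => // -[].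
have ln0 : 0 < ln (4 / eps) by rewrite ln_gt0// ltr_pdivlMr//; lra.
have t0 : 0 < t by rewrite sqrtr_gt0 !mulr_gt0.
apply: (le_trans (int_bad_le _ _ _ _)).
(* For n <= m no face has dimension above [m], and the sum is empty. *)
have [nm|mn] := leqP n m.
  rewrite big_pred0 ?lee_fin ?divr_ge0 ?ltW// => f.
  apply/negbTE; rewrite negb_and -leqNgt; apply/orP; right; apply: leq_trans nm.
  by rewrite -[X in (_ <= X)%N](card_ord n); exact: max_card.
have S0 : S !=set0 by exists (bound_fun khat kL Nk 0); exists 0 => /=.
have Slb : lbound S 0 by move=> _ [tau _ <-]; exact: bound_fun_ge0.
have hS : has_inf S by split => //; exists 0.
have inf0 : 0 <= inf S by exact: lb_le_inf.
(* The infimum need not be attained; a [tau] within 1 of it suffices because faces have dimension at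
   least m + 1, and the extra 1 absorbs the loss. *)
have [_ [tau tau0 <-] htau] := inf_adherent (ltr0Sn R 0) hS.
have s_half : t / (2 * n%:R) <= 2^-1.
  have : t <= n%:R by apply: le_trans (_ : m%:R <= _); [lra|rewrite ler_nat ltnW].
  by rewrite ler_pdivrMr ?mulr_gt0//; lra.
have s0 : 0 < t / (2 * n%:R) by rewrite divr_gt0// mulr_gt0.
apply: (le_trans (face_prob_sum_le Kh KL idef m s0 s_half tau0)).
rewrite lee_fin hsum; apply: (le_trans (tilt_weight_le mn t0 (bound_fun_ge0 _ _ _ _) _)).
  by rewrite -natr1; lra.
have -> : t ^+ 2 / (8 * n%:R) = ln (4 / eps).
  by rewrite sqr_sqrtr ?mulr_ge0 ?ltW//; field; rewrite gt_eqF.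
by rewrite expRN lnK ?posrE ?divr_gt0// invf_div.
Qed.

Lemma mem_bigcup_seq (T : finType) (r : seq nat) (K : nat -> {set T}) x :
  (x \in (\bigcup_(i <- r) K i)%SET) = has (fun i => x \in K i) r.
Proof. by elim: r => [|i r IH]; rewrite ?big_nil ?finset.inE// big_cons finset.in_setU IH. Qed.

Lemma levels_val (N L : nat) (K : nat -> {set 'I_N}) j (n : 'I_N) :
  (forall i j, (1 <= i <= L)%N -> (1 <= j <= L)%N -> i != j -> (K i :&: K j = finset.set0)) ->
  (1 <= j <= L)%N -> n \in K j ->
  \sum_(1 <= i < L.+1) i%:R * (n \in K i)%:R = j%:R :> R.
Proof.
move=> dis jL nj; rewrite (bigD1_seq j)/= ?iota_uniq ?mem_index_iota//.
rewrite nj mulr1 big1_seq ?addr0// => i /andP[ij]; rewrite mem_index_iota ltnS => iL.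
have [ni|_] := boolP (n \in K i); last by rewrite mulr0.
have : n \in K i :&: K j by rewrite finset.in_setI ni.
by rewrite dis// finset.inE.
Qed.

End Main.

Theorem theorem4p4 (R : realType) (d : measure_display) (T : measurableType d)
  (P : probability T R) (eps : R) (m N L : nat) (K : nat -> {set 'I_N})
  (a : 'I_m -> 'I_N -> {RV P >-> R}) :
  0 < eps ->
  (1 <= L)%N ->
  (forall i j, (1 <= i <= L)%N -> (1 <= j <= L)%N -> i != j ->
     (K i :&: K j = finset.set0)) ->
  (forall i j, std_normal_RV (a i j)) ->
  mutually_independent a ->
  let x0 : 'cV[R]_N := \col_(n < N) \sum_(1 <= i < L.+1) i%:R * (n \in K i)%:R in
  let Kall := \bigcup_(1 <= i < L.+1) K i in
  let Khat := Kall :\: K L in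
  let k := #|Kall| in
  let khat := #|Khat| in
  let kL := #|K L| in
  m%:R >= inf [set bound_fun khat kL (N - k) tau | tau in [set t : R | 0 <= t]]
          + Num.sqrt (8 * ln (4 / eps) * N%:R) ->
  exists E : set T, measurable E /\
    E `<=` [set w | unique_box_l1_solution L (gauss_mx a w)
                      (gauss_mx a w *m x0) x0] /\
    ((1 - eps)%:E < P E)%E.
Proof.
move=> eps0 L1 dis an ai x0 Kall Khat k khat kL hm.
have KallP i : (i \in Kall) = has (fun j => i \in K j) (index_iota 1 L.+1).
  exact: mem_bigcup_seq.
have KLall i : i \in K L -> i \in Kall.
  by move=> iL; rewrite KallP; apply/hasP; exists L; rewrite // mem_index_iota L1 ltnS leqnn.
have x0L i : i \in K L -> x0 i 0 = L%:R.
  by move=> iL; rewrite mxE; apply: levels_val; rewrite // L1 leqnn.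
have x0N i : i \notin Kall -> x0 i 0 = 0.
  rewrite KallP => /hasPn iN; rewrite mxE big1_seq// => j /andP[_ /iN /negbTE ->].
  by rewrite mulr0.
have x0box i : 0 <= x0 i 0 <= L%:R.
  have [|/x0N ->] := boolP (i \in Kall); last by rewrite lexx ler0n.
  rewrite KallP => /hasP[j]; rewrite mem_index_iota ltnS => jL ij.
  by rewrite mxE (levels_val dis jL ij) ler0n ler_nat; case/andP: jL.
have x0feas w : gauss_mx a w *m x0 = gauss_mx a w *m x0 /\ (forall j, 0 <= x0 j 0 <= L%:R) by split.
(* For eps > 1 the lower bound on the probability is negative, so the empty set will do. *)
have [eps1|eps1] := ltP 1 eps.
  exists set0; split; first exact: measurable0.
  by split=> //; rewrite measure0 lte_fin subr_lt0.
have [N0|N0] := posnP N.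
  exists setT; split; first exact: measurableT.
  split; last by rewrite probability_setT lte_fin ltrBlDr ltrDl.
  move=> w _; split=> // x _ []; apply/matrixP => i.
  by have := ltn_ord i; rewrite {2}N0.
have idef : 'I_N by exact: Ordinal N0.
have hsum (tau : R) : \sum_(i < N) (if i \in Khat then 1 + tau ^+ 2
     else if i \in K L then fine (qm tau) else fine (qp tau)) = bound_fun khat kL (N - k) tau.
  rewrite bound_funE.
  have cE (A : {set 'I_N}) (c : R) : #|A|%:R * c = \sum_(i < N) (if i \in A then c else 0).
    by rewrite -big_mkcond sumr_const mulr_natl.
  have -> : (N - k)%N = #|~: Kall| by rewrite cardsCs finset.setCK card_ord.
  rewrite !cE -!big_split; apply: eq_bigr => i _ /=.
  rewrite finset.in_setD finset.in_setC.
  have [iL|iL] := boolP (i \in K L); first by rewrite (KLall i iL)/= add0r addr0.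
  by case: (i \in Kall); rewrite /= ?addr0 ?add0r.
have hbad := int_bad_small idef hsum eps0 eps1 hm.
(* Needed to undo the factor m^(-1/2) of [gauss_mx], so that its kernel is that of the unscaled
   matrix. *)
have m0 : (0 < m)%N.
  rewrite -(@ltr0n R); apply: lt_le_trans hm.
  apply: ltr_wpDl; last first.
    by rewrite sqrtr_gt0 !mulr_gt0 ?ltr0n// ln_gt0// ltr_pdivlMr//; lra.
  apply: lb_le_inf; first by exists (bound_fun khat kL (N - k) 0); exists 0 => /=.
  by move=> _ [tau _ <-]; exact: bound_fun_ge0.
pose A (w : T) : mxm R m N := \matrix_(i, j) a i j w.
have mA : measurable_fun setT A.
  apply: measurable_mxP => i j.
  under [X in measurable_fun _ X]eq_fun do rewrite mxE.
  exact: measurable_funPT.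
pose bd := bad Khat (K L) idef : mxm R (1 + m) N -> \bar R.
pose h (B : mxm R m N) : \bar R := (\int[mgauss 1 N]_g bd (col_mx g B))%E.
have mbd : measurable_fun setT bd by exact: measurable_bad.
have bd0 D : (0 <= bd D)%E by exact: bad_ge0.
have mcol : measurable_fun setT (fun z : mxm R 1 N * mxm R m N => bd (col_mx z.1 z.2)).
  exact: (measurableT_comp mbd (measurable_col_mx (@measurable_fst _ _ _ _) (@measurable_snd _ _ _ _))).
have mh : measurable_fun setT h.
  exact: (@measurable_fun_fubini_tonelli_G _ _ _ _ _ (mgauss 1 N) _ mcol (fun z => bd0 _)).
have h0 B : (0 <= h B)%E by apply: integral_ge0 => g _; exact: bd0.
have hA : (\int[P]_w h (A w) <= (eps / 4)%:E)%E.
  have law : is_mgauss (fun D => P (A @^-1` D)).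
    move=> B mB; have := ai B mB.
    rewrite (_ : A @^-1` box B = [set w | forall i j, B i j (a i j w)]); last first.
      by apply/seteqP; split=> w /= + i j => /(_ i j); rewrite mxE.
    move=> ->; apply: eq_bigr => i _; apply: eq_bigr => j _; exact: an.
  apply: le_trans hbad; rewrite le_eqVlt; apply/orP; left; apply/eqP.
  apply: (etrans (mgauss_push mA law mh h0)).
  apply: etrans (esym (mgauss_col_mx mbd bd0)).
  exact: (esym (@fubini_tonelli _ _ _ _ _ (mgauss 1 N) (mgauss m N) _ mcol (fun z => bd0 _))).
(* By Markov's inequality the complement has probability at most 2 (eps / 4) = eps / 2. *)
pose E := [set w | (h (A w) < (2^-1)%:E)%E].
have mhA : measurable_fun setT (fun w => h (A w)) by exact: (measurableT_comp mh mA).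
have mE : measurable E.
  have := emeasurable_fun_infty_o measurableT mhA (2^-1)%:E.
  by rewrite setTI; congr measurable; apply/seteqP; split => w; rewrite /= in_itv.
exists E; split=> //; split; last first.
  have mEC : measurable_fun setT (fun w => ((2^-1)%:E <= h (A w))%E).
    by apply: measurable_fun_lee; [exact: measurable_cst|exact: mhA].
  have PEC : (P (~` E) <= (eps / 2)%:E)%E.
    have -> : ~` E = [set w | ((2^-1)%:E <= h (A w))%E].
      by apply/seteqP; split=> w /=; rewrite leNgt => /negP.
    rewrite -(integral_bE P mEC).
    apply: (@le_trans _ _ (2%:E * \int[P]_w h (A w))%E); last first.
      apply: (le_trans (lee_wpmul2l _ hA)); first by rewrite lee_fin.
      by rewrite -EFinM lee_fin; lra.
    rewrite -(ge0_integralZl P measurableT mhA (fun w _ => h0 _)); last by rewrite lee_fin.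
    apply: ge0_le_integral => //.
    - by move=> w _; exact: bE_ge0.
    - exact: measurable_bE.
    - by apply: measurable_funeM.
    - move=> w _; have [hw|_] := boolP ((2^-1)%:E <= h (A w))%E; last by rewrite mule_ge0// h0.
      have h2 : (2%:E * (2^-1)%:E <= 2%:E * h (A w))%E by apply: lee_wpmul2l; rewrite ?lee_fin.
      by apply: le_trans h2; rewrite -EFinM divff.
  have := probability_setC P (measurableC mE); rewrite setCK => ->.
  apply: (@lt_le_trans _ _ (1 - (eps / 2)%:E)%E); last by rewrite leeB.
  by rewrite -EFinB lte_fin; lra.
move=> w Ew; split; first exact: x0feas.
move=> x [xA xbox] xx0; rewrite ltNge; apply/negP => lx.
pose dd : 'rV[R]_N := (x - x0)^T.
have ddE i : dd 0 i = x i 0 - x0 i 0 by rewrite !mxE.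
(* On the box the l1 norm is linear, so a competitor with no larger norm gives a difference with
   nonpositive sum. *)
have sumE (y : 'cV[R]_N) : (forall j, 0 <= y j 0 <= L%:R) -> l1norm y = \sum_i y i 0.
  by move=> yb; apply: eq_bigr => i _; rewrite ger0_norm//; case/andP: (yb i).
have ddC : descent_cone Khat (K L) dd.
  split=> [i|]; last first.
    under eq_bigr do rewrite ddE.
    by rewrite sumrB subr_le0 -!sumE.
  rewrite finset.in_setD negb_and negbK ddE /sg => /orP[iL|iN].
    by rewrite iL mulN1r oppr_ge0 x0L// subr_le0; case/andP: (xbox i).
  rewrite ifN; last by apply: contra iN; exact: KLall.
  by rewrite mul1r x0N// subr0; case/andP: (xbox i).
have dd0 : dd != 0.
  by apply/eqP => /(congr1 trmx); rewrite trmxK trmx0 => /eqP; rewrite subr_eq0 => /eqP.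
have Add : dd *m (A w)^T = 0.
  rewrite -trmx_mul; have -> : A w *m (x - x0) = 0; last by rewrite trmx0.
  have sm : Num.sqrt (m%:R : R) != 0 by rewrite gt_eqF// sqrtr_gt0 ltr0n.
  have -> : A w = Num.sqrt m%:R *: gauss_mx a w.
    by apply/matrixP => i j; rewrite !mxE mulVKf.
  by rewrite -scalemxAl mulmxBr xA subrr scaler0.
move: Ew; rewrite /E /= ltNge => /negP; apply.
apply: (le_trans (halfspace_half dd0)).
apply: ge0_le_integral => //.
- by move=> g _; exact: bE_ge0.
- apply: (@measurable_bE R _ _ _); apply: measurable_fun_ltr; first exact: measurable_cst.
  by apply: measurable_dot; [exact: measurable_id|exact: measurable_cst].
- exact: (measurableT_comp mcol (pair2_measurable _)).
- move=> g _; have [gd|_] := boolP (0 < dot g dd); last exact: bd0.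
  exact: (kernel_bad _ ddC Add gd).
Qed.
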